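(* Let $T>0$, $\alpha\in(0,1)$, $f\in C^{2+\alpha}_H(X)$ and $g\in C^{0,\alpha}_H([0,T]\times X)$. Define $$v(t,x)=T(t)f(x)+\int_0^t T(t-s)g(s,\cdot)(x)\,ds,\qquad t\in[0,T],\ x\in X.$$ Then $v\in C^{0,2+\alpha}_H([0,T]\times X)$. Moreover, there exists $C=C(T)>0$, independent of $f$ and $g$, such that $$\|v\|_{C^{0,2+\alpha}_H([0,T]\times X)}\le C\big(\|f\|_{C^{2+\alpha}_H(X)}+\|g\|_{C^{0,\alpha}_H([0,T]\times X)}\big).$$
   Context: Let $X$ be a separable real Banach space endowed with a centered Gaussian measure $\gamma$. Let $H\subset X$ be the associated Cameron–Martin space, with norm $\|\cdot\|_H$. $C_b(\cdot)$ denotes bounded continuous real functions with sup norm $\|\cdot\|_\infty$. The Ornstein–Uhlenbeck semigroup is $$T(t)f(x)=\int_X f\big(e^{-t}x+\sqrt{1-e^{-2t}}\,y\big)\,\gamma(dy),\qquad t\ge0 .$$ $H$-differentiability. $F:X\to Y$ ($Y$ a Banach space) is $H$-differentiable at $x$ if there is a bounded linear $\ell:H\to Y$ with $\|F(x+h)-F(x)-\ell(h)\|_Y/\|h\|_H\to0$ as $\|h\|_H\to0$. For real $f$ write $\ell=D_Hf(x)$. The second derivative $D^2_Hf(x)$ lies in $\mathcal L^{(2)}(H)$, the space of bounded bilinear forms on $H$. Function spaces. - $C^2_H(X)$ is the set of $f\in C_b(X)$ twice $H$-differentiable everywhere with $D_Hf$, $D^2_Hf$ bounded and continuous. Its norm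 is $\|f\|_\infty+\sup\|D_Hf\|+\sup\|D^2_Hf\|$. - For $\alpha\in(0,1)$, $C^\alpha_H(X,Y)$ is the set of bounded continuous $F:X\to Y$ with $[F]_\alpha:=\sup_{x,\,h\in H\setminus\{0\}}\|F(x+h)-F(x)\|_Y/\|h\|_H^\alpha<\infty$. Its norm is $\|F\|_\infty+[F]_\alpha$, and $C^\alpha_H(X)=C^\alpha_H(X,\mathbb R)$. - $C^{2+\alpha}_H(X)$ is the set of $f\in C^2_H(X)$ with $D^2_Hf\in C^\alpha_H(X,\mathcal L^{(2)}(H))$. Its norm is $\|f\|_{C^2_H}+[D^2_Hf]_\alpha$. - $C^{0,\alpha}_H([0,T]\times X)$ is the set of $g\in C_b([0,T]\times X)$ with $g(t,\cdot)\in C^\alpha_H(X)$ for all $t$ and $\|g\|_{C^{0,\alpha}_H}:=\sup_{t\in[0,T]}\|g(t,\cdot)\|_{C^\alpha_H(X)}<\infty$. - $C^{0,2+\alpha}_H([0,T]\times X)$ is the set of $v\in C_b([0,T]\times X)$ with $v(t,\cdot)\in C^{2+\alpha}_H(X)$ for all $t$ and $\|v\|_{C^{0,2+\alpha}_H}:=\sup_{t\in[0,T]}\|v(t,\cdot)\|_{C^{2+\alpha}_H(X)}<\infty$. *)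

(* Defs.v *)
From HB Require Import structures.
From mathcomp Require Import all_boot all_order all_algebra.
From mathcomp Require Import all_classical all_reals all_analysis.
Set Implicit Arguments.
Unset Strict Implicit.
Unset Printing Implicit Defensive.
Import Order.TTheory GRing.Theory Num.Theory.
Import numFieldNormedType.Exports.
Local Open Scope classical_set_scope.
Local Open Scope ring_scope.

Section GaussianSetting.
Context {R : realType} (X : normedModType R).

Definition borel_X := g_sigma_algebraType (@open X).
Definition toX (y : borel_X) : X := y.

Definition separable_space : Prop :=
  exists D : set X, countable D /\ closure D = setT.

Definition cont_linear_functional (l : X -> R) : Prop :=
  [/\ (forall x y, l (x + y) = l x + l y),
      (forall (a : R) x, l (a *: x) = a * l x) &
      continuous l].

Variable gam : probability borel_X R.

Definition centered_gaussian : Prop :=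
  forall l, cont_linear_functional l ->
    exists s : R, 0 <= s /\
      forall A : set R, measurable A ->
        gam ((l \o toX) @^-1` A) =
          (if s == 0 then \d_(0 : R) A else normal_prob 0 s A).

Definition cm_enorm (h : X) : \bar R :=
  ereal_sup [set (l h)%:E | l in
    [set l | cont_linear_functional l /\
             (\int[gam]_y ((l (toX y)) ^+ 2)%:E <= 1)%E]].

Definition CM : set X := [set h | (cm_enorm h < +oo)%E].

Definition cm_norm (h : X) : R := fine (cm_enorm h).

(** norm in H^* of a functional (only its values on H matter) *)
Definition dual_norm (phi : X -> R) : \bar R :=
  ereal_sup [set `|phi k|%:E | k in [set k | CM k /\ cm_norm k <= 1]].

(** norm in L^(2)(H) of a bilinear form (only its values on H x H matter) *)
Definition bil_norm (B : X -> X -> R) : \bar R :=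
  ereal_sup [set `|B p.1 p.2|%:E | p in
    [set p : X * X | [/\ CM p.1, CM p.2, cm_norm p.1 <= 1 & cm_norm p.2 <= 1]]].

Definition sup_norm (f : X -> R) : \bar R := ereal_sup (range (fun x => `|f x|%:E)).

Definition Cb (f : X -> R) : Prop :=
  continuous f /\ exists M : R, forall x, `|f x| <= M.

Definition H_bounded_linear (phi : X -> R) : Prop :=
  [/\ (forall h k, CM h -> CM k -> phi (h + k) = phi h + phi k),
      (forall (a : R) h, CM h -> phi (a *: h) = a * phi h) &
      (dual_norm phi < +oo)%E].

Definition H_bounded_bilinear (B : X -> X -> R) : Prop :=
  [/\ (forall k, CM k -> H_bounded_linear (B ^~ k)),
      (forall h, CM h -> H_bounded_linear (B h)) &
      (bil_norm B < +oo)%E].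

(** f is twice H-differentiable everywhere, with D_H f = Df, D^2_H f = D2f
    (D2f x h k = D^2_H f(x)(h,k), i.e. the derivative of D_H f in the
    direction h, applied to k), and f, D_H f, D^2_H f are bounded and
    continuous: f in C^2_H(X). *)
Definition C2H (f : X -> R) (Df : X -> X -> R) (D2f : X -> X -> X -> R) : Prop :=
  [/\ Cb f,
      (forall x, H_bounded_linear (Df x)) /\
      (forall x, H_bounded_bilinear (D2f x)),
      (forall x (e : R), 0 < e -> exists d : R, 0 < d /\
         forall h, CM h -> 0 < cm_norm h < d ->
           `|f (x + h) - f x - Df x h| <= e * cm_norm h) /\
      (forall x (e : R), 0 < e -> exists d : R, 0 < d /\
         forall h, CM h -> 0 < cm_norm h < d ->
           (dual_norm (fun k => Df (x + h) k - Df x k - D2f x h k)%R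
              <= (e * cm_norm h)%:E)%E),
      (ereal_sup (range (fun x => dual_norm (Df x))) < +oo)%E /\
      (ereal_sup (range (fun x => bil_norm (D2f x))) < +oo)%E &
      (forall x (e : R), 0 < e -> exists d : R, 0 < d /\
         forall y, `|y - x| < d ->
           (dual_norm (fun k => Df y k - Df x k)%R <= e%:E)%E) /\
      (forall x (e : R), 0 < e -> exists d : R, 0 < d /\
         forall y, `|y - x| < d ->
           (bil_norm (fun h k => D2f y h k - D2f x h k)%R <= e%:E)%E)].

Definition C2H_norm (f : X -> R) (Df : X -> X -> R) (D2f : X -> X -> X -> R)
  : \bar R :=
  (sup_norm f + ereal_sup (range (fun x => dual_norm (Df x)))
   + ereal_sup (range (fun x => bil_norm (D2f x))))%E.

Definition holder_H (a : R) (F : X -> R) : \bar R :=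
  ereal_sup [set (`|F (p.1 + p.2) - F p.1| / (cm_norm p.2 `^ a))%:E
            | p in [set p : X * X | CM p.2 /\ p.2 != 0]].

Definition holder_bil (a : R) (B : X -> X -> X -> R) : \bar R :=
  ereal_sup [set (bil_norm (fun h k => B (p.1 + p.2) h k - B p.1 h k)%R
                   * ((cm_norm p.2 `^ a)^-1)%:E)%E
            | p in [set p : X * X | CM p.2 /\ p.2 != 0]].

Definition CaH (a : R) (F : X -> R) : Prop :=
  Cb F /\ (holder_H a F < +oo)%E.
Definition CaH_norm (a : R) (F : X -> R) : \bar R :=
  (sup_norm F + holder_H a F)%E.

Definition C2aH (a : R) (f : X -> R) Df D2f : Prop :=
  C2H f Df D2f /\ (holder_bil a D2f < +oo)%E.
Definition C2aH_norm (a : R) (f : X -> R) Df D2f : \bar R :=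
  (C2H_norm f Df D2f + holder_bil a D2f)%E.

Definition Cb_TX (T : R) (g : R -> X -> R) : Prop :=
  {within [set` `[0, T]] `*` [set: X], continuous (fun p : R * X => g p.1 p.2)} /\
  exists M : R, forall t x, [set` `[0, T]] t -> `|g t x| <= M.

Definition C0aH_norm (T a : R) (g : R -> X -> R) : \bar R :=
  ereal_sup [set CaH_norm a (g t) | t in [set` `[0, T]]].
Definition C0aH (T a : R) (g : R -> X -> R) : Prop :=
  [/\ Cb_TX T g, (forall t, [set` `[0, T]] t -> CaH a (g t)) &
      (C0aH_norm T a g < +oo)%E].

Definition C02aH_norm (T a : R) (v : R -> X -> R) Dv D2v : \bar R :=
  ereal_sup [set C2aH_norm a (v t) (Dv t) (D2v t) | t in [set` `[0, T]]].
Definition C02aH (T a : R) (v : R -> X -> R) Dv D2v : Prop :=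
  [/\ Cb_TX T v, (forall t, [set` `[0, T]] t -> C2aH a (v t) (Dv t) (D2v t)) &
      (C02aH_norm T a v Dv D2v < +oo)%E].

Definition OU (t : R) (f : X -> R) (x : X) : R :=
  \int[gam]_(y in [set: borel_X])
     f (expR (- t) *: x + Num.sqrt (1 - expR (- (2 * t))) *: toX y).

Definition mild_sol (f : X -> R) (g : R -> X -> R) (t : R) (x : X) : R :=
  OU t f x + \int[lebesgue_measure]_(s in [set` `[0, t]]) OU (t - s) (g s) x.

End GaussianSetting.

(* Main.v *)
(* Translating [x] by [h] in [OU t g x] amounts to translating the Gaussian variable by
   [e^-t (1 - e^(-2t))^(-1/2) h], and the derivative of [k |-> E[G(. + k)]] at [0] in a
   Cameron-Martin direction [h] is [E[G h^]], where [h^] is an [L^2] limit of continuous linear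
   functionals. Hence the [n]-th [H]-derivative of [OU t g] is bounded by a multiple of
   [t^((a-n)/2)] times the [a]-Hoelder seminorm of [g]. This is integrable in time for
   [n <= 2]; for the Hoelder seminorm of the second derivative of the time integral, the
   increment over [h] is bounded by the second derivatives when [2(t-s) <= |h|^2] and by
   the third derivative otherwise, and both parts contribute [|h|^a]. On [C^(2+a)] the
   semigroup is bounded because it commutes with [H]-differentiation up to factors [e^-t].
   The identities between Gaussian integrals (integration by parts, rotation invariance, the
   mean value formula) are proved for cosines of functionals and extended to bounded
   pointwise limits of their linear combinations; on a separable space these include all
   bounded continuous functions, the bridge being a norming functional for each vector. *)
Require Import Defs.
From HB Require Import structures.
From mathcomp Require Import all_boot all_order all_algebra.
From mathcomp Require Import all_classical all_reals all_analysis.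
From mathcomp Require Import measurable_realfun ring lra.
Import Order.TTheory GRing.Theory Num.Theory.
Import numFieldNormedType.Exports.
Local Open Scope classical_set_scope.
Local Open Scope ring_scope.
Set Implicit Arguments.
Unset Strict Implicit.
Unset Printing Implicit Defensive.

(** * Norming functionals *)

(** Two bounds on the derivatives of E[G(. + x)] at 0 carry the proof. The bound by the sup norm of
    G, applied to increments of G along a unit direction, trades one derivative for the Hoelder
    seminorm. The bound by the L^2 norm of G gives continuity in x in the operator norms: the
    directions split off as a factor, and the remaining L^2 distance between two translated
    functions tends to 0 by dominated convergence, although a continuous function on X need not be
    uniformly continuous. Suprema and limits in operator norm do not pass well through integrals.
    The record [C2a_est] therefore works with explicit candidates for the derivatives and with
    homogeneous inequalities for fixed directions, all with one constant: bounds, Taylor remainders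
    of order |h|^2 and |h|^(1+a), a Hoelder increment, and moduli of continuity uniform in the
    directions. The inequalities survive expectations and sums, and the time integral produces them
    anew; only at the end are they turned back into membership and norms. *)

Section HahnBanach.
Context {R : realType} {X : normedModType R}.

Let dominated_graph (z : X * R) (G : set (X * R)) : Prop :=
  [/\ (forall (c : R) p q, G p -> G q -> G (c *: p.1 + q.1, c * p.2 + q.2)),
      (forall p, G p -> p.2 <= `|p.1|) &
      (forall p, G p -> G z)].

(** Two values over one point make every multiple of their difference a value over 0, where
    domination allows only nonpositive ones. *)
Let dominated_graph_fun z G x r s : dominated_graph z G -> G (x, r) -> G (x, s) -> r = s.
Proof.
move=> [lG dG _] Gr Gs.
have G0 c : G (0, c * (r - s)).
  have G1 := lG (-1) _ _ Gr Gr.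
  rewrite /= scaleN1r mulN1r !addNr in G1.
  have := lG c _ _ (lG (-1) _ _ Gs Gr) G1.
  by rewrite /= scaleN1r mulN1r !addNr addr0 scaler0 addr0 addrC (addrC r).
have H c := dG _ (G0 c); rewrite /= in H.
apply/eqP; rewrite -subr_eq0; apply/eqP/le_anti/andP; split.
- by have := H 1; rewrite mul1r normr0.
- by have := H (-1); rewrite mulN1r normr0 oppr_le0.
Qed.

Let dominated_graph_extend z G y : dominated_graph z G -> G z -> ~ (exists r, G (y, r)) ->
  exists G', dominated_graph z G' /\ G `<` G'.
Proof.
move=> GP Gz ny; have [lG dG zG] := GP.
have G0 : G (0, 0).
  by have := lG (-1) _ _ Gz Gz; rewrite scaleN1r mulN1r !addNr.
have GZ c p : G p -> G (c *: p.1, c * p.2).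
  by move=> Gp; have := lG c _ _ Gp G0; rewrite !addr0.
pose S := [set p.2 - `|p.1 - y| | p in G].
have Sub p q : G p -> G q -> p.2 - `|p.1 - y| <= `|q.1 + y| - q.2.
  move=> Gp Gq; have := dG _ (lG 1 _ _ Gp Gq); rewrite /= scale1r mul1r => H.
  have : `|p.1 + q.1| <= `|p.1 - y| + `|q.1 + y|.
    by rewrite (_ : p.1 + q.1 = (p.1 - y) + (q.1 + y)) ?ler_normD// addrACA addNr addr0.
  lra.
have hS : has_sup S.
  split; first by exists (0 - `|0 - y|); exists (0,0).
  exists (`|0 + y| - 0) => _ [p Gp <-]; exact: (Sub p (0, 0)).
(* Any number separating the two families in [Sub] is an admissible value at [y]: the upper family
   controls positive multiples of [y], the lower one negative multiples. *)
pose c := sup S.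
have c1 p : G p -> p.2 - `|p.1 - y| <= c.
  by move=> Gp; apply: ub_le_sup; [exact: hS.2|exists p].
have c2 q : G q -> c <= `|q.1 + y| - q.2.
  move=> Gq; apply: ge_sup; first exact: hS.1.
  by move=> _ [p Gp <-]; exact: Sub.
exists [set w | exists p (t : R), [/\ G p, w.1 = p.1 + t *: y & w.2 = p.2 + t * c]].
split; [split|split].
- move=> b w1 w2 [p [t [Gp e1 e2]]] [q [u [Gq e3 e4]]].
  exists (b *: p.1 + q.1, b * p.2 + q.2), (b * t + u); split => /=.
  + exact: lG.
  + by rewrite e1 e3 scalerDr scalerA scalerDl addrACA.
  + by rewrite e2 e4; ring.
- move=> w [p [t [Gp -> ->]]].
  have [->|t0] := eqVneq t 0; first by rewrite scale0r mul0r !addr0; exact: dG.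
  have [tp|tn] := ltP 0 t.
  + have := c2 _ (GZ t^-1 _ Gp) => /=.
    rewrite (_ : p.1 + t *: y = t *: (t^-1 *: p.1 + y)); last first.
      by rewrite scalerDr scalerA divff// scale1r.
    rewrite normrZ gtr0_norm// => H.
    rewrite -(ler_pM2l tp) in H.
    have e : t * (t^-1 * p.2) = p.2 by rewrite mulrA divff// mul1r.
    rewrite mulrBr e in H; lra.
  + have {}tn : t < 0 by rewrite lt_neqAle t0.
    have tp : 0 < - t by rewrite oppr_gt0.
    have := c1 _ (GZ (- t)^-1 _ Gp) => /=.
    rewrite (_ : p.1 + t *: y = (- t) *: ((- t)^-1 *: p.1 - y)); last first.
      by rewrite scalerBr scalerA divff ?oppr_eq0// scale1r scaleNr opprK.
    rewrite normrZ gtr0_norm// => H.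
    rewrite -(ler_pM2l tp) in H.
    have e : (- t) * ((- t)^-1 * p.2) = p.2 by rewrite mulrA divff ?oppr_eq0// mul1r.
    rewrite mulrBr e in H; lra.
- move=> w [p [t [Gp e1 e2]]]; exists z, 0; rewrite scale0r mul0r !addr0; split => //.
- move=> w Gw; exists w, 0; rewrite scale0r mul0r !addr0; split => //.
- move=> sub; apply: ny; exists c; apply: sub.
  by exists (0, 0), 1; rewrite /= scale1r mul1r !add0r; split.
Qed.

Lemma norming_functional (x : X) : exists l : X -> R,
  [/\ cont_linear_functional l, forall y, `|l y| <= `|y| & l x = `|x|].
Proof.
pose z := (x, `|x|).
have [A [AP Amax]] : exists A, dominated_graph z A /\ forall B, A `<` B -> ~ dominated_graph z B.
  apply: Zorn_bigcup => F FP tot; split.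
  - move=> c p q [G1 FG1 Gp] [G2 FG2 Gq].
    have [s|s] := tot _ _ FG1 FG2.
    + by exists G2 => //; have [h _ _] := FP _ FG2; apply: h => //; exact: s.
    + by exists G1 => //; have [h _ _] := FP _ FG1; apply: h => //; exact: s.
  - by move=> p [G FG Gp]; have [_ h _] := FP _ FG; exact: h.
  - by move=> p [G FG Gp]; exists G => //; have [_ _ h] := FP _ FG; exact: h Gp.
(* An empty maximal graph would be strictly extended by the line through [z]. *)
have Az : A z.
  apply: contrapT => nz.
  have nA p : ~ A p by case: AP => _ _ h /h.
  apply: (Amax [set w | exists t : R, w = (t *: x, t * `|x|)]).
    split; first by move=> w /nA.
    by move=> /(_ z) h; apply/nz/h; exists 1; rewrite scale1r mul1r.
  split.
  - move=> c _ _ [t ->] [u ->]; exists (c * t + u) => /=.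
    by rewrite scalerA -scalerDl mulrA -mulrDl.
  - by move=> _ [t ->] /=; rewrite normrZ ler_wpM2r// ler_norm.
  - by move=> _ _; exists 1; rewrite scale1r mul1r.
have dom y : exists r, A (y, r).
  apply: contrapT => ny.
  have [B [BP AB]] := dominated_graph_extend AP Az ny.
  exact: Amax AB BP.
have [l lA] := choice dom.
have uni y r : A (y, r) -> l y = r by move=> Ay; exact: (dominated_graph_fun AP (lA y) Ay).
have [lin dA _] := AP.
have lD (c : R) u v : l (c *: u + v) = c * l u + l v.
  by apply: uni; have := lin c _ _ (lA u) (lA v).
have l0 : l 0 = 0 by have := lD (-1) 0 0; rewrite scaler0 addr0 mulN1r addNr.
have lZ (c : R) u : l (c *: u) = c * l u by rewrite -[c *: u]addr0 lD l0 addr0.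
have lB u v : l (u - v) = l u - l v by rewrite addrC -scaleN1r lD mulN1r addrC.
have bnd y : `|l y| <= `|y|.
  rewrite ler_norml; apply/andP; split; last exact: (dA _ (lA y)).
  have := dA _ (lA (- y)); rewrite /= normrN -scaleN1r lZ mulN1r; lra.
exists l; split => //; last exact: uni.
split => //; first by move=> u v; have := lD 1 u v; rewrite scale1r mul1r.
move=> y; apply/cvgrPdist_le => e e0.
near=> w; rewrite -lB; apply: le_trans (bnd _) _.
near: w; exact: cvgr_dist_le.
Unshelve. all: by end_near.
Qed.

End HahnBanach.

(** * Integration on the line and normal distributions *)

Section IntegrationTools.
Context d (T : measurableType d) {R : realType} (mu : {measure set T -> \bar R}).

Lemma Rintegral_dominated_convergence (D : set T) (f_ : nat -> T -> R) (f g : T -> R) :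
  measurable D -> (forall n, measurable_fun D (f_ n)) -> measurable_fun D f ->
  {ae mu, forall x, D x -> f_ n x @[n --> \oo] --> f x} ->
  mu.-integrable D (EFin \o g) -> (forall n x, D x -> `|f_ n x| <= g x) ->
  mu.-integrable D (EFin \o f) /\
  \int[mu]_(x in D) f_ n x @[n --> \oo] --> \int[mu]_(x in D) f x.
Proof.
move=> mD mf_ mf cf ig fg.
have [] := @dominated_convergence _ _ _ mu D mD (fun n => EFin \o f_ n) (EFin \o f) (EFin \o g).
- by move=> n; exact/measurable_EFinP.
- exact/measurable_EFinP.
- by apply: filterS cf => x h Dx; apply: cvg_EFin; [exact: nearW|exact: h].
- exact: ig.
- by apply: aeW => x n Dx; rewrite /= lee_fin; exact: fg.
move=> i _ c.
split => //; apply: fine_cvg; rewrite fineK//; exact: integrable_fin_num.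
Qed.

End IntegrationTools.

Section Density.
Context d (T : measurableType d) {R : realType} (mu : {sigma_finite_measure set T -> \bar R}).

(** A function with the right integrals over measurable sets agrees almost everywhere with the
    Radon-Nikodym derivative, to which the change of variables applies. *)
Lemma ge0_integral_density (nu : {finite_measure set T -> \bar R}) (p : T -> R) (f : T -> \bar R) :
  nu `<< mu -> measurable_fun setT p ->
  (forall A, measurable A -> nu A = \int[mu]_(x in A) (p x)%:E)%E ->
  measurable_fun setT f -> (forall x, 0 <= f x)%E ->
  (\int[nu]_x f x = \int[mu]_x (f x * (p x)%:E))%E.
Proof.
move=> numu mp nuE mf f0.
have id := Radon_Nikodym_SigmaFinite.f_integrable numu.
have md := measurable_int _ id.
have mEp : measurable_fun setT (EFin \o p) by exact/measurable_EFinP.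
rewrite -(Radon_Nikodym_SigmaFinite.change_of_variables numu f0 measurableT mf).
apply: ae_eq_integral => //; try exact: emeasurable_funM.
have : ae_eq mu setT (Radon_Nikodym_SigmaFinite.f nu mu) (EFin \o p).
  apply: integral_ae_eq => // A _ mA.
  by rewrite -Radon_Nikodym_SigmaFinite.f_integral// nuE.
by apply: filterS => x /= fp xT; rewrite fp.
Qed.

End Density.

(** * Fundamental theorem of calculus on segments and on the line *)

Section FundamentalTheoremLine.
Context {R : realType}.
Notation mu := (@lebesgue_measure R).

Lemma is_derive_continuous (F : R -> R) (f : R) (x : R) :
  is_derive x (1 : R) F f -> {for x, continuous F}.
Proof. by move=> [d _]; apply: differentiable_continuous; exact/derivable1_diffP. Qed.

Lemma is_derive_approx (F : R -> R) (x c : R) :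
  (forall e : R, 0 < e -> exists d : R, 0 < d /\
     forall r, 0 < `|r| < d -> `|F (x + r) - F x - r * c| <= e * `|r|) ->
  is_derive x (1 : R) F c.
Proof.
move=> H.
have cF : r^-1 *: (F (r *: (1 : R) + x) - F x) @[r --> 0^'] --> c.
  apply/cvgrPdist_le => e e0; have [d [d0 dP]] := H e e0.
  apply/nbhs_ballP; exists d => //= r; rewrite /ball/= sub0r normrN => rd r0.
  have r0' : 0 < `|r| by rewrite normr_gt0.
  rewrite -(ler_pM2l r0') -normrM /GRing.scale/= mulr1 [r + x]addrC mulrBr mulVKf// distrC.
  by rewrite [leRHS]mulrC; apply: dP; rewrite r0'.
by split; [exact: (cvgP _ cF)|exact: cvg_lim cF].
Qed.

(** Regularity is asked only to the left of [t], because the weights integrated later are singular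
    at [t]. *)
Lemma integral_derivative_segment_lt (F f : R -> R) (a b t : R) : a <= b -> b < t ->
  (forall x, x < t -> is_derive x (1 : R) F (f x)) -> (forall x, x < t -> {for x, continuous f}) ->
  (\int[mu]_(x in `[a, b]) (f x)%:E = (F b - F a)%:E)%E.
Proof.
rewrite le_eqVlt => /predU1P[->|ab] bt dF cf.
  by rewrite set_itv1 integral_set1 subrr.
rewrite (@continuous_FTC2 _ f F)//.
- apply: continuous_in_subspaceT => x; rewrite inE/= in_itv/= => /andP[_ xb].
  by apply: cf; exact: le_lt_trans bt.
- have cF x : x < t -> {for x, continuous F} by move=> xt; exact: (is_derive_continuous (dF x xt)).
  split.
  + by move=> x; rewrite in_itv/= => /andP[_ xb]; have [] := dF x (lt_trans xb bt).
  + exact/cvg_at_right_filter/cF/(lt_trans ab).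
  + exact/cvg_at_left_filter/cF.
- move=> x; rewrite in_itv/= => /andP[_ xb]; rewrite derive1E.
  by have [_ ->] := dF x (lt_trans xb bt).
Qed.

Lemma integral_derivative_segment (F f : R -> R) (a b : R) : a <= b ->
  (forall x, is_derive x (1 : R) F (f x)) -> continuous f ->
  (\int[mu]_(x in `[a, b]) (f x)%:E = (F b - F a)%:E)%E.
Proof.
move=> ab dF cf; apply: (@integral_derivative_segment_lt F f a b (b + 1) ab) => //.
- by rewrite ltrDl.
- by move=> x _; exact: cf.
Qed.

Let line := fun n : nat => `[- n.+1%:R, n.+1%:R]%classic : set R.

Let line_nd : nondecreasing_seq line.
Proof.
move=> m n mn; apply/subsetPset => x; rewrite /line/= !in_itv/= => /andP[h1 h2].
have h : m.+1%:R <= n.+1%:R :> R by rewrite ler_nat.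
by apply/andP; split; lra.
Qed.

Let line_cover (x : R) : exists N, forall n, (N <= n)%N -> line n x.
Proof.
exists (Num.truncn `|x|) => n Nn; rewrite /line/= in_itv/=.
have : `|x| <= n.+1%:R.
  by apply: le_trans (ltW (Num.Theory.truncnS_gt _)) _; rewrite ler_nat ltnS.
by rewrite ler_norml.
Qed.

Lemma ge0_integral_line_le (f : R -> R) (M : R) : measurable_fun setT f ->
  (forall x, 0 <= f x) ->
  (forall n : nat, \int[mu]_(x in `[(- n.+1%:R)%R, n.+1%:R]) (f x)%:E <= M%:E)%E ->
  (\int[mu]_x (f x)%:E <= M%:E)%E.
Proof.
move=> mf f0 fM.
have -> : [set: R] = \bigcup_n line n.
  apply/seteqP; split => x // _; have [N h] := line_cover x.
  by exists N => //; exact: h.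
have c := @ge0_nondecreasing_set_cvg_integral _ (measurableTypeR R) R line (EFin \o f) mu line_nd.
apply: (cvge_le _ (c _ _ _)).
- by apply: nearW => n; exact: fM.
- by move=> i; exact: measurable_itv.
- by move=> i; apply/measurable_EFinP/measurable_funTS.
- by move=> i x _; rewrite lee_fin.
Qed.

Lemma integral_derivative_line (F f : R -> R) :
  (forall x, is_derive x (1 : R) F (f x)) -> continuous f ->
  mu.-integrable setT (EFin \o f) ->
  F n.+1%:R @[n --> \oo] --> 0 -> F (- n.+1%:R) @[n --> \oo] --> 0 ->
  \int[mu]_x f x = 0.
Proof.
move=> dF cf fi F1 F2.
have mf : measurable_fun setT f by exact: continuous_measurable_fun.
have mfl n : measurable_fun setT (f \_ (line n)).
  by apply/(measurable_restrictT f); [exact: measurable_itv|exact: measurable_funTS].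
have [|||_ c] := @Rintegral_dominated_convergence _ (measurableTypeR R) R mu setT
  (fun n => f \_ (line n)) f (fun x => `|f x|) measurableT mfl mf.
- apply: aeW => x _; have [N h] := line_cover x.
  apply: cvg_near_cst; exists N => // n Nn /=.
  by rewrite patchE mem_set//; exact: h.
- exact: (integrable_abse fi).
- by move=> n x _; rewrite patchE; case: ifPn => // _; rewrite normr0.
apply: (cvg_unique _ c); first exact: norm_hausdorff.
rewrite (_ : (fun n => _) = (fun n => F n.+1%:R - F (- n.+1%:R))); last first.
  apply/funext => n; rewrite -Rintegral_mkcond /Rintegral.
  by rewrite (integral_derivative_segment _ dF)// -subr_ge0 opprK addr_ge0.
by rewrite -(subr0 (0 : R)); exact: cvgB.
Qed.

End FundamentalTheoremLine.

Section TaylorBounds.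
Context {R : realType}.

Lemma is_derive_quadratic (F : R -> R) (t d K : R) :
  (forall e, `|F (t + e) - F t - e * d| <= K * e ^+ 2) -> is_derive t (1 : R) F d.
Proof.
move=> H; apply: is_derive_approx => e e0; have K1 : 0 < `|K| + 1 by rewrite ltr_wpDl.
exists (e / (`|K| + 1)); split => [|r /andP[r0]]; first exact: divr_gt0.
rewrite ltr_pdivlMr// => re; apply: le_trans (H r) _.
rewrite -real_normK ?num_real// expr2 mulrA ler_wpM2r//.
by apply: le_trans (ltW re); rewrite mulrC ler_wpM2l//; have := ler_norm K; lra.
Qed.

Lemma sin_lipschitz (a b : R) : `|sin a - sin b| <= `|a - b|.
Proof.
wlog ab : a b / b <= a.
  by move=> h; have [/h//|/ltW /h] := leP b a; rewrite distrC (distrC a).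
have [c _ ->] := MVT_segment ab (fun x _ => is_derive_sin x) (continuous_subspaceT (@continuous_sin R)).
by rewrite normrM ler_piMl// ler_norml cos_geN1 cos_le1.
Qed.

Lemma cos_taylor1 (u v : R) : `|cos (u + v) - cos u + v * sin u| <= v ^+ 2.
Proof.
have [v0|v0] := leP 0 v.
- have uv : u <= u + v by rewrite lerDl.
  have [c] := MVT_segment uv (fun x _ => is_derive_cos x) (continuous_subspaceT (@continuous_cos R)).
  rewrite in_itv/= => /andP[c1 c2] ->.
  have -> : - sin c * (u + v - u) + v * sin u = v * (sin u - sin c) by ring.
  rewrite normrM expr2 ger0_norm// ler_wpM2l//.
  by apply: le_trans (sin_lipschitz _ _) _; rewrite ler_norml; apply/andP; split; lra.
- have uv : u + v <= u by rewrite gerDl ltW.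
  have [c] := MVT_segment uv (fun x _ => is_derive_cos x) (continuous_subspaceT (@continuous_cos R)).
  rewrite in_itv/= => /andP[c1 c2] e.
  have -> : cos (u + v) - cos u + v * sin u = v * (sin u - sin c).
    by rewrite -opprB e; ring.
  rewrite normrM ltr0_norm// -sqrrN expr2 ler_wpM2l ?oppr_ge0 ?(ltW v0)//.
  by apply: le_trans (sin_lipschitz _ _) _; rewrite ler_norml; apply/andP; split; lra.
Qed.

End TaylorBounds.

(** * Second moment and characteristic function of the normal law *)

Section NormalMoments.
Context {R : realType}.
Notation mu := (@lebesgue_measure R).

Let is_derive_mul (f g : R -> R) (x a b : R) : is_derive x (1 : R) f a -> is_derive x (1 : R) g b ->
  is_derive x (1 : R) (fun y => f y * g y) (f x * b + g x * a).
Proof. by move=> df dg; exact: (is_deriveM df dg). Qed.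

Let is_derive_scale (k : R) (f : R -> R) (x a : R) : is_derive x (1 : R) f a ->
  is_derive x (1 : R) (fun y => k * f y) (k * a).
Proof. by move=> df; exact: (is_deriveZ k df). Qed.

Let is_derive_affine (k c x : R) : is_derive x (1 : R) (fun y => k * y + c) k.
Proof.
have := is_deriveD (is_derive_scale k (is_derive_id x 1)) (is_derive_cst c x 1).
by rewrite mulr1 addr0.
Qed.

Let is_derive_sqr (x : R) : is_derive x (1 : R) (fun y => y ^+ 2) (2 * x).
Proof.
have := is_derive_mul (is_derive_id x 1) (is_derive_id x 1).
rewrite mulr1 (_ : x + x = 2 * x); last by ring.
by rewrite (_ : (fun y : R => id y * id y) = (fun y => y ^+ 2)).
Qed.

Lemma is_derive_continuousT (F f : R -> R) :
  (forall x, is_derive x (1 : R) F (f x)) -> continuous F.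
Proof. by move=> dF x; exact: (is_derive_continuous (dF x)). Qed.

Variable s : R.
Hypothesis s_gt0 : 0 < s.
Let p : R -> R := normal_pdf 0 s.
Let s0 : s != 0. Proof. by rewrite gt_eqF. Qed.

Let pE : p = fun x => normal_peak s * expR (- (s ^+ 2 *+ 2)^-1 * x ^+ 2).
Proof.
rewrite /p normal_pdfE//; apply/funext => x; rewrite /normal_fun subr0.
by rewrite !mulNr (mulrC (x ^+ 2)).
Qed.

Let is_derive_pdf x : is_derive x (1 : R) p (- (x / s ^+ 2) * p x).
Proof.
rewrite pE.
have d := @is_derive1_comp R expR (fun y => - (s ^+ 2 *+ 2)^-1 * y ^+ 2) x _ _ (is_derive_expR (- (s ^+ 2 *+ 2)^-1 * x ^+ 2))
  (is_derive_scale (- (s ^+ 2 *+ 2)^-1) (is_derive_sqr x)).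
apply: is_derive_eq (is_derive_scale (normal_peak s) d) _.
by rewrite -mulr_natr; field.
Qed.

Let p_ge0 x : 0 <= p x. Proof. exact: normal_pdf_ge0. Qed.

Let continuous_pdf : continuous p. Proof. exact: continuous_normal_pdf. Qed.

Let pdf_even x : p (- x) = p x.
Proof. by rewrite pE sqrrN. Qed.

Let pdf_decay x : x ^+ 2 * p x <= normal_peak s * (s ^+ 2 *+ 2).
Proof.
rewrite pE mulrCA ler_wpM2l ?normal_peak_ge0//.
have q0 : 0 < s ^+ 2 *+ 2 by rewrite mulrn_wgt0 // exprn_gt0.
have := expR_ge1Dx ((s ^+ 2 *+ 2)^-1 * x ^+ 2).
rewrite mulNr expRN => h.
rewrite -ler_pdivlMr ?invr_gt0 ?expR_gt0// invrK -ler_pdivrMl//.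
by apply: le_trans h; rewrite lerDr.
Qed.

Let inv_cvg0 : ((n.+1%:R : R)^-1) @[n --> \oo] --> (0 : R).
Proof. exact: cvg_harmonic. Qed.

Let pdf_mul_cvg0 : n.+1%:R * p n.+1%:R @[n --> \oo] --> 0.
Proof.
have h : (normal_peak s * (s ^+ 2 *+ 2)) * (n.+1%:R : R)^-1 @[n --> \oo] --> 0.
  by rewrite -(mulr0 (normal_peak s * (s ^+ 2 *+ 2))); apply: cvgMl_tmp; exact: inv_cvg0.
apply: (@squeeze_cvgr _ _ _ _ (fun=> 0) (fun n : nat => normal_peak s * (s ^+ 2 *+ 2) * (n.+1%:R)^-1)).
- apply: nearW => n; rewrite mulr_ge0//= ler_pdivlMr//.
  by rewrite mulrC mulrA -expr2; exact: pdf_decay.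
- exact: cvg_cst.
- exact: h.
Qed.

Let pdf_cvg0 : p n.+1%:R @[n --> \oo] --> 0.
Proof.
apply: (@squeeze_cvgr _ _ _ _ (fun=> 0) (fun n : nat => n.+1%:R * p n.+1%:R)).
- apply: nearW => n; rewrite p_ge0/= ler_peMl// ler1n//.
- exact: cvg_cst.
- exact: pdf_mul_cvg0.
Qed.

Let measurable_pdf : measurable_fun setT p. Proof. exact: measurable_normal_pdf. Qed.

Let measurable_sqr_pdf : measurable_fun setT (fun x : R => x ^+ 2 * p x).
Proof. by apply: measurable_funM => //; exact: measurable_funX. Qed.

Let integrable_pdf : mu.-integrable setT (EFin \o p).
Proof. exact: integrable_normal_pdf. Qed.

Let is_derive_xpdf x :
  is_derive x (1 : R) (fun y => - s ^+ 2 * (y * p y)) (x ^+ 2 * p x - s ^+ 2 * p x).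
Proof.
have d := is_derive_mul (is_derive_id x 1) (is_derive_pdf x).
by apply: is_derive_eq (is_derive_scale (- s ^+ 2) d) _; field.
Qed.

Let continuous_sqr_pdf : continuous (fun x : R => x ^+ 2 * p x).
Proof.
move=> x; apply: cvgM; last exact: continuous_pdf.
by have := is_derive_continuousT is_derive_sqr; apply.
Qed.

Let continuous_xpdf' : continuous (fun x : R => x ^+ 2 * p x - s ^+ 2 * p x).
Proof.
move=> x; apply: cvgB; first exact: continuous_sqr_pdf.
by apply: cvgMl_tmp; exact: continuous_pdf.
Qed.

(** The function x^2 p - s^2 p has the primitive - s^2 x p. Over a symmetric interval its integral
    is a nonpositive boundary term, so the integral of x^2 p stays below s^2. Once integrability is
    known, the boundary term vanishes in the limit and the second moment is exact. *)
Lemma integrable_sqr_normal_pdf : mu.-integrable setT (EFin \o (fun x : R => x ^+ 2 * p x)).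
Proof.
have pp x : 0 <= x ^+ 2 * p x by rewrite mulr_ge0// sqr_ge0.
apply/integrableP; split; first exact/measurable_EFinP.
under eq_integral do rewrite /= ger0_norm//.
apply: le_lt_trans (ltry (s ^+ 2)).
apply: ge0_integral_line_le => // n.
have ii f : continuous f -> mu.-integrable `[- n.+1%:R, n.+1%:R] (EFin \o f).
  move=> cf; apply: continuous_compact_integrable; first exact: segment_compact.
  exact: continuous_subspaceT.
under eq_integral => x _ do rewrite -[x ^+ 2 * p x](subrK (s ^+ 2 * p x)).
rewrite integralD_EFin//; last 2 first.
- exact: ii.
- by apply: ii => x; apply: cvgMl_tmp; exact: continuous_pdf.
rewrite (integral_derivative_segment _ is_derive_xpdf continuous_xpdf'); last first.
  by rewrite -subr_ge0 opprK addr_ge0.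
have -> : - s ^+ 2 * (n.+1%:R * p n.+1%:R) - (- s ^+ 2 * (- n.+1%:R * p (- n.+1%:R))) =
   - (s ^+ 2 * 2 * (n.+1%:R * p n.+1%:R)) by rewrite pdf_even; ring.
apply: (@le_trans _ _ (\int[mu]_(x in `[(- n.+1%:R)%R, n.+1%:R]) (s ^+ 2 * p x)%:E)%E).
  rewrite geeDr// lee_fin oppr_le0; apply: mulr_ge0; apply: mulr_ge0 => //; exact: sqr_ge0.
apply: (@le_trans _ _ (\int[mu]_x (s ^+ 2 * p x)%:E)%E).
  apply: ge0_subset_integral => //.
  - by apply/measurable_EFinP; exact: measurable_funM.
  - by move=> x _; rewrite lee_fin mulr_ge0// sqr_ge0.
under eq_integral do rewrite EFinM.
by rewrite integralZl// integral_normal_pdf mule1.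
Qed.

Lemma integral_sqr_normal_pdf : \int[mu]_x (x ^+ 2 * p x) = s ^+ 2.
Proof.
have i2 : mu.-integrable setT (EFin \o (fun x : R => s ^+ 2 * p x)).
  exact: (integrableZl _ _ integrable_pdf).
have i3 : mu.-integrable setT (EFin \o (fun x : R => x ^+ 2 * p x - s ^+ 2 * p x)).
  exact: (integrableB _ integrable_sqr_normal_pdf i2).
have i1 := integrable_sqr_normal_pdf.
have := integral_derivative_line is_derive_xpdf continuous_xpdf' i3.
rewrite RintegralB// RintegralZl// => h.
have e1 : \int[mu]_x p x = 1 by rewrite /Rintegral integral_normal_pdf.
apply/eqP; rewrite -subr_eq0; move: h; rewrite e1 mulr1 => ->//.
- rewrite -(mulr0 (- s ^+ 2)); apply: cvgMl_tmp; exact: pdf_mul_cvg0.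
- rewrite (_ : (fun n => _) = (fun n : nat => s ^+ 2 * (n.+1%:R * p n.+1%:R))); last first.
    by apply/funext => n; rewrite pdf_even; ring.
  rewrite -(mulr0 (s ^+ 2)); apply: cvgMl_tmp; exact: pdf_mul_cvg0.
Qed.

Let continuous_trig (f : R -> R) (t c : R) : continuous f -> continuous (fun x => f (t * x + c)).
Proof.
move=> cf x; apply: (@continuous_comp _ _ _ (fun x => t * x + c) f); last exact: cf.
by have := is_derive_continuousT (is_derive_affine t c); apply.
Qed.

Let integrable_bounded_pdf (f : R -> R) : continuous f -> (forall x, `|f x| <= 1) ->
  mu.-integrable setT (EFin \o (fun x => f x * p x)).
Proof.
move=> cf f1; apply: le_integrable integrable_pdf => //.
- apply/measurable_EFinP; apply: measurable_funM => //; exact: continuous_measurable_fun.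
- by move=> x _; rewrite /= lee_fin normrM ler_piMl.
Qed.

Let integrable_lin_pdf (f : R -> R) : continuous f -> (forall x, `|f x| <= 1) ->
  mu.-integrable setT (EFin \o (fun x => x * f x * p x)).
Proof.
move=> cf f1.
apply: le_integrable (integrableD _ integrable_pdf integrable_sqr_normal_pdf) => //.
- apply/measurable_EFinP; apply: measurable_funM => //; apply: measurable_funM => //.
  exact: continuous_measurable_fun.
- move=> x _; rewrite /= lee_fin !normrM (ger0_norm (p_ge0 x)) -{2}(mul1r (p x)) -mulrDl.
  rewrite [leRHS]ger0_norm ?mulr_ge0 ?addr_ge0 ?sqr_ge0// ler_wpM2r//.
  apply: le_trans (_ : `|x| <= _); first by rewrite ler_piMr.
  rewrite -(real_normK (num_real x)); have := sqr_ge0 (`|x| - 1).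
  have := normr_ge0 x; nra.
Qed.

Let sin1 t c x : `|sin (t * x + c)| <= 1 :> R.
Proof. by rewrite ler_norml sin_geN1 sin_le1. Qed.

Let cos1 t c x : `|cos (t * x + c)| <= 1 :> R.
Proof. by rewrite ler_norml cos_geN1 cos_le1. Qed.

Let integral_x_sin (t c : R) :
  \int[mu]_x (x * sin (t * x + c) * p x) = s ^+ 2 * t * \int[mu]_x (cos (t * x + c) * p x).
Proof.
pose F x := - s ^+ 2 * (sin (t * x + c) * p x).
pose f x := x * sin (t * x + c) * p x - s ^+ 2 * t * (cos (t * x + c) * p x).
have dF x : is_derive x (1 : R) F (f x).
  have d := @is_derive1_comp R sin (fun y => t * y + c) x _ _ (is_derive_sin _) (is_derive_affine t c x).
  apply: is_derive_eq (is_derive_scale (- s ^+ 2) (is_derive_mul d (is_derive_pdf x))) _.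
  by rewrite /f /=; field.
have i1 := integrable_lin_pdf (@continuous_trig _ t c (@continuous_sin R)) (sin1 t c).
have i2 := integrable_bounded_pdf (@continuous_trig _ t c (@continuous_cos R)) (cos1 t c).
have i3 : mu.-integrable setT (EFin \o (fun x : R => s ^+ 2 * t * (cos (t * x + c) * p x))).
  exact: (integrableZl _ _ i2).
have i4 : mu.-integrable setT (EFin \o f) by exact: (integrableB _ i1 i3).
have cf : continuous f.
  move=> x; apply: cvgB; [apply: cvgM|apply: cvgMl_tmp; apply: cvgM]; try exact: continuous_pdf.
  - by apply: cvgM; [exact: cvg_id|exact: continuous_trig (@continuous_sin R) _].
  - exact: (@continuous_trig _ t c (@continuous_cos R)).
have lim0 (u : nat -> R) : p (u n) @[n --> \oo] --> 0 -> F (u n) @[n --> \oo] --> 0.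
  move=> h; rewrite -(mulr0 (- s ^+ 2)); apply: cvgMl_tmp.
  apply: norm_cvg0; apply: (@squeeze_cvgr _ _ _ _ (fun=> 0) (fun n => p (u n))) => //.
    apply: nearW => n; by rewrite normr_ge0/= normrM (ger0_norm (p_ge0 _)) ler_piMl.
  exact: cvg_cst.
have := integral_derivative_line dF cf i4 (lim0 _ pdf_cvg0).
rewrite /f RintegralB// RintegralZl// => h.
apply/eqP; rewrite -subr_eq0; apply/eqP; apply: h; apply: lim0.
by under eq_cvg do rewrite pdf_even; exact: pdf_cvg0.
Qed.

Lemma integrable_cos_normal_pdf (t c : R) :
  mu.-integrable setT (EFin \o (fun x => cos (t * x + c) * p x)).
Proof.
exact: integrable_bounded_pdf (@continuous_trig _ t c (@continuous_cos R)) (cos1 t c).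
Qed.

(** As a function of [t] the integral solves phi' = - s^2 t phi, by [integral_x_sin]; multiplied by
    exp(s^2 t^2 / 2) it becomes constant, equal to its value cos c at 0. The phase [c] lets cosines
    stand for sines as well. *)
Lemma integral_cos_normal_pdf (t c : R) :
  \int[mu]_x (cos (t * x + c) * p x) = cos c * expR (- (s ^+ 2 * t ^+ 2) / 2).
Proof.
pose phi t := \int[mu]_x (cos (t * x + c) * p x).
have ic u : mu.-integrable setT (EFin \o (fun x => cos (u * x + c) * p x)).
  exact: integrable_cos_normal_pdf.
have dphi u : is_derive u (1 : R) phi (- (s ^+ 2 * u * phi u)).
  rewrite -integral_x_sin.
  have i1 := integrable_lin_pdf (@continuous_trig _ u c (@continuous_sin R)) (sin1 u c).
  apply: (@is_derive_quadratic _ _ _ _ (s ^+ 2)) => e.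
  have -> : phi (u + e) - phi u - e * (- \int[mu]_x (x * sin (u * x + c) * p x)) =
    \int[mu]_x ((cos ((u + e) * x + c) * p x - cos (u * x + c) * p x) +
                e * (x * sin (u * x + c) * p x)).
    rewrite RintegralD//; last 2 first.
    - exact: (integrableB _ (ic _) (ic _)).
    - exact: (integrableZl _ _ i1).
    by rewrite RintegralB// RintegralZl// mulrN opprK.
  have i2 : mu.-integrable setT (EFin \o (fun x : R => (cos ((u + e) * x + c) * p x -
     cos (u * x + c) * p x) + e * (x * sin (u * x + c) * p x))).
    apply: (integrableD _ (integrableB _ (ic _) (ic _)) (integrableZl _ e i1)) => //.
  have i4 := integrable_sqr_normal_pdf.
  have i3 : mu.-integrable setT (EFin \o (fun x : R => e ^+ 2 * (x ^+ 2 * p x))).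
    exact: (integrableZl _ _ integrable_sqr_normal_pdf).
  apply: le_trans (le_normr_Rintegral _ i2) _ => //.
  rewrite mulrC -integral_sqr_normal_pdf -RintegralZl//.
  apply: le_Rintegral => //; first exact: (integrable_norm i2).
  move=> x _ /=.
  have -> : cos ((u + e) * x + c) * p x - cos (u * x + c) * p x + e * (x * sin (u * x + c) * p x)
    = (cos ((u * x + c) + e * x) - cos (u * x + c) + (e * x) * sin (u * x + c)) * p x.
    by rewrite (_ : (u + e) * x + c = u * x + c + e * x); ring.
  rewrite normrM (ger0_norm (p_ge0 x)) mulrA ler_wpM2r//.
  by apply: le_trans (cos_taylor1 _ _) _; rewrite exprMn.
pose G t := phi t * expR (s ^+ 2 / 2 * t ^+ 2).
have dG u : is_derive u (1 : R) G 0.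
  have d := @is_derive1_comp R expR (fun y => s ^+ 2 / 2 * y ^+ 2) u _ _ (is_derive_expR _)
    (is_derive_scale (s ^+ 2 / 2) (is_derive_sqr u)).
  apply: is_derive_eq (is_derive_mul (dphi u) d) _.
  by rewrite /=; field.
have phi0 : phi 0 = cos c.
  rewrite /phi; under eq_Rintegral do rewrite mul0r add0r.
  by rewrite RintegralZl// /Rintegral integral_normal_pdf mulr1.
have := is_derive_0_is_cst t 0 dG.
rewrite /G phi0 expr0n/= mulr0 expR0 mulr1 => <-.
rewrite -[RHS]mulrA -expRD -[LHS]mulr1; congr (_ * _); rewrite -expR0; congr expR.
by field.
Qed.

End NormalMoments.

(** * Expectations and characteristic functions *)

Section GaussianExpectation.
Context {R : realType} {X : normedModType R} (gam : probability (borel_X X) R).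
Implicit Types (F G H : X -> R).

Definition bmeasurable G := measurable_fun [set: borel_X X] (G : borel_X X -> R).

Lemma continuous_bmeasurable G : continuous G -> bmeasurable G.
Proof.
move=> /continuousP cG; apply: (measurability _ (RGenOpens.measurableE R)).
move=> _ [_ [a [b ->] <-]]; rewrite setTI; apply: sub_sigma_algebra.
exact/cG/interval_open.
Qed.

Definition expect G : R := \int[gam]_(y in [set: borel_X X]) G (toX y).

Definition eintegrable G := gam.-integrable [set: borel_X X] (EFin \o (G : borel_X X -> R)).

Definition sqintegrable G := bmeasurable G /\ eintegrable (fun y => G y ^+ 2).

Lemma bounded_eintegrable G (M : R) : bmeasurable G -> (forall x, `|G x| <= M) -> eintegrable G.
Proof.
move=> mG bG; apply: measurable_bounded_integrable => //.
- by rewrite (le_lt_trans (probability_le1 gam measurableT))// ltry.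
- exists M; split; rewrite ?num_real// => x Mx y _ /=.
  by apply: le_trans (bG y) _; exact: ltW.
Qed.

Lemma bounded_sqintegrable G (M : R) : bmeasurable G -> (forall x, `|G x| <= M) -> sqintegrable G.
Proof.
move=> mG bG; split => //; apply: (@bounded_eintegrable _ (M ^+ 2)).
  exact: measurable_funX.
by move=> x; rewrite normrX lerXn2r ?nnegrE// (le_trans _ (bG x)).
Qed.

Lemma sqintegrable_mul G H : sqintegrable G -> sqintegrable H ->
  eintegrable (fun y => G y * H y).
Proof.
move=> [mG iG] [mH iH].
apply: le_integrable (integrableD _ iG iH) => //.
  by apply/measurable_EFinP; exact: measurable_funM.
move=> x _; rewrite /= lee_fin normrM [leRHS]ger0_norm ?addr_ge0 ?sqr_ge0//.
rewrite -(real_normK (num_real (G x))) -(real_normK (num_real (H x))).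
have := sqr_ge0 (`|G x| - `|H x|); have := mulr_ge0 (normr_ge0 (G x)) (normr_ge0 (H x)).
nra.
Qed.

Lemma expectD F G : eintegrable F -> eintegrable G ->
  expect (fun y => F y + G y) = expect F + expect G.
Proof. by move=> iF iG; rewrite /expect RintegralD. Qed.

Lemma expectB F G : eintegrable F -> eintegrable G ->
  expect (fun y => F y - G y) = expect F - expect G.
Proof. by move=> iF iG; rewrite /expect RintegralB. Qed.

Lemma expectZ (c : R) F : eintegrable F -> expect (fun y => c * F y) = c * expect F.
Proof. by move=> iF; rewrite /expect RintegralZl. Qed.

Lemma eintegrableD F G : eintegrable F -> eintegrable G -> eintegrable (fun y => F y + G y).
Proof. by move=> iF iG; exact: (integrableD _ iF iG). Qed.

Lemma eintegrableB F G : eintegrable F -> eintegrable G -> eintegrable (fun y => F y - G y).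
Proof. by move=> iF iG; exact: (integrableB _ iF iG). Qed.

Lemma eintegrableZ (c : R) F : eintegrable F -> eintegrable (fun y => c * F y).
Proof. by move=> iF; exact: (integrableZl _ _ iF). Qed.

Lemma expect_cst (c : R) : expect (fun=> c) = c.
Proof.
rewrite /expect Rintegral_cst// [fine _](_ : _ = 1) ?mulr1//.
exact: (congr1 fine (probability_setT gam)).
Qed.

Lemma expect_ge0 F : (forall x, 0 <= F x) -> 0 <= expect F.
Proof. by move=> F0; apply: Rintegral_ge0. Qed.

Lemma expect_le F G : eintegrable F -> eintegrable G -> (forall x, F x <= G x) ->
  expect F <= expect G.
Proof. by move=> iF iG FG; apply: le_Rintegral. Qed.

Lemma norm_expect F : eintegrable F -> `|expect F| <= expect (fun y => `|F y|).
Proof. by move=> iF; apply: le_normr_Rintegral. Qed.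

Lemma norm_expect_le F (M : R) : bmeasurable F -> (forall x, `|F x| <= M) -> `|expect F| <= M.
Proof.
move=> mF bF; have iF := bounded_eintegrable mF bF.
apply: le_trans (norm_expect iF) _; rewrite -[leRHS]expect_cst.
apply: expect_le => //; first exact: (integrable_norm iF).
apply: (@bounded_eintegrable _ `|M|) => //; exact: measurable_cst.
Qed.

Lemma bmeasurable_cvg (G_ : nat -> X -> R) G : (forall n, bmeasurable (G_ n)) ->
  (forall x, G_ n x @[n --> \oo] --> G x) -> bmeasurable G.
Proof. by move=> mG cG; apply: (measurable_fun_cvg mG) => x _; exact: cG. Qed.

Lemma bounded_limit (T : Type) (G_ : nat -> T -> R) (G : T -> R) (M : R) :
  (forall n x, `|G_ n x| <= M) -> (forall x, G_ n x @[n --> \oo] --> G x) -> forall x, `|G x| <= M.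
Proof.
move=> bG cG x.
by apply: (cvgr_to_le (cvg_norm (cG x))); apply: nearW => n; exact: bG.
Qed.

Lemma expect_cvg (G_ : nat -> X -> R) G (M : R) : (forall n, bmeasurable (G_ n)) ->
  (forall n x, `|G_ n x| <= M) ->
  (forall x, G_ n x @[n --> \oo] --> G x) -> expect (G_ n) @[n --> \oo] --> expect G.
Proof.
move=> mG bG cG.
have [|||_ c] := @Rintegral_dominated_convergence _ (borel_X X) R gam setT G_ G
  (fun=> M) measurableT mG (bmeasurable_cvg mG cG).
- by apply: aeW => x _; exact: cG.
- apply: (@bounded_eintegrable (fun=> M) `|M|) => //; exact: measurable_cst.
- by move=> n x _; exact: bG.
exact: c.
Qed.

Lemma expect_cauchy_schwarz G H : sqintegrable G -> sqintegrable H ->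
  `|expect (fun y => G y * H y)| <=
    Num.sqrt (expect (fun y => G y ^+ 2)) * Num.sqrt (expect (fun y => H y ^+ 2)).
Proof.
move=> sG sH; have iGH := sqintegrable_mul sG sH; have [mG iG] := sG; have [mH iH] := sH.
set a := expect (fun y => G y ^+ 2); set b := expect _; set c := expect (fun y => H y ^+ 2).
have a0 : 0 <= a by apply: expect_ge0 => x; exact: sqr_ge0.
have c0 : 0 <= c by apply: expect_ge0 => x; exact: sqr_ge0.
have Q t : 0 <= a + 2 * t * b + t ^+ 2 * c.
  rewrite -expectZ// -expectZ// -expectD//; last exact: eintegrableZ.
  rewrite -expectD//; last exact: eintegrableZ.
    apply: expect_ge0 => x; have := sqr_ge0 (G x + t * H x).
    by rewrite (_ : (G x + t * H x) ^+ 2 = G x ^+ 2 + 2 * t * (G x * H x) + t ^+ 2 * H x ^+ 2)//; ring.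
  by apply: eintegrableD => //; exact: eintegrableZ.
have : b ^+ 2 <= a * c.
  have [c00|cn0] := eqVneq c 0.
    have [->|b0] := eqVneq b 0; first by rewrite expr0n/= mulr_ge0.
    (* With [c = 0] the polynomial is affine in [t], and if [b] is nonzero it takes the value -1 at
       this point. *)
    have := Q (- (a + 1) / (2 * b)).
    rewrite c00 mulr0 addr0 (_ : 2 * _ * b = - (a + 1)); last by field.
    lra.
  have cp : 0 < c by rewrite lt_neqAle eq_sym cn0.
  have := Q (- b / c).
  rewrite (_ : a + _ + _ = a - b ^+ 2 / c); last by field.
  by rewrite subr_ge0 ler_pdivrMr.
by move=> h; rewrite -sqrtrM// -sqrtr_sqr; exact: ler_wsqrtr.
Qed.

Lemma sqintegrableD F G : sqintegrable F -> sqintegrable G -> sqintegrable (fun y => F y + G y).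
Proof.
move=> sF sG; have iFG := sqintegrable_mul sF sG; have [mF iF] := sF; have [mG iG] := sG.
split; first exact: measurable_funD.
rewrite (_ : (fun y => _) = (fun y => (F y ^+ 2 + G y ^+ 2) + 2 * (F y * G y))).
  by apply: eintegrableD; [exact: eintegrableD|exact: eintegrableZ].
by apply/funext => y; ring.
Qed.

Lemma sqintegrableZ (c : R) F : sqintegrable F -> sqintegrable (fun y => c * F y).
Proof.
move=> [mF iF]; split; first exact: measurable_funM.
rewrite (_ : (fun y => _) = (fun y => c ^+ 2 * (F y ^+ 2))); first exact: eintegrableZ.
by apply/funext => y; rewrite exprMn.
Qed.

End GaussianExpectation.

(** * Moments and characteristic functions of continuous linear functionals *)

Section GaussianFunctionals.
Context {R : realType} {X : normedModType R} (gam : probability (borel_X X) R).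
Notation mu := (@lebesgue_measure R).

Let law_integral (l : X -> R) (nu : {measure set (measurableTypeR R) -> \bar R}) (f : R -> R) :
  continuous l ->
  (forall A : set (measurableTypeR R), measurable A -> gam ((l \o @toX R X) @^-1` A) = nu A) ->
  measurable_fun setT f -> (forall x, 0 <= f x) ->
  (\int[gam]_y (f (l (toX y)))%:E = \int[nu]_x (f x)%:E)%E.
Proof.
move=> cl law mf f0.
have mEf : measurable_fun setT (EFin \o f) by exact/measurable_EFinP.
have ml : measurable_fun [set: borel_X X] (l \o @toX R X) by exact: continuous_bmeasurable.
have := @ge0_integral_pushforward _ _ (borel_X X) (measurableTypeR R) R _ ml gam setT (EFin \o f)
  measurableT mEf (fun x _ => f0 x).
rewrite preimage_setT => <-.
by apply: eq_measure_integral => A mA _; exact: law.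
Qed.

Let gaussian_integral (l : X -> R) (s : R) (f : R -> R) : continuous l ->
  (forall A : set R, measurable A -> gam ((l \o @toX R X) @^-1` A) =
          (if s == 0 then \d_(0 : R) A else normal_prob 0 s A)) ->
  measurable_fun setT f -> (forall x, 0 <= f x) ->
  (\int[gam]_y (f (l (toX y)))%:E =
   if s == 0%R then (f 0%R)%:E else \int[mu]_x (f x * normal_pdf 0%R s x)%:E)%E.
Proof.
move=> cl law mf f0.
have mEf : measurable_fun setT (EFin \o f) by exact/measurable_EFinP.
case: ifPn law => s0 law.
- rewrite (@law_integral l (\d_(0 : measurableTypeR R)) f)//.
  by rewrite integral_dirac// diracE mem_set// mul1e.
- rewrite (@law_integral l (normal_prob 0 s) f)//.
  rewrite (@ge0_integral_density _ _ _ mu (normal_prob 0 s) (normal_pdf 0 s))//.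
  - exact: normal_prob_dominates.
  - exact: measurable_normal_pdf.
Qed.

Hypothesis gauss : centered_gaussian gam.

Let gaussian_functional_moments (l : X -> R) : cont_linear_functional l ->
  exists s : R, [/\ sqintegrable gam l, expect gam (fun y => l y ^+ 2) = s ^+ 2 &
    forall c, expect gam (fun y => cos (l y + c)) = cos c * expR (- (s ^+ 2) / 2)].
Proof.
move=> hl; have [s [s0 law]] := gauss hl; have [_ _ cl] := hl.
have ml : bmeasurable l by exact: continuous_bmeasurable.
have msq : measurable_fun setT (fun x : R => x ^+ 2) by exact: measurable_funX.
(* Integrals are transported to the line for nonnegative integrands only, hence the shift of the
   cosine by 1. *)
have mcos (c : R) : measurable_fun setT (fun x : R => cos (x + c) + 1).
  apply: measurable_funD => //; apply: continuous_measurable_fun => x.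
  apply: (@continuous_comp _ _ _ (fun x => x + c) cos); last exact: continuous_cos.
  by apply: cvgD; [exact: cvg_id|exact: cvg_cst].
have cosge0 (c x : R) : 0 <= cos (x + c) + 1 by rewrite -lerBlDr sub0r cos_geN1.
have e2 := gaussian_integral cl law msq (@sqr_ge0 R).
have ec c := gaussian_integral cl law (mcos c) (cosge0 c).
have q2 : (\int[gam]_y ((l (toX y)) ^+ 2)%:E = (s ^+ 2)%:E)%E.
  rewrite e2; have [->|s0'] := eqVneq s 0; first by [].
  have sp : 0 < s by rewrite lt_neqAle eq_sym s0'.
  rewrite -(integral_sqr_normal_pdf sp) /Rintegral fineK//.
  apply: integrable_fin_num => //; exact: integrable_sqr_normal_pdf.
exists s; split.
- split=> //; apply/integrableP; split; first by apply/measurable_EFinP; exact: measurable_funX.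
  under eq_integral do rewrite /= ger0_norm ?sqr_ge0//.
  by rewrite q2 ltry.
- by rewrite /expect /Rintegral q2.
- move=> c.
  have bc : forall x, `|cos (l x + c)| <= 1 by move=> x; rewrite ler_norml cos_geN1 cos_le1.
  have mc : bmeasurable (fun y => cos (l y + c)).
    apply: continuous_bmeasurable => x.
    apply: (@continuous_comp _ _ _ (fun x => l x + c) cos); last exact: continuous_cos.
    by apply: cvgD; [exact: cl|exact: cvg_cst].
  have ic := bounded_eintegrable gam mc bc.
  apply: (@addIr _ 1); rewrite -[X in _ + X](expect_cst gam 1) -expectD//; last first.
    by apply: (@bounded_eintegrable _ _ gam _ 1); [exact: measurable_cst|rewrite normr1].
  rewrite /expect /Rintegral ec.
  have [->|s0'] := eqVneq s 0.
    by rewrite expr0n/= add0r oppr0 mul0r expR0 mulr1.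
  have sp : 0 < s by rewrite lt_neqAle eq_sym s0'.
  have i1 := integrable_cos_normal_pdf s 1 c.
  have i0 := integrable_normal_pdf 0 s.
  under eq_integral => x _ do rewrite mulrDl mul1r -{1}(mul1r x).
  rewrite -[fine _]/(\int[mu]_x (cos (1 * x + c) * normal_pdf 0 s x + normal_pdf 0 s x)) RintegralD//.
  rewrite integral_cos_normal_pdf// expr1n mulr1; congr (_ + _).
  by rewrite /Rintegral integral_normal_pdf.
Qed.

Lemma sqintegrable_functional (l : X -> R) : cont_linear_functional l -> sqintegrable gam l.
Proof. by move=> /gaussian_functional_moments[s []]. Qed.

Lemma expect_cos_functional (l : X -> R) (c : R) : cont_linear_functional l ->
  expect gam (fun y => cos (l y + c)) =
  cos c * expR (- expect gam (fun y => l y ^+ 2) / 2).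
Proof. by move=> /gaussian_functional_moments[s [_ -> ->]]. Qed.

End GaussianFunctionals.

(** * The monotone class of cosines *)

Section CylindricalFunctions.
Context {R : realType} {X : normedModType R}.
Implicit Types (F G : X -> R) (A : set X).

(* The monotone class argument: an identity between functionals that are linear and
   continuous for bounded pointwise limits holds on [cyl] as soon as it holds for cosines,
   and [cyl] contains all bounded continuous functions when X is separable. *)
Inductive cyl : (X -> R) -> Prop :=
| cyl_cos l c : cont_linear_functional l -> cyl (fun x => cos (l x + c))
| cyl_linear c F G : cyl F -> cyl G -> cyl (fun x => c * F x + G x)
| cyl_limit (G_ : nat -> X -> R) G (M : R) : (forall n, cyl (G_ n)) ->
    (forall n x, `|G_ n x| <= M) -> (forall x, G_ n x @[n --> \oo] --> G x) -> cyl G.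

Lemma cont_linear_functionalZ (a : R) (l : X -> R) :
  cont_linear_functional l -> cont_linear_functional (fun x => a * l x).
Proof.
move=> [lD lZ cl]; split=> [x y|b x|x].
- by rewrite lD mulrDr.
- by rewrite lZ mulrCA.
- by apply: cvgMl_tmp; exact: cl.
Qed.

Lemma cont_linear_functionalD (l m : X -> R) :
  cont_linear_functional l -> cont_linear_functional m ->
  cont_linear_functional (fun x => l x + m x).
Proof.
move=> [lD lZ cl] [mD mZ cm]; split=> [x y|b x|x].
- by rewrite lD mD addrACA.
- by rewrite lZ mZ mulrDr.
- by apply: cvgD; [exact: cl|exact: cm].
Qed.

Lemma cont_linear_functional0 : cont_linear_functional (fun _ : X => 0 : R).
Proof.
by split=> [x y|b x|x]; [rewrite addr0|rewrite mulr0|exact: cvg_cst].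
Qed.

Lemma cyl_bounded F : cyl F -> exists M, forall x, `|F x| <= M.
Proof.
elim=> [l c hl|c {}F G _ [M FM] _ [N GN]|G_ G M _ _ GM cG].
- by exists 1 => x; rewrite ler_norml cos_geN1 cos_le1.
- exists (`|c| * M + N) => x; apply: le_trans (ler_normD _ _) _.
  by rewrite normrM lerD// ler_wpM2l.
- by exists M; exact: bounded_limit GM cG.
Qed.

Lemma cyl_bmeasurable F : cyl F -> bmeasurable F.
Proof.
elim=> [l c [lD lZ cl]|c {}F G _ mF _ mG|G_ G M _ mG _ cG].
- apply: continuous_bmeasurable => x.
  apply: (@continuous_comp _ _ _ (fun x => l x + c) cos); last exact: continuous_cos.
  by apply: cvgD; [exact: cl|exact: cvg_cst].
- by apply: measurable_funD => //; exact: measurable_funM.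
- exact: bmeasurable_cvg mG cG.
Qed.

Lemma cyl_affine F (b : X) (a : R) : cyl F -> cyl (fun x => F (b + a *: x)).
Proof.
elim=> [l c hl|c {}F G _ cF _ cG|G_ G M _ cG GM lG].
- have [lD lZ _] := hl.
  rewrite (_ : (fun x => _) = (fun x => cos (a * l x + (l b + c)))); last first.
    by apply/funext => x; rewrite lD lZ; congr cos; ring.
  by apply: cyl_cos; exact: cont_linear_functionalZ.
- exact: cyl_linear.
- by apply: (cyl_limit cG) => [n x|x]; [exact: GM|exact: lG].
Qed.

Lemma cyl1 : cyl (fun=> 1).
Proof.
rewrite (_ : (fun=> 1) = (fun x : X => cos ((fun=> 0) x + 0))).
  by apply: cyl_cos; exact: cont_linear_functional0.
by apply/funext => x; rewrite addr0 cos0.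
Qed.

Lemma cyl0 : cyl (fun=> 0).
Proof.
have := cyl_linear (-1) cyl1 cyl1.
by congr cyl; apply/funext => x; rewrite mulr1 addNr.
Qed.

Lemma cylZ c F : cyl F -> cyl (fun x => c * F x).
Proof.
move=> cF; have := cyl_linear c cF cyl0.
by congr cyl; apply/funext => x; rewrite addr0.
Qed.

Lemma cylD F G : cyl F -> cyl G -> cyl (fun x => F x + G x).
Proof.
move=> cF cG; have := cyl_linear 1 cF cG.
by congr cyl; apply/funext => x; rewrite mul1r.
Qed.

Lemma cylB F G : cyl F -> cyl G -> cyl (fun x => F x - G x).
Proof.
move=> cF cG; have := cyl_linear (-1) cG cF.
by congr cyl; apply/funext => x; rewrite mulN1r addrC.
Qed.

Lemma cyl_cst c : cyl (fun=> c).
Proof. by have := cylZ c cyl1; congr cyl; apply/funext => x; rewrite mulr1. Qed.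

Let cyl_mul_cos l c G : cont_linear_functional l -> cyl G -> cyl (fun x => cos (l x + c) * G x).
Proof.
move=> hl; elim=> [m d hm|d F {}G _ cF _ cG|G_ {}G M _ cG GM lG].
- have h1 := cont_linear_functionalD hl hm.
  have h2 := cont_linear_functionalD hl (cont_linear_functionalZ (-1) hm).
  have := cylD (cylZ (2^-1) (cyl_cos (c + d) h1)) (cylZ (2^-1) (cyl_cos (c - d) h2)).
  congr cyl; apply/funext => x.
  rewrite (_ : l x + m x + (c + d) = (l x + c) + (m x + d)); last by ring.
  rewrite (_ : l x + -1 * m x + (c - d) = (l x + c) - (m x + d)); last by ring.
  by rewrite cosD cosB; field.
- have := cyl_linear d cF cG.
  by congr cyl; apply/funext => x; ring.
- apply: (@cyl_limit (fun n x => cos (l x + c) * G_ n x) _ M) => //.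
  + move=> n x; rewrite normrM (le_trans _ (GM n x))// ler_piMl//.
    by rewrite ler_norml cos_geN1 cos_le1.
  + by move=> x; apply: cvgMl_tmp; exact: lG.
Qed.

Lemma cylM F G : cyl F -> cyl G -> cyl (fun x => F x * G x).
Proof.
move=> cF cG; elim: cF => [l c hl|c {}F H _ cFG _ cHG|F_ {}F M _ cF FM lF].
- exact: cyl_mul_cos.
- have := cyl_linear c cFG cHG.
  by congr cyl; apply/funext => x; ring.
- have [N GN] := cyl_bounded cG.
  apply: (@cyl_limit (fun n x => F_ n x * G x) _ (M * N)) => //.
  + by move=> n x; rewrite normrM ler_pM.
  + by move=> x; apply: cvgMr_tmp; exact: lF.
Qed.

(** On [-1, 1] this odd cubic has the repelling fixed point 0 and the attracting ones -1 and 1, so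
    its iterates converge to the sign. They are polynomials, hence preserve [cyl]. *)
Let smooth_step (u : R) := (3 * u - u ^+ 3) / 2.

Let smooth_step_itv u : 0 <= u <= 1 -> 0 <= smooth_step u <= 1 /\ u <= smooth_step u.
Proof.
move=> /andP[u0 u1]; rewrite /smooth_step.
have h1 : 0 <= (1 - u) ^+ 2 * (2 + u) by rewrite mulr_ge0 ?sqr_ge0 ?addr_ge0.
have h2 : 0 <= u * (1 - u) * (1 + u) by rewrite !mulr_ge0 ?subr_ge0 ?addr_ge0.
have e1 : (1 - u) ^+ 2 * (2 + u) = 2 - 3 * u + u ^+ 3 by ring.
have e2 : u * (1 - u) * (1 + u) = u - u ^+ 3 by ring.
by split; [apply/andP; split|]; lra.
Qed.

Let smooth_step_iter u n : 0 <= u <= 1 ->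
  [/\ 0 <= iter n smooth_step u <= 1, u <= iter n smooth_step u &
      1 - iter n smooth_step u <= (1 - u / 2) ^+ n].
Proof.
move=> u01; elim: n => [|n [IH1 IH2 IH3]]; rewrite ?iterS.
  by split => //; rewrite expr0 gerBl; case/andP: u01.
have /andP[u0 u1] := u01.
set w := iter n smooth_step u in IH1 IH2 IH3 *; have /andP[w0 w1] := IH1.
have [h1 h2] := smooth_step_itv IH1; split => //; first exact: le_trans h2.
rewrite exprS.
(* The distance to 1 contracts by a factor of at most 1 - u / 2, because the iterates stay above the
   starting point [u]. *)
have -> : 1 - smooth_step w = (1 - (w + w ^+ 2) / 2) * (1 - w) by rewrite /smooth_step; field.
apply: ler_pM => //; rewrite ?subr_ge0//.
- have := sqr_ge0 (1 - w); have := sqr_ge0 (1 + w); nra.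
- have := sqr_ge0 w; lra.
Qed.

Let smooth_stepN u : smooth_step (- u) = - smooth_step u.
Proof. by rewrite /smooth_step; field. Qed.

Let smooth_step_cvg u : `|u| <= 1 -> iter n smooth_step u @[n --> \oo] --> Num.sg u.
Proof.
have pos v : 0 < v <= 1 -> iter n smooth_step v @[n --> \oo] --> (1 : R).
  move=> /andP[v0 v1].
  have q1 : `|1 - v / 2| < 1 by rewrite ltr_norml; apply/andP; split; lra.
  have c : 1 - (1 - v / 2) ^+ n @[n --> \oo] --> (1 : R).
    rewrite -[X in _ --> X]subr0; apply: cvgB; [exact: cvg_cst|exact: cvg_expr].
  apply: (@squeeze_cvgr _ _ _ _ (fun n => 1 - (1 - v / 2) ^+ n) (fun=> 1)) => //.
  - apply: nearW => n; have := @smooth_step_iter v n; rewrite (ltW v0) v1 => /(_ isT)[/andP[_ ->] _ h].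
    by rewrite andbT; lra.
  - exact: cvg_cst.
have odd n v : iter n smooth_step (- v) = - iter n smooth_step v.
  by elim: n => //= n ->; rewrite smooth_stepN.
rewrite ler_norml => /andP[u1 u2]; have [u0|u0|->] := ltrgtP u 0.
- rewrite ltr0_sg// -{1}(opprK u); under eq_cvg do rewrite odd.
  by apply: cvgN; apply: pos; rewrite oppr_gt0 u0; lra.
- by rewrite gtr0_sg//; apply: pos; rewrite u0.
- rewrite sgr0 (_ : (fun n => _) = (fun=> 0)); first exact: cvg_cst.
  apply/funext => n; elim: n => //= n ->; rewrite /smooth_step; ring.
Qed.

Lemma cyl_sg F : cyl F -> (forall x, `|F x| <= 1) -> cyl (fun x => Num.sg (F x)).
Proof.
move=> cF F1.
have H n : cyl (fun x => iter n smooth_step (F x)).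
  elim: n => //= n IH; have := cylB (cylZ (3 / 2) IH) (cylZ 2^-1 (cylM IH (cylM IH IH))).
  by congr cyl; apply/funext => x; rewrite /smooth_step; field.
apply: (@cyl_limit _ _ 1 H) => [n x|x]; last exact: smooth_step_cvg.
have [h|h] := leP 0 (F x).
  have := @smooth_step_iter (F x) n; rewrite h -{1}(ger0_norm h) F1 => /(_ isT)[/andP[a b] _ _].
  by rewrite ger0_norm.
have odd v : iter n smooth_step (- v) = - iter n smooth_step v.
  by elim: n => //= n ->; rewrite smooth_stepN.
have := @smooth_step_iter (- F x) n; rewrite oppr_ge0 (ltW h) -{1}(ltr0_norm h) F1 => /(_ isT)[/andP[a b] _ _].
by rewrite -normrN -odd ger0_norm.
Qed.

Definition cylset A := cyl (\1_A : X -> R).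

Lemma cylsetC A : cylset A -> cylset (~` A).
Proof.
move=> cA; have := cylB cyl1 cA; congr cyl; apply/funext => x.
by rewrite !indicE in_setC; case: (x \in A); rewrite ?subrr ?subr0.
Qed.

Lemma cylset_bigcap (A : nat -> set X) : (forall n, cylset (A n)) -> cylset (\bigcap_n A n).
Proof.
move=> cA.
pose F n x := \prod_(i < n) (\1_(A i) x : R).
have cF n : cyl (F n).
  rewrite /F; elim: n => [|n IH].
    by have := cyl1; congr cyl; apply/funext => x; rewrite big_ord0.
  have := cylM IH (cA n); congr cyl; apply/funext => x.
  by rewrite big_ord_recr.
apply: (@cyl_limit F _ 1 cF) => [n x|x].
- rewrite /F; elim: n => [|n IH]; first by rewrite big_ord0 normr1.
  rewrite big_ord_recr/= normrM mulr_ile1// indicE.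
  by case: (x \in A n); rewrite ?normr1 ?normr0.
- have [Ax|] := pselect ((\bigcap_n A n) x).
    rewrite indicE mem_set// (_ : (fun n => _) = (fun=> 1)); first exact: cvg_cst.
    by apply/funext => n; rewrite /F big1// => i _; rewrite indicE mem_set//; exact: Ax.
  move=> nAx; have [k nAk] : exists k, ~ A k x.
    by apply: contrapT => h; apply: nAx => k _; apply: contrapT => h'; apply: h; exists k.
  rewrite indicE memNset//; apply: cvg_near_cst; exists k.+1 => // n /= kn.
  by rewrite /F (bigD1 (Ordinal kn))//= indicE memNset// mul0r.
Qed.

Lemma cylset_bigcup (A : nat -> set X) : (forall n, cylset (A n)) -> cylset (\bigcup_n A n).
Proof.
move=> cA; rewrite -(setCK (\bigcup_n A n)) setC_bigcup.
by apply/cylsetC/cylset_bigcap => n; exact: cylsetC.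
Qed.

Lemma cylset_halfspace (l : X -> R) (b : R) : cont_linear_functional l -> cylset [set x | b < l x].
Proof.
move=> hl.
have csg : cyl (fun x => Num.sg (l x - b)).
  (* [cyl_sg] needs values in [-1, 1] while [l x - b] is unbounded. The sine of the quotient is
     bounded, and has the sign of [l x - b] as soon as the quotient is below 1 in absolute value. *)
  pose F n x := Num.sg (sin ((l x - b) / n.+1%:R)).
  have cF n : cyl (F n).
    apply: cyl_sg => [|x]; last by rewrite ler_norml sin_geN1 sin_le1.
    have := cyl_cos (- b / n.+1%:R - pi / 2) (cont_linear_functionalZ (n.+1%:R)^-1 hl).
    congr cyl; apply/funext => x; rewrite -[RHS]cosBpihalf; congr cos.
    by ring.
  apply: (@cyl_limit F _ 1 cF) => [n x|x].
    by rewrite /F normr_sg; case: (_ == 0); rewrite /= ?normr0 ?normr1.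
  apply: cvg_near_cst; exists (Num.truncn `|l x - b|) => // n /= hn.
  set u := (l x - b) / n.+1%:R.
  have n0 : (0 : R) < n.+1%:R^-1 by rewrite invr_gt0.
  have u1 : `|u| < 1.
    rewrite normrM (gtr0_norm n0) ltr_pdivrMr// mul1r.
    by apply: lt_le_trans (Num.Theory.truncnS_gt _) _; rewrite ler_nat ltnS.
  have pi1 : (1 : R) < pi by have := @pi_ge2 R; lra.
  rewrite /F -/u -[RHS]mulr1 -(gtr0_sg n0) -sgrM -/u.
  move: u1; rewrite ltr_norml => /andP[u1 u2].
  have [u0|u0|->] := ltrgtP u 0; last by rewrite sin0.
  - rewrite (ltr0_sg u0) ltr0_sg// -oppr_gt0 -sinN sin_gt0_pi// oppr_gt0 u0; lra.
  - by rewrite (gtr0_sg u0) gtr0_sg// sin_gt0_pi// u0; lra.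
(* On the values -1, 0 and 1 of the sign, half the sum of the sign and its square is the indicator
   of 1. *)
have := cylZ 2^-1 (cylD csg (cylM csg csg)); congr cyl; apply/funext => x.
rewrite indicE; have [h|h|h] := ltrgtP b (l x).
- by rewrite mem_set//= gtr0_sg ?subr_gt0//; field.
- by rewrite memNset/= ?ltr0_sg ?subr_lt0//; [field|apply/negP; rewrite -leNgt ltW].
- by rewrite memNset/= -?h ?subrr ?sgr0; [field|rewrite ltxx].
Qed.

End CylindricalFunctions.

(** * Bounded continuous functions on a separable space *)

Section CylindricalContinuous.
Context {R : realType} {X : normedModType R}.
Implicit Types (F G : X -> R) (A : set X).

Lemma dense_sequence : separable_space X ->
  exists d : nat -> X, forall x (e : R), 0 < e -> exists n, `|x - d n| < e.
Proof.
move=> [D [/countable_injP[f finj] cD]].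
have [n|d dP] := @choice nat X (fun n z => forall y, D y -> f y = n -> z = y).
  have [[y [Dy fy]]|h] := pselect (exists y, D y /\ f y = n).
    by exists y => z Dz fz; apply: finj; rewrite ?inE// fy fz.
  by exists 0 => y Dy fy; exfalso; apply: h; exists y.
exists d => x e e0.
have : closure D x by rewrite cD.
move=> /(_ (ball x e) (nbhsx_ballx _ _ e0))[y [Dy]].
rewrite -ball_normE/= => h; exists (f y); by rewrite (dP _ y).
Qed.

Hypothesis sepX : separable_space X.

(** A ball is a countable intersection of half-spaces cut out by functionals norming a dense
    sequence: if x - a is longer than r, the functional norming a nearby term of the sequence still
    exceeds r on it. *)
Lemma cylset_closed_ball (a : X) (r : R) : cylset [set x | `|x - a| <= r].
Proof.
have [d dP] := dense_sequence sepX.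
have [l lP] := choice (fun n => norming_functional (d n)).
rewrite (_ : [set x | _] = \bigcap_n ~` [set x | r + l n a < l n x]).
  by apply: cylset_bigcap => n; apply/cylsetC/cylset_halfspace; have [] := lP n.
have lB n x y : l n (x - y) = l n x - l n y.
  have [[lD lZ _] _ _] := lP n.
  by rewrite lD -scaleN1r lZ mulN1r.
apply/seteqP; split => x /= xa.
- move=> n _ /=; apply/negP; rewrite -leNgt.
  have [_ h _] := lP n; have := h (x - a); rewrite lB ler_norml => /andP[_].
  by lra.
- rewrite leNgt; apply/negP => h.
  pose e := (`|x - a| - r) / 3.
  have e0 : 0 < e by rewrite divr_gt0// subr_gt0.
  have [n hn] := dP (x - a) e e0.
  have /negP := xa n I; rewrite /= -leNgt => h1.
  have [_ h2 h3] := lP n.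
  have h4 := h2 (d n - (x - a)); rewrite lB h3 in h4.
  have h5 : `|x - a| <= `|d n| + `|x - a - d n|.
    by rewrite -{1}(subrK (d n) (x - a)) addrC; exact: ler_normD.
  have h6 : `| `|d n| - l n (x - a)| < e by apply: le_lt_trans h4 _; rewrite distrC.
  have := h6; rewrite ltr_norml lB => /andP[h7 h8].
  have e3 : `|x - a| = r + 3 * e by rewrite /e; field.
  lra.
Qed.

(** An open set is the union of the closed balls inside it whose centres lie in the dense sequence
    and whose radii are 1 / (k + 1). Balls that do not fit are replaced by the empty set, so that
    the union runs over all pairs. *)
Lemma cylset_open A : open A -> cylset A.
Proof.
move=> oA; have [d dP] := dense_sequence sepX.
pose B n k := [set x | `|x - d n| <= (k.+1%:R)^-1 :> R] : set X.
pose C n k := [set x | B n k x /\ B n k `<=` A] : set X.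
have cC n k : cylset (C n k).
  have [h|h] := pselect (B n k `<=` A).
    rewrite (_ : C n k = B n k); first exact: cylset_closed_ball.
    by apply/seteqP; split => x //= [].
  rewrite (_ : C n k = set0); last by apply/seteqP; split => x //= -[].
  by have := @cyl0 R X; congr cyl; apply/funext => x; rewrite indic0.
rewrite (_ : A = \bigcup_n \bigcup_k C n k).
  by apply: cylset_bigcup => n; apply: cylset_bigcup => k; exact: cC.
apply/seteqP; split => x.
- move=> Ax; have : nbhs x A by exact: open_nbhs_nbhs.
  move=> /nbhs_ballP[e /= e0 eA].
  have [k hk] : exists k, (k.+1%:R)^-1 < e / 2 :> R.
    have e2 : 0 < e / 2 by rewrite divr_gt0.
    exists (Num.truncn (e / 2)^-1); rewrite invf_plt// ?posrE//.
    exact: Num.Theory.truncnS_gt.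
  have [n hn] := dP x (k.+1%:R)^-1 (ltac:(by rewrite invr_gt0)).
  exists n => //; exists k => //; split; first by rewrite /B/= ltW.
  move=> y yB; apply: eA; rewrite -ball_normE/=.
  have : `|x - y| <= `|x - d n| + `|y - d n|.
    by rewrite -(normrN (y - d n)) opprB (le_trans _ (ler_normD _ _))// addrA subrK.
  move: hn hk yB; rewrite /B/=; move: (k.+1%:R^-1) => q ? ? ? ?; lra.
- by move=> [n _ [k _ [Bx BA]]]; exact: BA.
Qed.

Let layer_sum (u : R) (N : nat) : 0 <= u <= N%:R ->
  `|u - \sum_(k < N) (k%:R < u)%R%:R| <= 1.
Proof.
move=> /andP[u0]; elim: N => [|N IH] uN.
  by rewrite big_ord0 subr0 ger0_norm// (le_trans uN).
have [h|h] := leP u N%:R.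
  by rewrite big_ord_recr/= ltNge h/= addr0; exact: IH.
rewrite (eq_bigr (fun=> 1)); last first.
  by move=> k _; rewrite (le_lt_trans _ h)// ler_nat -ltnS.
rewrite sumr_const card_ord ler_norml; move: uN.
by rewrite -natr1 => uN; apply/andP; split; lra.
Qed.

(** After rescaling to [0, 1] the function is the uniform limit of averages of indicators of its
    superlevel sets at the levels k / (n + 1), and these sets are open. *)
Lemma cyl_continuous F (M : R) : continuous F -> (forall x, `|F x| <= M) -> cyl F.
Proof.
move=> cF FM.
pose K : R := `|M| + 1.
have K0 : 0 < K by rewrite /K ltr_wpDl.
pose U x := (F x / K + 1) / 2.
have cU : continuous U.
  move=> x; apply: cvgMr_tmp; apply: cvgD; last exact: cvg_cst.
  by apply: cvgMr_tmp; exact: cF.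
have U01 x : 0 <= U x <= 1.
  have : `|F x / K| <= 1.
    rewrite normrM normfV (gtr0_norm K0) ler_pdivrMr// mul1r.
    by apply: le_trans (FM x) _; rewrite /K; have := ler_norm M; lra.
  by rewrite ler_norml /U => /andP[h1 h2]; apply/andP; split; lra.
pose G n x : R := n.+1%:R^-1 * \sum_(k < n.+1) \1_[set y | k%:R / n.+1%:R < U y] x.
have cG n : cyl (G n).
  suff H m : cyl (fun x => \sum_(k < m) \1_[set y | k%:R / n.+1%:R < U y] x : R) by exact: cylZ.
  elim: m => [|m IH].
    by have := @cyl0 R X; congr cyl; apply/funext => x; rewrite big_ord0.
  have oU : open [set y | m%:R / n.+1%:R < U y].
    rewrite (_ : [set y | _] = U @^-1` [set r | m%:R / n.+1%:R < r])//.
    by move/continuousP : cU; apply; exact: open_gt.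
  have := cylD IH (cylset_open oU); congr cyl; apply/funext => x.
  by rewrite big_ord_recr.
have GU n x : `|U x - G n x| <= n.+1%:R^-1.
  have n0 : (0 : R) < n.+1%:R by [].
  have := U01 x => /andP[h0 h1].
  have := @layer_sum (n.+1%:R * U x) n.+1.
  rewrite mulr_ge0//= ler_piMr// => /(_ isT) h.
  have -> : U x - G n x = n.+1%:R^-1 * (n.+1%:R * U x - \sum_(k < n.+1) (k%:R < n.+1%:R * U x)%R%:R).
    rewrite mulrBr mulKf ?gt_eqF// /G; congr (_ - _ * _); apply: eq_bigr => k _.
    rewrite indicE; congr ((_ : bool)%:R).
    by apply/idP/idP; rewrite inE/= ltr_pdivrMr// mulrC.
  by rewrite normrM gtr0_norm ?invr_gt0// ler_piMr// ltW// invr_gt0.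
have cylU : cyl U.
  apply: (@cyl_limit _ _ G _ 2 cG) => [n x|x].
  - have := GU n x; have := U01 x.
    have : (n.+1%:R : R)^-1 <= 1 by rewrite invf_le1// ler1n.
    move: (n.+1%:R^-1) => q.
    by rewrite !ler_norml => ? /andP[? ?] /andP[? ?]; apply/andP; split; lra.
  - apply/cvgrPdist_le => e e0; near=> n.
    apply: le_trans (GU n x) _.
    near: n.
    exact: (cvgr_le _ cvg_harmonic).
have := cylB (cylZ (2 * K) cylU) (cyl_cst K).
congr cyl; apply/funext => x; rewrite /U; field.
by rewrite gt_eqF.
Unshelve. all: by end_near.
Qed.

End CylindricalContinuous.

(** * The Cameron-Martin space and integration by parts *)

Section CameronMartin.
Context {R : realType} {X : normedModType R} (gam : probability (borel_X X) R).
Hypothesis gauss : centered_gaussian gam.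
Implicit Types (l m : X -> R) (h k : X).
Local Notation E := (expect gam).
Local Notation CMn := (cm_norm gam).
Local Notation CMH := (CM gam).

Definition variance_of l : R := expect gam (fun y => l y ^+ 2).
Local Notation q := variance_of.

Lemma variance_ge0 l : 0 <= q l.
Proof. by apply: expect_ge0 => x; exact: sqr_ge0. Qed.

Lemma varianceZ (a : R) l : cont_linear_functional l -> q (fun x => a * l x) = a ^+ 2 * q l.
Proof.
move=> hl; have [_ i] := sqintegrable_functional gauss hl.
by rewrite /q -expectZ//; congr expect; apply/funext => x; rewrite exprMn.
Qed.

Lemma varianceD l m : cont_linear_functional l -> cont_linear_functional m ->
  q (fun x => l x + m x) = q l + 2 * E (fun y => l y * m y) + q m.
Proof.
move=> hl hm; have sl := sqintegrable_functional gauss hl; have sm := sqintegrable_functional gauss hm.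
have ilm := sqintegrable_mul sl sm; have [_ il] := sl; have [_ im] := sm.
rewrite /q -expectZ// -expectD//; last exact: eintegrableZ.
rewrite -expectD//; last by apply: eintegrableD => //; exact: eintegrableZ.
by congr expect; apply/funext => x; ring.
Qed.

Let unit_ballE l : cont_linear_functional l ->
  (\int[gam]_y ((l (toX y)) ^+ 2)%:E <= 1)%E <-> q l <= 1.
Proof.
move=> hl; have [_ i] := sqintegrable_functional gauss hl.
have := integrable_fin_num measurableT i => /fineK h.
by rewrite -[q l]/(fine _) -lee_fin h.
Qed.

Let CM_fin h : CMH h -> cm_enorm gam h = (CMn h)%:E.
Proof.
move=> fin; rewrite /cm_norm fineK// fin_numElt fin andbT.
apply: lt_le_trans (ltNyr 0) _; apply: ereal_sup_ubound; exists (fun=> 0) => //.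
split; first exact: cont_linear_functional0.
apply/(unit_ballE (@cont_linear_functional0 R X)).
by rewrite /q expr0n/= expect_cst.
Qed.

Lemma CM_leP h (M : R) : (forall l, cont_linear_functional l -> q l <= 1 -> l h <= M) ->
  CMH h /\ CMn h <= M.
Proof.
move=> H.
have sup : (cm_enorm gam h <= M%:E)%E.
  by apply: ge_ereal_sup => _ [l [hl /(unit_ballE hl) ql] <-]; rewrite lee_fin; exact: H.
have fin : CMH h by rewrite /CM/= (le_lt_trans sup)// ltry.
by split => //; rewrite -lee_fin -CM_fin.
Qed.

Lemma cm_norm_ub h l : CMH h -> cont_linear_functional l -> q l <= 1 -> l h <= CMn h.
Proof.
move=> Hh hl ql; rewrite -lee_fin -CM_fin//; apply: ereal_sup_ubound; exists l => //.
by split => //; exact/(unit_ballE hl).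
Qed.

Lemma cm_norm_ge0 h : CMH h -> 0 <= CMn h.
Proof.
move=> Hh; apply: (@cm_norm_ub h (fun=> 0)) => //; first exact: cont_linear_functional0.
by rewrite /q expr0n/= expect_cst.
Qed.

Lemma functional_CM_le l h : CMH h -> cont_linear_functional l ->
  `|l h| <= CMn h * Num.sqrt (q l).
Proof.
move=> Hh hl; wlog lh : l hl / 0 <= l h.
  move=> H; have [lh|lh] := leP 0 (l h); first exact: H.
  have := H _ (cont_linear_functionalZ (-1) hl).
  rewrite varianceZ// mulN1r normrN sqrrN expr1n mul1r; apply.
  by rewrite oppr_ge0 ltW.
rewrite ger0_norm//.
have [q0|q0] := eqVneq (q l) 0.
  rewrite q0 sqrtr0 mulr0 leNgt; apply/negP => lp.
  (* A functional of variance 0 can be multiplied freely inside the unit ball; this multiple would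
     take the value [CMn h + 1] at [h]. *)
  have := @cm_norm_ub h (fun x => (CMn h + 1) / l h * l x) Hh (cont_linear_functionalZ _ hl).
  by rewrite varianceZ// q0 mulr0 => /(_ ler01); rewrite divfK ?gt_eqF//; lra.
have qp : 0 < Num.sqrt (q l) by rewrite sqrtr_gt0 lt_neqAle eq_sym q0 variance_ge0.
have := @cm_norm_ub h (fun x => (Num.sqrt (q l))^-1 * l x) Hh (cont_linear_functionalZ _ hl).
rewrite varianceZ// exprVn sqr_sqrtr ?variance_ge0// mulVf// => /(_ (lexx _)).
by rewrite mulrC ler_pdivrMr.
Qed.

Lemma functional_CM_sqr_le l h : CMH h -> cont_linear_functional l ->
  l h ^+ 2 <= CMn h ^+ 2 * q l.
Proof.
move=> Hh hl; have := functional_CM_le Hh hl.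
rewrite -(@ler_pXn2r _ 2) ?nnegrE ?mulr_ge0 ?cm_norm_ge0 ?sqrtr_ge0//.
by rewrite exprMn sqr_sqrtr ?variance_ge0// real_normK ?num_real.
Qed.

Let functional0 l : cont_linear_functional l -> l 0 = 0.
Proof. by move=> [_ lZ _]; rewrite -(scale0r 0) lZ mul0r. Qed.

Lemma CM0 : CMH 0 /\ CMn 0 = 0.
Proof.
have [H1 H2] : CMH 0 /\ CMn 0 <= 0 by apply: CM_leP => l hl _; rewrite functional0.
by split => //; apply/eqP; rewrite eq_le H2 cm_norm_ge0.
Qed.

Lemma CMD h k : CMH h -> CMH k -> CMH (h + k) /\ CMn (h + k) <= CMn h + CMn k.
Proof.
move=> Hh Hk; apply: CM_leP => l hl ql; have [lD _ _] := hl.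
by rewrite lD lerD// cm_norm_ub.
Qed.

Let CMZ_le (a : R) h : CMH h -> CMH (a *: h) /\ CMn (a *: h) <= `|a| * CMn h.
Proof.
move=> Hh; apply: CM_leP => l hl ql; have [_ lZ _] := hl.
rewrite lZ; apply: le_trans (ler_norm _) _; rewrite normrM ler_wpM2l//.
apply: le_trans (functional_CM_le Hh hl) _.
by rewrite ler_piMr ?cm_norm_ge0// -sqrtr1 ler_wsqrtr.
Qed.

Lemma CMZ (a : R) h : CMH h -> CMH (a *: h) /\ CMn (a *: h) = `|a| * CMn h.
Proof.
move=> Hh; have [H1 H2] := CMZ_le a Hh; split => //.
apply/eqP; rewrite eq_le H2/=.
have [->|a0] := eqVneq a 0; first by rewrite normr0 mul0r scale0r (CM0).2.
have [_] := CMZ_le a^-1 H1; rewrite scalerA mulVf// scale1r normfV.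
by rewrite ler_pdivlMl// normr_gt0.
Qed.

Lemma cm_norm_gt0 h : CMH h -> h != 0 -> 0 < CMn h.
Proof.
move=> Hh h0; rewrite lt_neqAle cm_norm_ge0// andbT eq_sym; apply/eqP => e.
have [l [hl _ lh]] := norming_functional h.
have := functional_CM_le Hh hl; rewrite lh e mul0r normr_id normr_le0.
by rewrite (negbTE h0).
Qed.

(** Near-maximisers of the supremum defining |h|, rescaled by |h|. The element of L^2 representing
    [h] has variance |h|^2 and value |h|^2 at [h]; [lam j] keeps the first as an upper bound and
    misses the second by at most |h| / (j + 1). *)
Definition approximating h (lam : nat -> X -> R) :=
  forall j, [/\ cont_linear_functional (lam j), q (lam j) <= CMn h ^+ 2 &
    CMn h ^+ 2 - CMn h * j.+1%:R^-1 <= lam j h].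

Let approximating_ex h : CMH h -> exists lam, approximating h lam.
Proof.
move=> Hh.
have [j|lam H] := @choice nat (X -> R) (fun j l => [/\ cont_linear_functional l,
    q l <= CMn h ^+ 2 & CMn h ^+ 2 - CMn h * j.+1%:R^-1 <= l h]); last by exists lam.
have [l [hl ql lh]] : exists l, [/\ cont_linear_functional l, q l <= 1 & CMn h - j.+1%:R^-1 <= l h].
  apply: contrapT => H.
  have [_] : CMH h /\ CMn h <= CMn h - j.+1%:R^-1.
    apply: CM_leP => l hl ql; rewrite leNgt; apply/negP => lh.
    by apply: H; exists l; split => //; exact: ltW.
  have : (0 : R) < j.+1%:R^-1 by rewrite invr_gt0.
  by move: (j.+1%:R^-1) => d; lra.
exists (fun x => CMn h * l x); split; first exact: cont_linear_functionalZ.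
- by rewrite varianceZ// ler_piMr// sqr_ge0.
- by rewrite expr2 -mulrBr ler_wpM2l// cm_norm_ge0.
Qed.

Definition cmseq h : nat -> X -> R := xget (fun _ _ => 0) (approximating h).

Lemma cmseqP h : CMH h -> approximating h (cmseq h).
Proof. by move=> /approximating_ex[lam H]; exact: (@xgetI _ _ _ lam). Qed.

(** Parallelogram law. With d and e the two reciprocals, the sum of the functionals is at least 2
    |h|^2 - |h| (d + e) at [h], so its variance is at least (2 |h| - (d + e))^2, while each single
    variance is at most |h|^2. *)
Lemma cmseq_cauchy h i j : CMH h ->
  q (fun x => cmseq h i x - cmseq h j x) <= 4 * CMn h * (i.+1%:R^-1 + j.+1%:R^-1).
Proof.
move=> Hh; have [hi qi li] := cmseqP Hh i; have [hj qj lj] := cmseqP Hh j.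
have hNj := cont_linear_functionalZ (-1) hj.
have -> : (fun x => cmseq h i x - cmseq h j x) = (fun x => cmseq h i x + -1 * cmseq h j x).
  by apply/funext => x; rewrite mulN1r.
have e1 := varianceD hi hNj.
have e2 := varianceD hi hj.
rewrite varianceZ// sqrrN expr1n mul1r in e1.
have e3 : E (fun y => cmseq h i y * (-1 * cmseq h j y)) = - E (fun y => cmseq h i y * cmseq h j y).
  rewrite -[RHS]mulN1r -expectZ; last exact: (sqintegrable_mul (sqintegrable_functional gauss hi)
     (sqintegrable_functional gauss hj)).
  by congr expect; apply/funext => y; ring.
rewrite e3 in e1.
have := functional_CM_sqr_le Hh (cont_linear_functionalD hi hj).
have w0 := variance_ge0 (fun x => cmseq h i x + cmseq h j x).
rewrite e2 in w0 *; rewrite e1.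
have N0 : 0 <= CMn h by exact: cm_norm_ge0.
have : (0 : R) <= i.+1%:R^-1 by rewrite invr_ge0.
have : (0 : R) <= j.+1%:R^-1 by rewrite invr_ge0.
move: (j.+1%:R^-1) (i.+1%:R^-1) li lj w0 => d e.
move: (E _) (cmseq h i h) (cmseq h j h) (q (cmseq h i)) (q (cmseq h j)) (CMn h) qi qj N0.
move=> ip u v a b N qi qj N0 li lj w0 d0 e0 H.
have [tN|Nt] := leP (d + e) (2 * N).
- have [N00|Nn0] := eqVneq N 0.
    by rewrite N00 expr0n/= in qi qj *; lra.
  have Np : 0 < N by rewrite lt_neqAle eq_sym Nn0.
  have S0 : 0 <= N * (2 * N - (d + e)) by rewrite mulr_ge0// subr_ge0.
  have S1 : N * (2 * N - (d + e)) <= u + v.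
    by rewrite (_ : N * _ = (N ^+ 2 - N * d) + (N ^+ 2 - N * e)); [lra|ring].
  have S2 : (N * (2 * N - (d + e))) ^+ 2 <= (u + v) ^+ 2.
    by rewrite lerXn2r// nnegrE (le_trans S0).
  have := le_trans S2 H; rewrite exprMn ler_pM2l ?exprn_gt0// => S3.
  have : (2 * N - (d + e)) ^+ 2 = 4 * N ^+ 2 - 4 * N * (d + e) + (d + e) ^+ 2 by ring.
  have := sqr_ge0 (d + e); rewrite (addrC d e); lra.
(* Here the lower bound on the variance of the sum is void, but the trivial bound 4 |h|^2 is already
   at most 2 |h| (d + e). *)
- have : 2 * N * (2 * N) <= 2 * N * (d + e) by rewrite ler_wpM2l ?mulr_ge0// ltW.
  rewrite (_ : 2 * N * (2 * N) = 4 * N ^+ 2); last by ring.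
  have : 0 <= N * (d + e) by rewrite mulr_ge0// addr_ge0.
  rewrite (_ : 2 * N * (d + e) = 2 * (N * (d + e))); last by ring.
  rewrite (_ : 4 * N * (e + d) = 4 * (N * (d + e))); last by ring.
  lra.
Qed.

End CameronMartin.

(** * The derivative in a Cameron-Martin direction *)

Section FirstOrder.
Context {R : realType} {X : normedModType R} (gam : probability (borel_X X) R).
Hypothesis gauss : centered_gaussian gam.
Implicit Types (l m : X -> R) (h k : X) (G F : X -> R).
Local Notation E := (expect gam).
Local Notation CMn := (cm_norm gam).
Local Notation CMH := (CM gam).
Local Notation q := (variance_of gam).

Lemma cvgn_cauchy (u : nat -> R) :
  (forall e, 0 < e -> exists N, forall n, (N <= n)%N -> `|u N - u n| < e) -> cvgn u.
Proof.
move=> H; apply: R_complete; apply: cauchy_exP => e e0.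
by have [N hN] := H e e0; exists (u N); exists N.
Qed.

(* The derivative of [t |-> E[G(. + t h)]] at 0, that is E[G h^], where h^ is the L^2 limit
   of [cmseq gam h]. *)
Definition cm_deriv h G : R := limn (fun j => E (fun y => G y * cmseq gam h j y)).

Lemma cm_deriv_cvg h G : CMH h -> sqintegrable gam G ->
  E (fun y => G y * cmseq gam h j y) @[j --> \oo] --> cm_deriv h G.
Proof.
move=> Hh sG; apply: cvgn_cauchy => e e0.
(* By Cauchy-Schwarz and [cmseq_cauchy], increments beyond the index N are at most the square root
   of K / (N + 1). The 8 is twice the constant 4 there, since 1 / (n + 1) is at most 1 / (N + 1). *)
pose K := E (fun y => G y ^+ 2) * (8 * CMn h).
have K0 : 0 <= K.
  by rewrite mulr_ge0 ?mulr_ge0 ?cm_norm_ge0//; apply: expect_ge0 => x; exact: sqr_ge0.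
exists (Num.truncn (K / e ^+ 2)) => n; set N := Num.truncn _ => Nn.
have [hN _ _] := cmseqP gauss Hh N; have [hn _ _] := cmseqP gauss Hh n.
have sN := sqintegrable_functional gauss hN; have sn := sqintegrable_functional gauss hn.
have iN := sqintegrable_mul sG sN; have i_n := sqintegrable_mul sG sn.
rewrite -expectB//.
rewrite (_ : (fun y => _) = (fun y => G y * (cmseq gam h N y - cmseq gam h n y))); last first.
  by apply/funext => y; rewrite mulrBr.
have sNn : sqintegrable gam (fun y => cmseq gam h N y - cmseq gam h n y).
  have := sqintegrableD sN (sqintegrableZ (-1) sn).
  by congr (sqintegrable gam); apply/funext => y; rewrite mulN1r.
apply: le_lt_trans (expect_cauchy_schwarz sG sNn) _.
rewrite -sqrtrM; last by apply: expect_ge0 => x; exact: sqr_ge0.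
rewrite -(ger0_norm (ltW e0)) -sqrtr_sqr ltr_sqrt ?exprn_gt0//.
have d0 : (n.+1%:R : R)^-1 <= N.+1%:R^-1 by rewrite lef_pV2 ?posrE// ler_nat ltnS.
have h2 : E (fun y => (cmseq gam h N y - cmseq gam h n y) ^+ 2) <= 8 * CMn h * N.+1%:R^-1.
  apply: le_trans (cmseq_cauchy gauss N n Hh) _.
  have := cm_norm_ge0 gauss Hh; move: (CMn h) => M M0.
  move: (n.+1%:R^-1) (N.+1%:R^-1) d0 => a b ab.
  have : M * a <= M * b by rewrite ler_wpM2l.
  rewrite (_ : 4 * M * (b + a) = 4 * (M * b) + 4 * (M * a)); last by ring.
  rewrite (_ : 8 * M * b = 8 * (M * b)); last by ring.
  by lra.
apply: le_lt_trans (_ : K * N.+1%:R^-1 < _).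
  by rewrite /K -mulrA ler_wpM2l//; apply: expect_ge0 => x; exact: sqr_ge0.
rewrite ltr_pdivrMr// mulrC -ltr_pdivrMr ?exprn_gt0//.
exact: Num.Theory.truncnS_gt.
Qed.

Lemma cm_deriv_le h G : CMH h -> sqintegrable gam G ->
  `|cm_deriv h G| <= CMn h * Num.sqrt (E (fun y => G y ^+ 2)).
Proof.
move=> Hh sG.
apply: (cvgr_to_le (cvg_norm (cm_deriv_cvg Hh sG))); apply: nearW => j.
have [hj qj _] := cmseqP gauss Hh j.
apply: le_trans (expect_cauchy_schwarz sG (sqintegrable_functional gauss hj)) _.
rewrite mulrC ler_wpM2r ?sqrtr_ge0//.
rewrite -(ger0_norm (cm_norm_ge0 gauss Hh)) -sqrtr_sqr; exact: ler_wsqrtr.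
Qed.

Lemma cm_deriv_linear h c F G : CMH h -> sqintegrable gam F -> sqintegrable gam G ->
  cm_deriv h (fun y => c * F y + G y) = c * cm_deriv h F + cm_deriv h G.
Proof.
move=> Hh sF sG.
apply/cvg_lim => //.
rewrite (_ : (fun j => _) = (fun j => c * E (fun y => F y * cmseq gam h j y) +
    E (fun y => G y * cmseq gam h j y))).
  by apply: cvgD; [apply: cvgMl_tmp|]; exact: cm_deriv_cvg.
apply/funext => j; have [hj qj _] := cmseqP gauss Hh j.
have sj := sqintegrable_functional gauss hj.
have iF := sqintegrable_mul sF sj; have iG := sqintegrable_mul sG sj.
rewrite -expectZ// -expectD//; last exact: eintegrableZ.
by congr expect; apply/funext => y; rewrite mulrDl mulrA.
Qed.

(** Bounded pointwise convergence implies convergence in L^2, where [cm_deriv_le] makes [cm_deriv]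
    continuous. *)
Lemma cm_deriv_bounded_limit h (G_ : nat -> X -> R) G (M : R) : CMH h ->
  (forall n, bmeasurable (G_ n)) -> (forall n x, `|G_ n x| <= M) ->
  (forall x, G_ n x @[n --> \oo] --> G x) ->
  cm_deriv h (G_ n) @[n --> \oo] --> cm_deriv h G.
Proof.
move=> Hh mG bG cG.
have mg := bmeasurable_cvg mG cG; have bg := bounded_limit bG cG.
have sG n := bounded_sqintegrable gam (mG n) (bG n); have sg := bounded_sqintegrable gam mg bg.
have sd n : sqintegrable gam (fun y => G_ n y - G y).
  have := sqintegrableD (sG n) (sqintegrableZ (-1) sg).
  by congr (sqintegrable gam); apply/funext => y; rewrite mulN1r.
have e n : cm_deriv h (G_ n) - cm_deriv h G = cm_deriv h (fun y => G_ n y - G y).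
  have := cm_deriv_linear (-1) Hh sg (sG n).
  rewrite mulN1r addrC => <-; congr (cm_deriv h); apply/funext => y.
  by rewrite mulN1r addrC.
have c0 : CMn h * Num.sqrt (E (fun y => (G_ n y - G y) ^+ 2)) @[n --> \oo] --> 0.
  rewrite -(mulr0 (CMn h)); apply: cvgMl_tmp.
  rewrite -(@sqrtr0 R) -(expect_cst gam 0).
  apply: continuous_cvg; first exact: sqrt_continuous.
  apply: (@expect_cvg _ _ _ _ _ ((M + M) ^+ 2)).
  - by move=> n; apply: measurable_funX; have [] := sd n.
  - move=> n x; have M0 : 0 <= M := le_trans (normr_ge0 _) (bg x).
    rewrite normrX lerXn2r ?nnegrE ?addr_ge0//.
    by apply: le_trans (ler_normB _ _) _; apply: lerD; [exact: bG|exact: bg].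
  - move=> x; have d0 : G_ n x - G x @[n --> \oo] --> (0 : R).
      by rewrite -(subrr (G x)); apply: cvgB; [exact: cG|exact: cvg_cst].
    have d2 : (G_ n x - G x) * (G_ n x - G x) @[n --> \oo] --> (0 * 0 : R) := cvgM d0 d0.
    by rewrite mulr0 in d2; exact: d2.
have c1 : cm_deriv h (fun y => G_ n y - G y) @[n --> \oo] --> 0.
  apply: norm_cvg0.
  apply: (@squeeze_cvgr _ _ _ _ (fun=> 0) (fun n => CMn h * Num.sqrt (E (fun y => (G_ n y - G y) ^+ 2)))) => //.
  - by apply: nearW => n; rewrite normr_ge0/=; exact: cm_deriv_le.
  - exact: cvg_cst.
have c2 : cm_deriv h (fun y => G_ n y - G y) + cm_deriv h G @[n --> \oo] --> 0 + cm_deriv h G.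
  by apply: cvgD => //; exact: cvg_cst.
rewrite add0r in c2; apply: cvg_trans c2.
by apply: near_eq_cvg; apply: nearW => n /=; rewrite -e subrK.
Qed.

End FirstOrder.

(** * The derivative of a cosine *)

Section FirstOrderCosine.
Context {R : realType} {X : normedModType R} (gam : probability (borel_X X) R).
Hypothesis gauss : centered_gaussian gam.
Implicit Types (l m : X -> R) (h k : X) (G F : X -> R).
Local Notation E := (expect gam).
Local Notation CMn := (cm_norm gam).
Local Notation CMH := (CM gam).
Local Notation q := (variance_of gam).

(* [cmseq gam h] nearly maximises [l h] under a bound on [q l]; comparing with its
   perturbations in the direction [m] gives the reproducing property. *)
Lemma cm_deriv_functional h m : CMH h -> cont_linear_functional m -> cm_deriv gam h m = m h.
Proof.
move=> Hh hm; have sm := sqintegrable_functional gauss hm.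
set L := cm_deriv gam h m; set N := CMn h.
have N0 : 0 <= N by exact: cm_norm_ge0.
have [N00|Nn0] := eqVneq N 0.
  have := cm_deriv_le gauss Hh sm; have := functional_CM_le gauss Hh hm.
  by rewrite -/N N00 !mul0r !normr_le0 => /eqP -> /eqP.
have Np : 0 < N by rewrite lt_neqAle eq_sym Nn0.
have cL := cm_deriv_cvg gauss Hh sm.
have cN : cmseq gam h j h @[j --> \oo] --> N ^+ 2.
  apply: (@squeeze_cvgr _ _ _ _ (fun j : nat => N ^+ 2 - N * j.+1%:R^-1) (fun=> N ^+ 2)).
  - apply: nearW => j; have [hj qj ->] := cmseqP gauss Hh j; rewrite /=.
    apply: le_trans (ler_norm _) _; apply: le_trans (functional_CM_le gauss Hh hj) _.
    rewrite expr2 ler_wpM2l// -(ger0_norm N0) -sqrtr_sqr; exact: ler_wsqrtr.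
  - rewrite -[X in _ --> X]subr0 -[X in _ --> _ - X](mulr0 N).
    apply: cvgB; first exact: cvg_cst.
    by apply: cvgMl_tmp; exact: cvg_harmonic.
  - exact: cvg_cst.
have Q e : (N ^+ 2 + e * m h) ^+ 2 <= N ^+ 2 * (N ^+ 2 + 2 * (e * L) + e ^+ 2 * q m).
  have c1 : (cmseq gam h j h + e * m h) * (cmseq gam h j h + e * m h) @[j --> \oo]
      --> (N ^+ 2 + e * m h) * (N ^+ 2 + e * m h).
    by apply: cvgM; (apply: cvgD; [exact: cN|exact: cvg_cst]).
  have c2 : N ^+ 2 * (N ^+ 2 + 2 * (e * E (fun y => m y * cmseq gam h j y)) + e ^+ 2 * q m)
     @[j --> \oo] --> N ^+ 2 * (N ^+ 2 + 2 * (e * L) + e ^+ 2 * q m).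
    apply: cvgMl_tmp; apply: cvgD; last exact: cvg_cst.
    apply: cvgD; first exact: cvg_cst.
    by apply: cvgMl_tmp; apply: cvgMl_tmp; exact: cL.
  rewrite expr2; apply: (ler_cvg_to c1 c2); apply: nearW => j.
  have [hj qj _] := cmseqP gauss Hh j.
  have hem := cont_linear_functionalZ e hm.
  rewrite -expr2; apply: le_trans (functional_CM_sqr_le gauss Hh (cont_linear_functionalD hj hem)) _.
  rewrite -/N ler_wpM2l ?sqr_ge0// varianceD// varianceZ//.
  rewrite lerD2r lerD//; rewrite -[X in _ <= 2 * X]expectZ; last first.
    exact: (sqintegrable_mul sm (sqintegrable_functional gauss hj)).
  rewrite le_eqVlt; apply/orP; left; apply/eqP; congr (2 * _).
  by congr expect; apply/funext => y; ring.
pose D := N ^+ 2 * (m h - L); pose K := N ^+ 2 * q m.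
have K0 : 0 <= K by rewrite mulr_ge0 ?sqr_ge0 ?variance_ge0.
have Q2 e : 2 * e * D <= e ^+ 2 * K.
  have := Q e; have := sqr_ge0 (e * m h).
  rewrite (_ : (N ^+ 2 + e * m h) ^+ 2 = N ^+ 2 * N ^+ 2 + 2 * e * (N ^+ 2 * m h) + (e * m h) ^+ 2); last by ring.
  rewrite (_ : N ^+ 2 * (_ + _ + _) = N ^+ 2 * N ^+ 2 + 2 * e * (N ^+ 2 * L) + e ^+ 2 * K); last by rewrite /K; ring.
  by rewrite /D mulrBr mulrBr; lra.
have K1 : 0 < K + 1 by rewrite ltr_wpDl.
have D0 : D = 0.
  (* At this [e] the inequality becomes D^2 (2 K + 2) <= D^2 K, which forces [D = 0]. *)
  have := Q2 (D / (K + 1)).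
  rewrite -(@ler_pM2r _ ((K + 1) ^+ 2)) ?exprn_gt0//.
  rewrite (_ : _ * (K + 1) ^+ 2 = D ^+ 2 * (2 * K + 2)); last by field; rewrite gt_eqF.
  rewrite [leRHS](_ : _ = D ^+ 2 * K); last by field; rewrite gt_eqF.
  rewrite -subr_le0 -mulrBr (_ : 2 * K + 2 - K = K + 2); last by ring.
  rewrite pmulr_lle0 ?ltr_wpDl// => D2.
  by apply/eqP; rewrite -sqrf_eq0 eq_le D2 sqr_ge0.
move/eqP: D0; rewrite /D mulf_eq0 expf_eq0 (negbTE Nn0)/= subr_eq0 => /eqP.
by [].
Qed.

Let sqintegrable_cos m c : cont_linear_functional m -> sqintegrable gam (fun y => cos (m y + c)).
Proof.
move=> hm; apply: (@bounded_sqintegrable _ _ _ _ 1).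
  exact: (cyl_bmeasurable (cyl_cos c hm)).
by move=> x; rewrite ler_norml cos_geN1 cos_le1.
Qed.

(** Both sides are minus the derivative at e = 0 of E[cos(m + e l + d)] with d = c + pi / 2,
    computed once under the expectation and once from the characteristic function of m + e l. *)
Lemma expect_cos_mul l m c : cont_linear_functional l -> cont_linear_functional m ->
  E (fun y => cos (m y + c) * l y) = - sin c * E (fun y => m y * l y) * expR (- q m / 2).
Proof.
move=> hl hm.
have sl := sqintegrable_functional gauss hl; have sm := sqintegrable_functional gauss hm.
have [_ il] := sl.
pose d := c + pi / 2.
have sinD x : sin (x + d) = cos (x + c) by rewrite /d addrA sinDpihalf.
have cosd : cos d = - sin c by rewrite /d cosDpihalf.
pose F e := E (fun y => cos ((m y + e * l y) + d)).
have FE e : F e = cos d * expR (- (q m + 2 * (e * E (fun y => m y * l y)) + e ^+ 2 * q l) / 2).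
  have hel := cont_linear_functionalZ e hl.
  rewrite /F (expect_cos_functional gauss d (cont_linear_functionalD hm hel)).
  congr (_ * expR (- _ / 2)); rewrite -/(q _) varianceD// varianceZ//.
  rewrite -[X in _ = _ + 2 * X + _]expectZ; last exact: sqintegrable_mul.
  congr (_ + 2 * _ + _); congr expect; apply/funext => y; ring.
have icos e : eintegrable gam (fun y => cos ((m y + e * l y) + d)).
  have hel := cont_linear_functionalZ e hl.
  have := sqintegrable_cos d (cont_linear_functionalD hm hel) => -[mc _].
  apply: (@bounded_eintegrable _ _ gam _ 1) => // x.
  by rewrite ler_norml cos_geN1 cos_le1.
have iml := sqintegrable_mul (sqintegrable_cos c hm) sl.
have d1 : is_derive (0 : R) (1 : R) F (- E (fun y => cos (m y + c) * l y)).
  apply: (@is_derive_quadratic _ _ _ _ (q l)) => e.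
  rewrite add0r mulrN opprK /F -expectB//.
  rewrite -expectZ// -expectD//; last 2 first.
  - exact: eintegrableB.
  - exact: eintegrableZ.
  have iD : eintegrable gam (fun y => cos (m y + e * l y + d) - cos (m y + 0 * l y + d) +
     e * (cos (m y + c) * l y)).
    by apply: eintegrableD; [exact: eintegrableB|exact: eintegrableZ].
  apply: le_trans (norm_expect iD) _.
  rewrite mulrC -expectZ//; apply: expect_le; [exact: (integrable_norm iD)|exact: eintegrableZ|].
  move=> x; rewrite mul0r addr0 -sinD (_ : m x + e * l x + d = m x + d + e * l x); last by ring.
  rewrite -exprMn (_ : e * (sin _ * l x) = (e * l x) * sin (m x + d)); last by ring.
  exact: cos_taylor1.
have d2 : is_derive (0 : R) (1 : R) F (sin c * E (fun y => m y * l y) * expR (- q m / 2)).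
  rewrite (funext FE) cosd.
  move: (E _) (q m) (q l) => ip a b.
  have e1 : (fun e => - (a + 2 * (e * ip) + e ^+ 2 * b) / 2) =
     (fun e => (- (b / 2)) * e ^+ 2 + ((- ip) * e + (- (a / 2)))).
    by apply/funext => e; field.
  have e2 : (fun e : R => - sin c * expR (- (a + 2 * (e * ip) + e ^+ 2 * b) / 2)) =
     (fun e => - sin c * expR ((- (b / 2)) * e ^+ 2 + ((- ip) * e + (- (a / 2))))).
    by apply/funext => e; have /(congr1 (fun f => f e)) /= -> := e1.
  rewrite e2.
  have da : is_derive (0 : R) (1 : R) (fun e : R => (- (b / 2)) * e ^+ 2 + ((- ip) * e + (- (a / 2)))) (- ip).
    have d3 := is_deriveZ (- (b / 2)) (is_deriveX 2 (is_derive_id (0 : R) (1 : R))).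
    have d4 := is_deriveD (is_deriveZ (- ip) (is_derive_id (0 : R) (1 : R))) (is_derive_cst (- (a / 2)) (0 : R) (1 : R)).
    apply: is_derive_eq (is_deriveD d3 d4) _.
    by rewrite /= /GRing.scale/=; ring.
  have db := @is_derive1_comp R expR _ 0 _ _ (is_derive_expR _) da.
  apply: is_derive_eq (is_deriveZ (- sin c) db) _.
  by rewrite expr0n/= !mulr0 !add0r /GRing.scale/= (_ : - (a / 2) = - a / 2); ring.
have [_ v1] := d1; have [_ v2] := d2.
by apply: oppr_inj; rewrite -v1 v2; ring.
Qed.

Lemma cm_deriv_cos h m c : CMH h -> cont_linear_functional m ->
  cm_deriv gam h (fun y => cos (m y + c)) = - sin c * m h * expR (- q m / 2).
Proof.
move=> Hh hm; apply/cvg_lim => //.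
rewrite (_ : (fun j => _) = (fun j => - sin c * E (fun y => m y * cmseq gam h j y) * expR (- q m / 2))).
  rewrite -(cm_deriv_functional Hh hm); apply: cvgMr_tmp; apply: cvgMl_tmp.
  exact: cm_deriv_cvg (sqintegrable_functional gauss hm).
apply/funext => j; have [hj _ _] := cmseqP gauss Hh j; exact: expect_cos_mul.
Qed.

End FirstOrderCosine.

(** * Higher derivatives *)

Section HigherOrder.
Context {R : realType} {X : normedModType R} (gam : probability (borel_X X) R).
Hypothesis gauss : centered_gaussian gam.
Implicit Types (l m : X -> R) (h k : X) (G F : X -> R) (hs : seq X).
Local Notation E := (expect gam).
Local Notation CMn := (cm_norm gam).
Local Notation CMH := (CM gam).
Local Notation q := (variance_of gam).
(** A rational Pythagorean pair: the variances recombine as 9/25 + 16/25 = 1, an identity that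
    [field] can check. *)
Local Notation rotated G y := (fun z => G ((3 / 5 : R) *: y + (4 / 5 : R) *: z)).

Lemma cyl_sqintegrable G : cyl G -> sqintegrable gam G.
Proof.
move=> cG; have [M bG] := cyl_bounded cG.
exact: bounded_sqintegrable (cyl_bmeasurable cG) bG.
Qed.

Lemma cyl_eintegrable G : cyl G -> eintegrable gam G.
Proof.
move=> cG; have [M bG] := cyl_bounded cG.
exact: bounded_eintegrable (cyl_bmeasurable cG) bG.
Qed.

Lemma cm_deriv_dir_linear (a : R) h k G : CMH h -> CMH k -> cyl G ->
  cm_deriv gam (a *: h + k) G = a * cm_deriv gam h G + cm_deriv gam k G.
Proof.
move=> Hh Hk.
have [Hah _] := CMZ gauss a Hh; have [Hs _] := CMD gauss Hah Hk.
elim=> [m c hm|c {}F {}G cF IF cG IG|G_ {}G M cG IG GM lG].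
- by have [mD mZ _] := hm; rewrite !cm_deriv_cos// mD mZ; ring.
- have sF := cyl_sqintegrable cF; have sG := cyl_sqintegrable cG.
  rewrite (cm_deriv_linear gauss c Hs sF sG) (cm_deriv_linear gauss c Hh sF sG).
  rewrite (cm_deriv_linear gauss c Hk sF sG) IF IG.
  move: (cm_deriv gam h F) (cm_deriv gam h G) (cm_deriv gam k F) (cm_deriv gam k G) => u v w z.
  by ring.
- have mG n := cyl_bmeasurable (cG n).
  have c1 := cm_deriv_bounded_limit gauss Hs mG GM lG.
  have c2 := cm_deriv_bounded_limit gauss Hh mG GM lG.
  have c3 := cm_deriv_bounded_limit gauss Hk mG GM lG.
  apply: (cvg_unique _ c1) => //.
  have c4 : a * cm_deriv gam h (G_ n) + cm_deriv gam k (G_ n) @[n --> \oo] -->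
     a * cm_deriv gam h G + cm_deriv gam k G by apply: cvgD; [apply: cvgMl_tmp; exact: c2|exact: c3].
  by apply: cvg_trans c4; apply: near_eq_cvg; apply: nearW => n /=; rewrite IG.
Qed.

Lemma cyl_rotate G (y : X) : cyl G -> cyl (rotated G y).
Proof. exact: cyl_affine. Qed.

(* Since [(3/5) y + (4/5) z] has law [gam] when [y, z] are independent with law [gam], an
   (n+1)-st derivative of [E[G(. + x)]] at 0 can be split into a first derivative acting on
   the part [(3/5) y] and an n-th derivative acting on the part [(4/5) z]. *)
Fixpoint cm_derivs hs G : R :=
  match hs with
  | [::] => E G
  | h :: hs' => (5 / 3) * (5 / 4) ^+ size hs' *
      cm_deriv gam h (fun y => cm_derivs hs' (rotated G y))
  end.

Fixpoint all_CM hs : Prop :=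
  match hs with [::] => True | h :: hs' => CMH h /\ all_CM hs' end.

(** The constant obtained by iterating [cm_deriv_le]. The factor 5/3 and the powers of 5/4 undo the
    chain rule, which yields 3/5 for the derivative in [y] and 4/5 for each derivative in [z]. *)
Fixpoint derivs_bound hs : R :=
  match hs with
  | [::] => 1
  | h :: hs' => (5 / 3) * (5 / 4) ^+ size hs' * CMn h * derivs_bound hs'
  end.

Fixpoint prod_functional m hs : R :=
  match hs with [::] => 1 | h :: hs' => m h * prod_functional m hs' end.

Lemma derivs_bound_ge0 hs : all_CM hs -> 0 <= derivs_bound hs.
Proof.
elim: hs => //= h hs IH [Hh Hhs].
by rewrite !mulr_ge0 ?exprn_ge0 ?cm_norm_ge0 ?IH// divr_ge0.
Qed.

Let shift_cos (c : R) n : - sin (c + n%:R * (pi / 2)) = cos (c + n.+1%:R * (pi / 2)).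
Proof. by rewrite -[n.+1%:R in RHS]natr1 [X in cos (_ + X)]mulrDl mul1r addrA cosDpihalf. Qed.

Let derivs_coef n : (0 : R) <= (5 / 3) * (5 / 4) ^+ n.
Proof. by rewrite mulr_ge0// ?exprn_ge0// divr_ge0. Qed.

(** Bundled for a single induction on [hs]: together the four properties place the inner function of
    [y] in [cyl], by [derivs_spec_cyl], and only then can the next [cm_deriv] be controlled. *)
Let derivs_spec hs :=
  [/\ (forall c F G, cyl F -> cyl G ->
        cm_derivs hs (fun y => c * F y + G y) = c * cm_derivs hs F + cm_derivs hs G),
      (forall G M, cyl G -> (forall x, `|G x| <= M) -> `|cm_derivs hs G| <= derivs_bound hs * M),
      (forall (G_ : nat -> X -> R) G M, (forall n, cyl (G_ n)) -> (forall n x, `|G_ n x| <= M) ->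
        (forall x, G_ n x @[n --> \oo] --> G x) -> cm_derivs hs (G_ n) @[n --> \oo] --> cm_derivs hs G) &
      (forall m c, cont_linear_functional m -> cm_derivs hs (fun y => cos (m y + c)) =
         cos (c + (size hs)%:R * (pi / 2)) * prod_functional m hs * expR (- q m / 2))].

Let derivs_spec_cyl hs : all_CM hs -> derivs_spec hs -> forall G, cyl G ->
  cyl (fun y => cm_derivs hs (rotated G y)).
Proof.
move=> Hhs [lin bnd lim dcos] G; elim=> [m c hm|c {}F {}G cF IF cG IG|G_ {}G M cG IG GM lG].
- have [mD mZ _] := hm.
  rewrite (_ : (fun y => _) = (fun y => (prod_functional (fun x => (4 / 5) * m x) hs *
    expR (- q (fun x => (4 / 5) * m x) / 2)) *
      cos ((3 / 5) * m y + (c + (size hs)%:R * (pi / 2))))).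
    by apply/cylZ/cyl_cos/cont_linear_functionalZ.
  apply/funext => y.
  rewrite (_ : (fun z => _) = (fun z => cos ((4 / 5) * m z + ((3 / 5) * m y + c)))); last first.
    by apply/funext => z; rewrite mD !mZ; congr cos; ring.
  rewrite dcos; last exact: cont_linear_functionalZ.
  by rewrite -addrA; ring.
- rewrite (_ : (fun y => _) = (fun y => c * cm_derivs hs (rotated F y)
     + cm_derivs hs (rotated G y))).
    exact: cyl_linear.
  by apply/funext => y; rewrite lin//; exact: cyl_rotate.
- apply: (cyl_limit (M := derivs_bound hs * M) IG).
  + by move=> n y; apply: bnd; [exact: cyl_rotate|move=> x; exact: GM].
  + by move=> y; apply: (lim _ _ M) => [n|n x|x]; [exact: cyl_rotate|exact: GM|exact: lG].
Qed.

Let derivs_specP hs : all_CM hs -> derivs_spec hs.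
Proof.
elim: hs => [_|h hs IH [Hh Hhs]].
  split => /=.
  - move=> c F G /cyl_eintegrable iF /cyl_eintegrable iG.
    by rewrite expectD ?expectZ//; exact: eintegrableZ.
  - by move=> G M cG bG; rewrite mul1r; apply: norm_expect_le => //; exact: cyl_bmeasurable.
  - by move=> G_ G M cG GM lG; apply: (@expect_cvg _ _ gam G_ G M) => // n; exact: cyl_bmeasurable.
  - by move=> m c hm; rewrite expect_cos_functional// mul0r addr0 mulr1.
have {}IH := IH Hhs; have cylh := derivs_spec_cyl Hhs IH; have [lin bnd lim dcos] := IH.
split.
- move=> c F G cF cG /=.
  rewrite (_ : (fun y => _) = (fun y => c * cm_derivs hs (rotated F y)
     + cm_derivs hs (rotated G y))); last first.
    by apply/funext => y; rewrite lin//; exact: cyl_rotate.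
  rewrite cm_deriv_linear//; [by ring|exact/cyl_sqintegrable/cylh|exact/cyl_sqintegrable/cylh].
- move=> G M cG bG /=.
  rewrite normrM (ger0_norm (derivs_coef _)) -!(mulrA (_ * _ ^+ _)) ler_wpM2l//.
  rewrite -mulrA.
  have bb y : `|cm_derivs hs (rotated G y)| <= derivs_bound hs * M.
    by apply: bnd => [|x]; [exact: cyl_rotate|exact: bG].
  have M0 : 0 <= derivs_bound hs * M by exact: le_trans (bb 0).
  apply: le_trans (cm_deriv_le gauss Hh (cyl_sqintegrable (cylh _ cG))) _.
  rewrite ler_wpM2l ?cm_norm_ge0// -[leRHS]ger0_norm// -sqrtr_sqr ler_wsqrtr//.
  rewrite -[leRHS](expect_cst gam); apply: expect_le.
  + exact: (proj2 (cyl_sqintegrable (cylh _ cG))).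
  + exact: cyl_eintegrable (cyl_cst _).
  + by move=> y; rewrite -(real_normK (num_real (cm_derivs _ _))) lerXn2r ?nnegrE.
- move=> G_ G M cG GM lG /=; apply: cvgMl_tmp.
  apply: (@cm_deriv_bounded_limit _ _ _ gauss _ _ _ (derivs_bound hs * M)) => //.
  + by move=> n; exact: (cyl_bmeasurable (cylh _ (cG n))).
  + by move=> n y; apply: bnd => [|x]; [exact: cyl_rotate|exact: GM].
  + by move=> y; apply: (lim _ _ M) => [n|n x|x]; [exact: cyl_rotate|exact: GM|exact: lG].
- move=> m c hm /=; have [mD mZ _] := hm.
  (* The inner derivative of a rotated cosine is a multiple of a cosine in [y]; the added 0 gives it
     the shape in which [cm_deriv_linear] extracts the factor. *)
  rewrite (_ : (fun y => _) = (fun y => (prod_functional (fun x => (4 / 5) * m x) hs *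
    expR (- q (fun x => (4 / 5) * m x) / 2)) *
      cos ((3 / 5) * m y + (c + (size hs)%:R * (pi / 2))) + 0)); last first.
    apply/funext => y; rewrite addr0.
    rewrite (_ : (fun z => _) = (fun z => cos ((4 / 5) * m z + ((3 / 5) * m y + c)))); last first.
      by apply/funext => z; rewrite mD !mZ; congr cos; ring.
    rewrite dcos; last exact: cont_linear_functionalZ.
    by rewrite -addrA; ring.
  have h35 := cont_linear_functionalZ (3 / 5) hm.
  rewrite (cm_deriv_linear gauss _ Hh (cyl_sqintegrable (cyl_cos _ h35)) (cyl_sqintegrable (@cyl0 R X))).
  rewrite cm_deriv_cos// shift_cos.
  have -> : cm_deriv gam h (fun=> 0) = 0.
    have := cm_deriv_le gauss Hh (cyl_sqintegrable (@cyl0 R X)).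
    by rewrite expr0n/= expect_cst sqrtr0 mulr0 normr_le0 => /eqP.
  have -> : prod_functional (fun x => 4 / 5 * m x) hs = (4 / 5) ^+ size hs * prod_functional m hs.
    by elim: (hs) => [|k ks /= ->]; rewrite /= ?mulr1// exprS; ring.
  have -> : expR (- q m / 2) = expR (- q (fun x => 4 / 5 * m x) / 2) * expR (- q (fun x => 3 / 5 * m x) / 2).
    by rewrite -expRD !varianceZ//; congr expR; field.
  have e1 : (5 / 4 : R) ^+ size hs * (4 / 5) ^+ size hs = 1.
    by rewrite -exprMn (_ : 5 / 4 * (4 / 5) = 1) ?expr1n//; field.
  move: (expR _) (expR _) (cos _) (prod_functional _ _) ((5 / 4) ^+ _) ((4 / 5) ^+ _) e1 => a b d p u v uv.
  rewrite (_ : _ * _ = (5 / 3 * (3 / 5)) * (u * v) * (p * a * b * d * m h)); last by ring.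
  by rewrite uv; field.
Qed.

Lemma cm_derivs_linear hs c F G : all_CM hs -> cyl F -> cyl G ->
  cm_derivs hs (fun y => c * F y + G y) = c * cm_derivs hs F + cm_derivs hs G.
Proof. by move=> /derivs_specP[H _ _ _]; exact: H. Qed.

Lemma cm_derivs_le hs G M : all_CM hs -> cyl G -> (forall x, `|G x| <= M) ->
  `|cm_derivs hs G| <= derivs_bound hs * M.
Proof. by move=> /derivs_specP[_ H _ _]; exact: H. Qed.

Lemma cm_derivs_bounded_limit hs (G_ : nat -> X -> R) G M : all_CM hs ->
  (forall n, cyl (G_ n)) -> (forall n x, `|G_ n x| <= M) ->
  (forall x, G_ n x @[n --> \oo] --> G x) -> cm_derivs hs (G_ n) @[n --> \oo] --> cm_derivs hs G.
Proof. by move=> /derivs_specP[_ _ H _]; exact: H. Qed.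

Lemma cm_derivs_cos hs m c : all_CM hs -> cont_linear_functional m ->
  cm_derivs hs (fun y => cos (m y + c)) =
  cos (c + (size hs)%:R * (pi / 2)) * prod_functional m hs * expR (- q m / 2).
Proof. by move=> /derivs_specP[_ _ _ H]; exact: H. Qed.

Lemma cyl_cm_derivs hs G : all_CM hs -> cyl G ->
  cyl (fun y => cm_derivs hs (rotated G y)).
Proof. by move=> Hhs; apply: derivs_spec_cyl => //; exact: derivs_specP. Qed.

Lemma expect_rotate G : cyl G ->
  E (fun y => E (rotated G y)) = E G.
Proof.
have cE F := @cyl_cm_derivs [::] F I.
have lE (c : R) F1 F2 : cyl F1 -> cyl F2 -> E (fun y => c * F1 y + F2 y) = c * E F1 + E F2.
  exact: (@cm_derivs_linear [::] c F1 F2 I).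
elim=> [m c hm|c {}F {}G cF IF cG IG|G_ {}G M cG IG GM lG].
- have [mD mZ _] := hm.
  rewrite (_ : (fun y => _) = (fun y => expR (- q (fun x => (4 / 5) * m x) / 2) *
      cos ((3 / 5) * m y + c))); last first.
    apply/funext => y.
    rewrite (_ : (fun z => _) = (fun z => cos ((4 / 5) * m z + ((3 / 5) * m y + c)))); last first.
      by apply/funext => z; rewrite mD !mZ; congr cos; ring.
    by rewrite expect_cos_functional//; [rewrite mulrC|exact: cont_linear_functionalZ].
  have h35 := cont_linear_functionalZ (3 / 5) hm.
  rewrite expectZ; last exact: cyl_eintegrable (cyl_cos _ h35).
  rewrite !expect_cos_functional// mulrCA -expRD -!/(q _) !varianceZ//.
  by congr (_ * expR _); field.
- rewrite (_ : (fun y => _) = (fun y => c * E (rotated F y)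
     + E (rotated G y))); last first.
    by apply/funext => y; apply: lE; exact: cyl_rotate.
  by rewrite (lE _ _ _ (cE _ cF) (cE _ cG)) IF IG lE.
- have c1 := @cm_derivs_bounded_limit [::] _ _ _ I cG GM lG.
  apply: (cvg_unique _ _ c1) => //=.
  rewrite -(funext IG).
  apply: (@cm_derivs_bounded_limit [::] (fun n y => E (rotated (G_ n) y)) _ M) => //.
  + by move=> n; exact: (cE _ (cG n)).
  + move=> n y; apply: norm_expect_le => [|x]; last exact: GM.
    by apply: cyl_bmeasurable; exact: cyl_rotate.
  + move=> y; apply: (@cm_derivs_bounded_limit [::]
      (fun n z => G_ n ((3 / 5 : R) *: y + (4 / 5 : R) *: z))
      (rotated G y) M I).
    * by move=> n; exact: cyl_rotate.
    * by move=> n x; exact: GM.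
    * by move=> x; exact: lG.
Qed.

(** The outer derivative is bounded by the L^2 norm in [y] of the inner ones, these by the L^2 norm
    in [z] of the rotated function, and [expect_rotate] recombines the two. Unlike the sup norm, the
    L^2 norm of an increment of a continuous bounded function is small for small steps, which gives
    continuity in operator norm. *)
Lemma cm_derivs_L2 hs G : all_CM hs -> cyl G ->
  `|cm_derivs hs G| <= derivs_bound hs * Num.sqrt (E (fun y => G y ^+ 2)).
Proof.
elim: hs G => [|h hs IH] G /=.
  move=> _ cG; rewrite mul1r.
  have := expect_cauchy_schwarz (cyl_sqintegrable cG) (cyl_sqintegrable (@cyl1 R X)).
  rewrite expr1n expect_cst sqrtr1 mulr1.
  by rewrite (_ : (fun y => _) = G)//; apply/funext => y; rewrite mulr1.
move=> [Hh Hhs] cG.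
rewrite normrM (ger0_norm (derivs_coef _)) -!(mulrA (_ * _ ^+ _)) ler_wpM2l//.
apply: le_trans (cm_deriv_le gauss Hh (cyl_sqintegrable (cyl_cm_derivs Hhs cG))) _.
rewrite -mulrA ler_wpM2l ?cm_norm_ge0//.
have K0 := derivs_bound_ge0 Hhs.
have cG2 : cyl (fun y => G y ^+ 2) by exact: cylM.
rewrite -{1}(ger0_norm K0) -sqrtr_sqr -sqrtrM ?sqr_ge0// ler_wsqrtr//.
rewrite -(expect_rotate cG2) -expectZ; last exact: cyl_eintegrable (@cyl_cm_derivs [::] _ I cG2).
apply: expect_le.
- exact: (proj2 (cyl_sqintegrable (cyl_cm_derivs Hhs cG))).
- exact/eintegrableZ/(cyl_eintegrable (@cyl_cm_derivs [::] _ I cG2)).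
- move=> y; have := IH _ Hhs (cyl_rotate y cG).
  rewrite -(@ler_pXn2r _ 2) ?nnegrE ?mulr_ge0 ?sqrtr_ge0//.
  rewrite exprMn sqr_sqrtr ?real_normK ?num_real//.
  by apply: expect_ge0 => x; exact: sqr_ge0.
Qed.

Lemma cm_derivs_head_linear (a : R) h k hs G : CMH h -> CMH k -> all_CM hs -> cyl G ->
  cm_derivs (a *: h + k :: hs) G = a * cm_derivs (h :: hs) G + cm_derivs (k :: hs) G.
Proof.
move=> Hh Hk Hhs cG /=; rewrite cm_deriv_dir_linear//; last exact: cyl_cm_derivs.
by rewrite mulrDr mulrCA.
Qed.

Lemma cm_derivs_second_linear (a : R) h k k' hs G : CMH h -> CMH k -> CMH k' -> all_CM hs -> cyl G ->
  cm_derivs [:: h, a *: k + k' & hs] G =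
  a * cm_derivs [:: h, k & hs] G + cm_derivs [:: h, k' & hs] G.
Proof.
move=> Hh Hk Hk' Hhs cG.
have e : (fun y => cm_derivs (a *: k + k' :: hs) (rotated G y)) =
  (fun y => a * cm_derivs (k :: hs) (rotated G y) +
     cm_derivs (k' :: hs) (rotated G y)).
  by apply/funext => y; rewrite cm_derivs_head_linear//; exact: cyl_rotate.
have s1 := cyl_sqintegrable (@cyl_cm_derivs (k :: hs) G (conj Hk Hhs) cG).
have s2 := cyl_sqintegrable (@cyl_cm_derivs (k' :: hs) G (conj Hk' Hhs) cG).
have e2 := cm_deriv_linear gauss a Hh s1 s2.
change (5 / 3 * (5 / 4) ^+ (size hs).+1 * cm_deriv gam h (fun y => cm_derivs (a *: k + k' :: hs)
  (rotated G y)) = a * cm_derivs [:: h, k & hs] G +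
  cm_derivs [:: h, k' & hs] G).
by rewrite e e2 mulrDr mulrCA.
Qed.

End HigherOrder.

(** * Mean value formula and Hoelder bounds *)

Section MeanValue.
Context {R : realType} {X : normedModType R} (gam : probability (borel_X X) R).
Hypothesis gauss : centered_gaussian gam.
Implicit Types (l m : X -> R) (h k : X) (G F : X -> R) (hs : seq X).
Local Notation CMn := (cm_norm gam).
Local Notation CMH := (CM gam).
Local Notation derivs := (cm_derivs gam).
Local Notation mu := (@lebesgue_measure R).

Lemma cyl_shift G k : cyl G -> cyl (fun y => G (y + k)).
Proof.
move=> cG; have := cyl_affine k 1 cG; congr cyl; apply/funext => y.
by rewrite scale1r addrC.
Qed.

Lemma integrable_bounded_itv (phi : R -> R) (a b M : R) : measurable_fun `[a, b] phi ->
  (forall s, `[a, b]%classic s -> `|phi s| <= M) -> mu.-integrable `[a, b] (EFin \o phi).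
Proof.
move=> mp bp; apply: measurable_bounded_integrable => //.
- by rewrite /= lebesgue_measure_itv/=; case: ifP => // _; rewrite ltry.
- exists M; split; rewrite ?num_real// => z Mz s sab /=.
  by apply: le_trans (bp s sab) _; exact: ltW.
Qed.

Let itv01 : fine (mu `[0, 1]%classic) = 1 :> R.
Proof. by rewrite lebesgue_measure_itv/= lte_fin ltr01 oppr0 adde0. Qed.

Lemma unit_integral_near (phi : R -> R) (c B M : R) : measurable_fun setT phi ->
  (forall s, `|phi s| <= M) -> (forall s, 0 <= s <= 1 -> `|phi s - c| <= B) ->
  `|\int[mu]_(s in `[0, 1]) phi s - c| <= B.
Proof.
move=> mp bp pc.
have ip : mu.-integrable `[0, 1] (EFin \o phi).
  by apply: (@integrable_bounded_itv _ _ _ M) => //; exact: measurable_funTS.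
have ic z : mu.-integrable `[0, 1] (EFin \o (fun=> z) : R -> \bar R).
  apply: (@integrable_bounded_itv _ _ _ `|z|) => //; exact: measurable_cst.
have cst z : \int[mu]_(s in `[0, 1]) z = z by rewrite Rintegral_cst// itv01 mulr1.
rewrite -{1}(cst c) -RintegralB//.
have ipc : mu.-integrable `[0, 1] (EFin \o (fun s => phi s - c)) by exact: (integrableB _ ip (ic c)).
apply: le_trans (le_normr_Rintegral _ ipc) _ => //.
rewrite -(cst B); apply: le_Rintegral => //.
exact: (integrable_norm ipc).
Qed.

(** Measurability in [s] travels with the identity through the induction, because it is needed to
    integrate sums and to pass to the limit under the integral. *)
Let mean_value_identity hs k G : all_CM gam hs -> CMH k -> cyl G ->
  measurable_fun setT (fun s : R => derivs (k :: hs) (fun y => G (y + s *: k))) /\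
  derivs hs (fun y => G (y + k)) - derivs hs G =
    \int[mu]_(s in `[0, 1]) derivs (k :: hs) (fun y => G (y + s *: k)).
Proof.
move=> Hhs Hk.
have Hk' : all_CM gam (k :: hs) by [].
elim=> [m c hm|c {}F {}G cF [mF IF] cG [mG IG]|G_ {}G M cG IG GM lG].
- have [mD mZ _] := hm.
  set K := prod_functional m hs * expR (- variance_of gam m / 2).
  pose f (s : R) := K * (m k * cos (c + s * m k + (size hs).+1%:R * (pi / 2))).
  pose Fs (s : R) := K * cos (c + s * m k + (size hs)%:R * (pi / 2)).
  have ef (s : R) : derivs (k :: hs) (fun y => cos (m (y + s *: k) + c)) = f s.
    rewrite (_ : (fun y => _) = (fun y => cos (m y + (c + s * m k)))); last first.
      by apply/funext => y; rewrite mD mZ; congr cos; ring.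
    by rewrite cm_derivs_cos// /f /K /=; ring.
  have dc (z s : R) : is_derive s (1 : R) (fun s => cos (c + s * m k + z)) (- sin (c + s * m k + z) * m k).
    have d0 : is_derive s (1 : R) (fun s => c + s * m k + z) (m k).
      apply: (@is_derive_quadratic _ _ _ _ 0) => e.
      by rewrite mul0r normr_le0; apply/eqP; ring.
    exact: (@is_derive1_comp R cos _ s _ _ (is_derive_cos _) d0).
  have dF (s : R) : is_derive s (1 : R) Fs (f s).
    apply: is_derive_eq (is_deriveZ K (dc _ s)) _.
    rewrite /f /GRing.scale/= -[(size hs).+1%:R]natr1 [(_ + 1) * (pi / 2)]mulrDl mul1r addrA cosDpihalf.
    by ring.
  have cf : continuous f.
    by move=> s; apply: cvgMl_tmp; apply: cvgMl_tmp; exact: (is_derive_continuous (dc _ s)).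
  split; first by rewrite (funext ef); exact: continuous_measurable_fun.
  rewrite /Rintegral.
  under eq_integral do rewrite ef.
  rewrite (integral_derivative_segment _ dF cf)//= /Fs mul0r addr0 mul1r.
  rewrite (_ : (fun y => _) = (fun y => cos (m y + (c + m k)))); last first.
    by apply/funext => y; rewrite mD; congr cos; ring.
  by rewrite !cm_derivs_cos// /K; ring.
- have e (s : R) : derivs (k :: hs) (fun y => c * F (y + s *: k) + G (y + s *: k)) =
     c * derivs (k :: hs) (fun y => F (y + s *: k)) + derivs (k :: hs) (fun y => G (y + s *: k)).
    by rewrite cm_derivs_linear//; exact: cyl_shift.
  have ii F' : cyl F' -> measurable_fun setT (fun s : R => derivs (k :: hs) (fun y => F' (y + s *: k))) ->
    mu.-integrable `[0, 1] (EFin \o (fun s : R => derivs (k :: hs) (fun y => F' (y + s *: k)))).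
    move=> cF' mF'; have [M bF] := cyl_bounded cF'.
    apply: (@integrable_bounded_itv _ _ _ (derivs_bound gam (k :: hs) * M)); first exact: measurable_funTS.
    by move=> s _; apply: cm_derivs_le => //; exact: cyl_shift.
  have iF := ii F cF mF; have iG := ii G cG mG.
  split; first by rewrite (funext e); apply: measurable_funD => //; exact: measurable_funM.
  under eq_Rintegral do rewrite e.
  rewrite RintegralD//; last exact: (integrableZl _ _ iF).
  rewrite RintegralZl// -IF -IG !cm_derivs_linear//; try exact: cyl_shift.
  move: (derivs hs _) (derivs hs _) (derivs hs _) (derivs hs _) => u v w z.
  by ring.
- pose phi n (s : R) := derivs (k :: hs) (fun y => G_ n (y + s *: k)).
  have mphi n : measurable_fun setT (phi n) by have [] := IG n.
  have cphi (s : R) : phi n s @[n --> \oo] --> derivs (k :: hs) (fun y => G (y + s *: k)).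
    apply: (cm_derivs_bounded_limit gauss (M := M)) => //.
    by move=> n; exact: cyl_shift.
  have bphi n (s : R) : `|phi n s| <= derivs_bound gam (k :: hs) * M.
    by apply: cm_derivs_le => //; exact: cyl_shift.
  have mlim : measurable_fun setT (fun s : R => derivs (k :: hs) (fun y => G (y + s *: k))).
    exact: (measurable_fun_cvg mphi (fun s _ => cphi s)).
  split => //.
  have [|||_ c1] := @Rintegral_dominated_convergence _ (measurableTypeR R) R mu `[0, 1]%classic phi
    (fun s : R => derivs (k :: hs) (fun y => G (y + s *: k))) (fun=> derivs_bound gam (k :: hs) * M)
    (measurable_itv _) (fun n => measurable_funTS (mphi n)) (measurable_funTS mlim).
  + by apply: aeW => s _; exact: cphi.
  + apply: (@integrable_bounded_itv _ _ _ `|derivs_bound gam (k :: hs) * M|) => //; exact: measurable_cst.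
  + by move=> n s _; exact: bphi.
  apply: (cvg_unique _ _ c1) => //.
  have c2 : derivs hs (fun y => G_ n (y + k)) - derivs hs (G_ n) @[n --> \oo] -->
     derivs hs (fun y => G (y + k)) - derivs hs G.
    apply: cvgB; apply: (cm_derivs_bounded_limit gauss (M := M)) => //.
    by move=> n; exact: cyl_shift.
  apply: cvg_trans c2; apply: near_eq_cvg; apply: nearW => n.
  by have [_ ->] := IG n.
Qed.

(** The centre [c] makes one statement serve two purposes: [c = 0] bounds increments, and taking for
    [c] the next derivative at the base point bounds Taylor remainders. *)
Lemma cm_derivs_mean_value hs k G (c B : R) : all_CM gam hs -> CMH k -> cyl G ->
  (forall s, 0 <= s <= 1 -> `|derivs (k :: hs) (fun y => G (y + s *: k)) - c| <= B) ->
  `|derivs hs (fun y => G (y + k)) - derivs hs G - c| <= B.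
Proof.
move=> Hhs Hk cG H; have [mp ->] := mean_value_identity Hhs Hk cG.
have Hk' : all_CM gam (k :: hs) by [].
have [M bG] := cyl_bounded cG.
apply: (@unit_integral_near _ _ _ (derivs_bound gam (k :: hs) * M)) => //.
by move=> s; apply: cm_derivs_le => //; exact: cyl_shift.
Qed.

Definition holder_along (a L : R) G := forall x k, CMH k -> `|G (x + k) - G x| <= L * CMn k `^ a.

Lemma cm_derivsB hs F G : all_CM gam hs -> cyl F -> cyl G ->
  derivs hs F - derivs hs G = derivs hs (fun y => F y - G y).
Proof.
move=> Hhs cF cG; have := cm_derivs_linear gauss (-1) Hhs cG cF.
rewrite mulN1r addrC => <-; congr cm_derivs; apply/funext => y.
by rewrite mulN1r addrC.
Qed.

Lemma cm_derivs_head0 hs G : all_CM gam hs -> cyl G -> derivs (0 :: hs) G = 0.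
Proof.
move=> Hhs cG; have [H0 e0] := CM0 gauss.
have := cm_derivs_le gauss (hs := 0 :: hs) (conj H0 Hhs) cG.
have [M bG] := cyl_bounded cG.
by move=> /(_ M bG); rewrite /= e0 mulr0 !mul0r normr_le0 => /eqP.
Qed.

Lemma cm_derivs_headZ (c : R) k hs G : CMH k -> all_CM gam hs -> cyl G ->
  derivs (c *: k :: hs) G = c * derivs (k :: hs) G.
Proof.
move=> Hk Hhs cG; rewrite -[c *: k]addr0.
rewrite (cm_derivs_head_linear gauss c Hk (proj1 (CM0 gauss)) Hhs cG).
by rewrite (cm_derivs_head0 Hhs cG) addr0.
Qed.

(** For a unit vector [u] the derivative is the increment over [u] minus the error of that linear
    approximation. The increment is bounded by [L]; the error is an average of derivatives of the
    differences G(. + s u) - G, which are again bounded by [L]. The last derivative thus costs only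
    the seminorm. *)
Lemma cm_derivs_holder hs k G (a L : R) : 0 < a -> 0 <= L -> all_CM gam hs -> CMH k -> cyl G ->
  holder_along a L G ->
  `|derivs (k :: hs) G| <= CMn k * (derivs_bound gam hs * (1 + 5 / 3 * (5 / 4) ^+ size hs)) * L.
Proof.
move=> a0 L0 Hhs Hk cG hG.
have K0 := derivs_bound_ge0 gauss Hhs.
have [k0|kn0] := eqVneq k 0.
  by rewrite k0 cm_derivs_head0// normr0 (CM0 gauss).2 !mul0r.
have Np := cm_norm_gt0 gauss Hk kn0.
pose u := (CMn k)^-1 *: k.
have [Hu Nu] := CMZ gauss (CMn k)^-1 Hk.
have {}Nu : CMn u = 1 by rewrite Nu gtr0_norm ?invr_gt0// mulVf// gt_eqF.
have ku : k = CMn k *: u by rewrite scalerA divff ?gt_eqF// scale1r.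
rewrite {1}ku cm_derivs_headZ// normrM (gtr0_norm Np) -(mulrA (CMn k)) ler_wpM2l ?(ltW Np)//.
have Hu' : all_CM gam (u :: hs) by [].
have bu : derivs_bound gam (u :: hs) = 5 / 3 * (5 / 4) ^+ size hs * derivs_bound gam hs.
  by rewrite /= Nu mulr1.
have inc (s : R) y : 0 <= s <= 1 -> `|G (y + s *: u) - G y| <= L.
  move=> /andP[s0 s1]; have [Hsu Nsu] := CMZ gauss s Hu.
  apply: le_trans (hG _ _ Hsu) _; rewrite Nsu Nu mulr1 ger0_norm// ler_piMr//.
  have -> : (1 : R) = 1 `^ a by rewrite powR1.
  by apply: ge0_ler_powR => //; exact: ltW.
have H1 : `|derivs hs (fun y => G (y + u)) - derivs hs G - derivs (u :: hs) G| <=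
    derivs_bound gam (u :: hs) * L.
  apply: cm_derivs_mean_value => // s s01.
  rewrite cm_derivsB//; last exact: cyl_shift.
  apply: cm_derivs_le => //; first by apply: cylB => //; exact: cyl_shift.
  by move=> y; exact: inc.
have H2 : `|derivs hs (fun y => G (y + u)) - derivs hs G| <= derivs_bound gam hs * L.
  rewrite cm_derivsB//; last exact: cyl_shift.
  apply: cm_derivs_le => //; first by apply: cylB => //; exact: cyl_shift.
  by move=> y; have := @inc 1 y; rewrite scale1r ler01 lexx; exact.
rewrite bu in H1.
move: (derivs hs _) (derivs hs _) (derivs (u :: hs) _) H1 H2 => p r w H1 H2.
have e : w = (r - p) - (r - p - w) by ring.
rewrite e; apply: le_trans (ler_normB _ _) _.
move: (derivs_bound gam hs) (_ ^+ _) H1 H2 => K z H1 H2.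
rewrite (_ : K * (1 + 5 / 3 * z) * L = K * L + 5 / 3 * z * K * L); last by ring.
exact: lerD.
Qed.

End MeanValue.

(** * Smoothing by the Ornstein-Uhlenbeck semigroup *)

Section OrnsteinUhlenbeckDerivatives.
Context {R : realType} {X : normedModType R} (gam : probability (borel_X X) R).
Hypothesis gauss : centered_gaussian gam.
Implicit Types (h k j x y : X) (g : X -> R) (hs : seq X).
Local Notation CMn := (cm_norm gam).
Local Notation CMH := (CM gam).
Local Notation derivs := (cm_derivs gam).

Definition ou_std (t : R) : R := Num.sqrt (1 - expR (- (2 * t))).
Definition ou_ratio (t : R) : R := expR (- t) / ou_std t.
Definition ou_frame (t : R) g x : X -> R := fun y => g (expR (- t) *: x + ou_std t *: y).

(* The derivative of [OU gam t g] at [x] in the directions [hs]: a shift of [x] by [h] is a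
   shift of the Gaussian variable by [ou_ratio t *: h]. *)
Definition ou_derivs (t : R) g x hs : R := ou_ratio t ^+ size hs * derivs hs (ou_frame t g x).

Lemma ou_derivs0 t g x : ou_derivs t g x [::] = OU gam t g x.
Proof. by rewrite /ou_derivs expr0 mul1r. Qed.

Lemma cyl_ou_frame t g x : cyl g -> cyl (ou_frame t g x).
Proof. exact: cyl_affine. Qed.

Lemma ou_std_sqr_le (t : R) : 0 < t -> 0 < ou_std t /\ ou_std t ^+ 2 = 1 - expR (- (2 * t)) /\
  ou_std t ^+ 2 <= 2 * t.
Proof.
move=> t0; have e1 : expR (- (2 * t)) < 1 by rewrite -expR0 ltr_expR oppr_lt0 mulr_gt0.
have s0 : 0 < ou_std t by rewrite sqrtr_gt0 subr_gt0.
have e2 : ou_std t ^+ 2 = 1 - expR (- (2 * t)) by rewrite sqr_sqrtr// subr_ge0 ltW.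
by split => //; split => //; rewrite e2; have := expR_ge1Dx (- (2 * t)); lra.
Qed.

Lemma ou_ratio_gt0 (t : R) : 0 < t -> 0 < ou_ratio t.
Proof. by move=> /ou_std_sqr_le[s0 _]; rewrite divr_gt0// expR_gt0. Qed.

(** The square of the ratio is 1 / (e^(2t) - 1), and e^(2t) >= 1 + 2t. *)
Lemma ou_ratio_sqr_le (t : R) : 0 < t -> ou_ratio t ^+ 2 <= (2 * t)^-1.
Proof.
move=> t0; have [s0 [s2 _]] := ou_std_sqr_le t0.
have t20 : 0 < 2 * t by rewrite mulr_gt0.
rewrite /ou_ratio exprMn exprVn s2 expr2 -expRD.
have -> : - t + - t = - (2 * t) by ring.
have d0 : 0 < 1 - expR (- (2 * t)) by rewrite -s2 exprn_gt0.
rewrite ler_pdivrMr// ler_pdivlMl//.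
have := expR_ge1Dx (2 * t); have := expR_gt0 (- (2 * t)).
have : expR (2 * t) * expR (- (2 * t)) = 1 by rewrite expRN divff// gt_eqF// expR_gt0.
move: (expR (2 * t)) (expR (- (2 * t))) => u v uv v0 ut.
have : v * (1 + 2 * t) <= v * u by rewrite ler_wpM2l// ltW.
by rewrite (mulrC v u) uv; lra.
Qed.

Definition ou_weight (a : R) (n : nat) (t : R) : R := (2 * t) `^ ((a - n%:R) / 2).

(** Each derivative contributes a ratio of at most (2t)^(-1/2), and the Hoelder increment a standard
    deviation of at most (2t)^(1/2) to the power [a]. *)
Lemma ou_weight_ge (a : R) (n : nat) (t : R) : 0 < a -> 0 < t ->
  ou_ratio t ^+ n * ou_std t `^ a <= ou_weight a n t.
Proof.
move=> a0 t0; have [s0 [_ s2]] := ou_std_sqr_le t0; have r0 := ou_ratio_gt0 t0.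
have r2 := ou_ratio_sqr_le t0; have t20 : 0 < 2 * t by rewrite mulr_gt0.
rewrite /ou_weight (_ : (a - n%:R) / 2 = - (n%:R / 2) + a / 2); last by field.
rewrite powRD; last by rewrite (gt_eqF t20) implybT.
apply: ler_pM; rewrite ?exprn_ge0 ?powR_ge0 ?(ltW r0)//.
- rewrite -powR_mulrn ?(ltW r0)// (_ : n%:R = 2%:R * (n%:R / 2) :> R); last by field.
  rewrite powRrM powR_mulrn ?(ltW r0)//.
  have -> : (2 * t) `^ (- (2 * (n%:R / 2) / 2)) = ((2 * t)^-1) `^ (n%:R / 2).
    rewrite -[(2 * t)^-1]powR_inv1 ?(ltW t20)// -powRrM; congr powR; by field.
  apply: ge0_ler_powR => //; rewrite ?nnegrE ?exprn_ge0 ?(ltW r0) ?invr_ge0 ?(ltW t20)//.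
- rewrite (_ : a = 2%:R * (a / 2)); last by field.
  rewrite powRrM powR_mulrn ?(ltW s0)//.
  have -> : 2 * (a / 2) / 2 = a / 2 by field.
  apply: ge0_ler_powR => //; rewrite ?nnegrE ?exprn_ge0 ?(ltW t20) ?(ltW s0)//.
  by rewrite divr_ge0// ltW.
Qed.

Lemma ou_frame_holder t g x (a L : R) : 0 < t -> holder_along gam a L g ->
  holder_along gam a (L * ou_std t `^ a) (ou_frame t g x).
Proof.
move=> t0 hg y k Hk; have [s0 _] := ou_std_sqr_le t0; have [Hsk Nsk] := CMZ gauss (ou_std t) Hk.
rewrite /ou_frame scalerDr addrA; apply: le_trans (hg _ _ Hsk) _.
rewrite Nsk gtr0_norm// powRM ?(ltW s0) ?cm_norm_ge0//.
by rewrite mulrA.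
Qed.

Lemma ou_derivs_holder t g x k hs (a L : R) : 0 < t -> 0 < a -> 0 <= L -> cyl g ->
  all_CM gam (k :: hs) -> holder_along gam a L g ->
  `|ou_derivs t g x (k :: hs)| <=
    CMn k * (derivs_bound gam hs * (1 + 5 / 3 * (5 / 4) ^+ size hs)) * L * ou_weight a (size hs).+1 t.
Proof.
move=> t0 a0 L0 cg [Hk Hhs] hg.
have r0 := ou_ratio_gt0 t0.
rewrite /ou_derivs normrM (ger0_norm (exprn_ge0 _ (ltW r0))).
have L1 : 0 <= L * ou_std t `^ a by rewrite mulr_ge0// powR_ge0.
have := cm_derivs_holder gauss a0 L1 Hhs Hk (cyl_ou_frame t x cg) (ou_frame_holder x t0 hg).
have c0 : 0 <= CMn k * (derivs_bound gam hs * (1 + 5 / 3 * (5 / 4) ^+ size hs)).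
  rewrite mulr_ge0 ?cm_norm_ge0// mulr_ge0 ?derivs_bound_ge0// addr_ge0// mulr_ge0 ?exprn_ge0//.
move: (CMn k * _) c0 => K K0 H.
have := ler_wpM2l (exprn_ge0 (size hs).+1 (ltW r0)) H.
move=> /le_trans; apply.
rewrite (_ : _ * (K * _) = K * L * (ou_ratio t ^+ (size hs).+1 * ou_std t `^ a)); last by ring.
by rewrite ler_wpM2l ?mulr_ge0// ou_weight_ge.
Qed.

Lemma ou_derivs_mean_value t g x k hs (c B : R) : 0 < t -> cyl g -> CMH k -> all_CM gam hs ->
  (forall s, 0 <= s <= 1 -> `|ou_derivs t g (x + s *: k) (k :: hs) - c| <= B) ->
  `|ou_derivs t g (x + k) hs - ou_derivs t g x hs - c| <= B.
Proof.
move=> t0 cg Hk Hhs H.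
have r0 := ou_ratio_gt0 t0; have [s0 _] := ou_std_sqr_le t0.
have shift (s : R) : ou_frame t g (x + s *: k) = (fun y => ou_frame t g x (y + s *: (ou_ratio t *: k))).
  apply/funext => y; rewrite /ou_frame; congr g.
  rewrite !scalerDr !scalerA -addrA [_ *: k + _]addrC.
  by congr (_ + (_ + _ *: k)); rewrite /ou_ratio; field; rewrite gt_eqF.
have [Hrk _] := CMZ gauss (ou_ratio t) Hk.
have rn0 : 0 < ou_ratio t ^+ size hs by rewrite exprn_gt0.
have := @cm_derivs_mean_value _ _ _ gauss hs (ou_ratio t *: k) (ou_frame t g x)
  (c / ou_ratio t ^+ size hs) (B / ou_ratio t ^+ size hs) Hhs Hrk (cyl_ou_frame t x cg).
have e1 := shift 1; rewrite scale1r in e1.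
have -> : (fun y => ou_frame t g x (y + ou_ratio t *: k)) = ou_frame t g (x + k).
  by rewrite e1; apply/funext => y; rewrite scale1r.
have scal u : `|u - c / ou_ratio t ^+ size hs| <= B / ou_ratio t ^+ size hs <->
   `|ou_ratio t ^+ size hs * u - c| <= B.
  rewrite ler_pdivlMr// -{2}(gtr0_norm rn0) -normrM mulrBl divfK ?gt_eqF//.
  by rewrite (mulrC u).
move=> H1; rewrite /ou_derivs -mulrBr; apply/scal; apply: H1 => s s01.
apply/scal; rewrite -shift.
rewrite (cm_derivs_headZ gauss _ Hk Hhs (cyl_ou_frame t _ cg)) mulrA -exprSr.
exact: H.
Qed.

End OrnsteinUhlenbeckDerivatives.

(** * Integrals of the weights in time *)

Section WeightIntegrals.
Context {R : realType}.
Notation mu := (@lebesgue_measure R).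

Implicit Types (a b r t u v s : R).

(** With the exponent [b - 1] the primitive is a multiple of the power [b], and the integral up to
    [t] converges for [0 < b]. Derivatives of order 1, 2 and 3 give [b] equal to (a + 1) / 2, a / 2
    and (a - 1) / 2; the last is negative. *)
Definition power_weight (b t s : R) : R := (2 * (t - s)) `^ (b - 1).

Lemma measurable_power_weight b t (D : set R) : measurable_fun D (power_weight b t).
Proof.
apply: measurable_funTS; apply: (measurableT_comp (measurable_powR (b - 1))).
by apply: measurable_funM => //; exact: measurable_funB.
Qed.

Lemma power_weight_ge0 b t s : 0 <= power_weight b t s. Proof. exact: powR_ge0. Qed.

Let is_derive_power (b t s : R) : b != 0 -> s < t ->
  is_derive s (1 : R) (fun s => - (2 * (t - s)) `^ b / (2 * b)) (power_weight b t s).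
Proof.
move=> b0 st; have p0 : 0 < 2 * (t - s) by rewrite mulr_gt0// subr_gt0.
have d0 : is_derive s (1 : R) (fun s => 2 * (t - s)) (- 2).
  apply: (@is_derive_quadratic _ _ _ _ 0) => e.
  by rewrite mul0r normr_le0; apply/eqP; ring.
have d1 := @is_derive1_comp R (fun z => z `^ b) _ s _ _ (is_derive1_powR b p0) d0.
have d2 := is_deriveZ (- (2 * b)^-1) d1.
have -> : (fun s => - (2 * (t - s)) `^ b / (2 * b)) =
   (- (2 * b)^-1 \*: ((fun z => z `^ b) \o (fun s => 2 * (t - s)))).
  by apply/funext => z; rewrite /GRing.scale/= /GRing.scale/=; ring.
apply: is_derive_eq d2 _.
rewrite /GRing.scale/= /power_weight; move: (_ `^ _) => u; field.
exact: b0.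
Qed.

Let continuous_power_weight (b t s : R) : s < t -> {for s, continuous (power_weight b t)}.
Proof.
move=> st; have p0 : 0 < 2 * (t - s) by rewrite mulr_gt0// subr_gt0.
have d0 : is_derive s (1 : R) (fun s => 2 * (t - s)) (- 2).
  apply: (@is_derive_quadratic _ _ _ _ 0) => e.
  by rewrite mul0r normr_le0; apply/eqP; ring.
have d1 := @is_derive1_comp R (fun z => z `^ (b - 1)) _ s _ _ (is_derive1_powR (b - 1) p0) d0.
exact: (is_derive_continuous d1).
Qed.

Lemma integral_power_weight_segment b t u v : b != 0 -> u <= v -> v < t ->
  (\int[mu]_(s in `[u, v]) (power_weight b t s)%:E =
   (((2 * (t - u)) `^ b - (2 * (t - v)) `^ b) / (2 * b))%:E)%E.
Proof.
move=> b0 uv vt.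
have dF x : x < t -> is_derive x (1 : R) (fun s => - (2 * (t - s)) `^ b / (2 * b)) (power_weight b t x).
  by move=> xt; exact: is_derive_power.
have cf x : x < t -> {for x, continuous (power_weight b t)}.
  by move=> xt; exact: continuous_power_weight.
rewrite (integral_derivative_segment_lt uv vt dF cf).
by congr (_%:E); move: (_ `^ _) (_ `^ _) => p r; field.
Qed.

Lemma integral_power_weight_le b t u : 0 < b -> u <= t ->
  (\int[mu]_(s in `[u, t[) (power_weight b t s)%:E <= ((2 * (t - u)) `^ b / (2 * b))%:E)%E.
Proof.
move=> b0; rewrite le_eqVlt => /predU1P[->|ut].
  by rewrite set_itvco0 ?integral_set0// lee_fin divr_ge0 ?powR_ge0 ?mulr_ge0 ?(ltW b0).
(* The primitive is usable on [[u, v n]] only; [v n] increases to [t], and monotone convergence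
   reaches the open end. *)
pose v n : R := t - (t - u) / n.+2%:R.
have d0 : 0 < t - u by rewrite subr_gt0.
have vt n : v n < t by rewrite /v ltrBlDr ltrDl divr_gt0.
have uv n : u <= v n.
  rewrite /v lerBrDr -lerBrDl ler_pdivrMr// ler_peMr ?(ltW d0)//.
  by rewrite ler1n.
have -> : `[u, t[%classic = \bigcup_n `[u, v n]%classic.
  apply/seteqP; split => x /=; rewrite ?in_itv/=.
  - move=> /andP[ux xt]; exists (Num.truncn ((t - u) / (t - x))) => //=; rewrite in_itv/= ux/= /v.
    have xp : 0 < t - x by rewrite subr_gt0.
    rewrite lerBrDr -lerBrDl ler_pdivrMr// mulrC -ler_pdivrMr//.
    apply: le_trans (ltW (Num.Theory.truncnS_gt _)) _; rewrite ler_nat//.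
  - move=> [n _ /=]; rewrite in_itv/= => /andP[-> xv] /=; exact: le_lt_trans (vt n).
have nd : nondecreasing_seq (fun n => `[u, v n]%classic).
  move=> m n mn; apply/subsetPset => x /=; rewrite !in_itv/= => /andP[-> xv] /=.
  apply: le_trans xv _; rewrite /v lerD2l lerN2 ler_wpM2l ?(ltW d0)//.
  by rewrite lef_pV2 ?posrE// ler_nat.
have c := @ge0_nondecreasing_set_cvg_integral _ (measurableTypeR R) R (fun n => `[u, v n]%classic)
  (EFin \o power_weight b t) mu nd.
apply: (cvge_le _ (c _ _ _)).
- apply: nearW => n; rewrite integral_power_weight_segment ?(gt_eqF b0)// lee_fin.
  rewrite ler_wpM2r ?invr_ge0 ?mulr_ge0 ?(ltW b0)//.
  by rewrite gerBl powR_ge0.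
- by move=> i; exact: measurable_itv.
- by move=> i; apply/measurable_EFinP; exact: measurable_power_weight.
- by move=> i x _; rewrite lee_fin power_weight_ge0.
Qed.

(* The interpolated weight: near [s = t] the first argument of the minimum is integrable,
   away from it the second one is; splitting at [2 (t - s) = r ^ 2] gives the power [r ^ a]. *)
Lemma integral_min_weight_le (a t r : R) : 0 < a < 1 -> 0 < r -> 0 <= t ->
  (\int[mu]_(s in `[0%R, t[) (Num.min (2 * power_weight (a / 2) t s)
      (power_weight ((a - 1) / 2) t s * r))%:E <= ((2 / a + (1 - a)^-1) * r `^ a)%:E)%E.
Proof.
move=> /andP[a0 a1] r0 t0.
pose phi s : R := Num.min (2 * power_weight (a / 2) t s) (power_weight ((a - 1) / 2) t s * r).
have mphi (D : set R) : measurable_fun D (EFin \o phi).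
  apply/measurable_EFinP; apply: measurable_minr.
  - by apply: measurable_funM => //; exact: measurable_power_weight.
  - by apply: measurable_funM => //; exact: measurable_power_weight.
have phi0 s : 0 <= phi s by rewrite /phi le_min !mulr_ge0 ?power_weight_ge0 ?(ltW r0).
have a20 : 0 < a / 2 by rewrite divr_gt0.
have near u : 0 <= u <= t ->
   (\int[mu]_(s in `[u, t[) (phi s)%:E <= (2 / a * (2 * (t - u)) `^ (a / 2))%:E)%E.
  move=> /andP[u0 ut].
  apply: (@le_trans _ _ (\int[mu]_(s in `[u, t[) (2 * power_weight (a / 2) t s)%:E)%E).
    apply: ge0_le_integral => //.
    + by move=> x _; rewrite lee_fin; exact: phi0.
    + exact: mphi.
    + by apply/measurable_EFinP; apply: measurable_funM => //; exact: measurable_power_weight.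
    + by move=> x _; rewrite lee_fin /phi ge_min lexx.
  under eq_integral do rewrite EFinM.
  rewrite ge0_integralZl//; last 2 first.
  - by apply/measurable_EFinP; exact: measurable_power_weight.
  - by move=> x _; rewrite lee_fin power_weight_ge0.
  apply: le_trans (lee_wpmul2l _ (integral_power_weight_le a20 ut)) _; first by rewrite lee_fin.
  rewrite -EFinM lee_fin le_eqVlt; apply/orP; left; apply/eqP.
  by field; rewrite gt_eqF.
have r2 : (r ^+ 2) `^ (a / 2) = r `^ a.
  by rewrite -powR_mulrn ?(ltW r0)// -powRrM; congr powR; field.
have a1' : 0 < 1 - a by rewrite subr_gt0.
(* In the first case the splitting point would not be positive, and the whole interval counts as
   near [t]. *)
have [tr|rt] := leP (2 * t) (r ^+ 2).
  apply: le_trans (near 0 _) _; first by rewrite lexx.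
  rewrite lee_fin subr0; apply: (@le_trans _ _ (2 / a * r `^ a)).
    rewrite ler_wpM2l ?divr_ge0 ?(ltW a0)// -r2.
    have p1 : 0 <= 2 * t by rewrite mulr_ge0// ltW.
    by apply: ge0_ler_powR; rewrite ?nnegrE ?(ltW a20) ?sqr_ge0.
  by rewrite ler_wpM2r ?powR_ge0// lerDl invr_ge0 ltW.
pose u := t - r ^+ 2 / 2.
have u0 : 0 < u by rewrite /u; lra.
have ut : u < t by rewrite /u ltrBlDr ltrDl divr_gt0 ?exprn_gt0.
have tu : 2 * (t - u) = r ^+ 2 by rewrite /u; field.
have -> : `[0, t[%classic = `[0, u]%classic `|` `]u, t[%classic.
  apply/seteqP; split => x /=; rewrite !in_itv/=.
    by move=> /andP[-> ->]; have [xu|ux] := leP x u; [left|right].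
  by move=> [/andP[-> xu]|/andP[ux ->]]; rewrite ?andbT /= ?(le_lt_trans xu)// ltW// (lt_trans u0).
rewrite ge0_integral_setU//; first last.
- by apply/disj_setPS => x [/=]; rewrite !in_itv/= => /andP[_ xu] /andP[]; rewrite ltNge xu.
- by move=> x _; rewrite lee_fin; exact: phi0.
- exact: mphi.
rewrite addeC [(_ + _) * (r `^ a)]mulrDl EFinD; apply: leeD.
- apply: (@le_trans _ _ (\int[mu]_(s in `[u, t[) (phi s)%:E)%E); last first.
    by have := near u; rewrite (ltW u0) (ltW ut) tu r2; exact.
  apply: ge0_subset_integral => //.
  + exact: mphi.
  + by move=> x _; rewrite lee_fin; exact: phi0.
  + by move=> x /=; rewrite !in_itv/= => /andP[h1 ->]; rewrite ltW.
- apply: (@le_trans _ _ (\int[mu]_(s in `[0%R, u]) (r * power_weight ((a - 1) / 2) t s)%:E)%E).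
    apply: ge0_le_integral => //.
    + by move=> x _; rewrite lee_fin; exact: phi0.
    + exact: mphi.
    + by apply/measurable_EFinP; apply: measurable_funM => //; exact: measurable_power_weight.
    + by move=> x _; rewrite lee_fin (mulrC r) ge_min lexx orbT.
  under eq_integral do rewrite EFinM.
  rewrite ge0_integralZl//; last 3 first.
  - by apply/measurable_EFinP; exact: measurable_power_weight.
  - by move=> x _; rewrite lee_fin power_weight_ge0.
  - by rewrite lee_fin ltW.
  have b0 : (a - 1) / 2 != 0 by rewrite mulf_neq0// subr_eq0 lt_eqF.
  rewrite integral_power_weight_segment ?(ltW u0)// -EFinM lee_fin subr0 tu.
  have -> : (r ^+ 2) `^ ((a - 1) / 2) = r `^ a / r.
    rewrite -powR_mulrn ?(ltW r0)// -powRrM (_ : 2%:R * ((a - 1) / 2) = a - 1); last by field.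
    by rewrite powRB ?(gt_eqF r0) ?implybT// powRr1 ?(ltW r0).
  have := powR_ge0 (2 * t) ((a - 1) / 2).
  move: ((2 * t) `^ _) (r `^ a) => p z p0.
  rewrite (_ : r * _ = z / (1 - a) - r * p / (1 - a)); last first.
    by field; rewrite (gt_eqF r0) gt_eqF//=  lt_eqF// subr_lt0.
  rewrite mulrC gerBl divr_ge0 ?mulr_ge0 ?(ltW r0) ?(ltW a1')//.
Qed.

End WeightIntegrals.

(** * Derivatives of the semigroup up to order three *)

Section OrnsteinUhlenbeckBounds.
Context {R : realType} {X : normedModType R} (gam : probability (borel_X X) R).
Hypothesis gauss : centered_gaussian gam.
Implicit Types (h k j x y : X) (g : X -> R) (hs : seq X).
Local Notation CMn := (cm_norm gam).
Local Notation CMH := (CM gam).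
Local Notation D := (ou_derivs gam).

Variables (a L : R) (g : X -> R) (t : R).
Hypotheses (a0 : 0 < a) (L0 : 0 <= L) (cg : cyl g) (hg : holder_along gam a L g) (t0 : 0 < t).

Let w n := ou_weight a n t.
Let w0 n : 0 <= w n. Proof. exact: powR_ge0. Qed.

(** The constant 13 serves all three orders: the exact ones are 8/3, 185/36 and 21625/1728, the last
    slightly above 12.5. *)
Lemma ou_deriv1_le x h : CMH h -> `|D t g x [:: h]| <= 13 * L * w 1 * CMn h.
Proof.
move=> Hh; have := ou_derivs_holder gauss (hs := [::]) x t0 a0 L0 cg (conj Hh I) hg.
move=> /le_trans; apply; rewrite /= expr0 -/(w 1) !mulr1 mul1r.
have := mulr_ge0 (mulr_ge0 L0 (w0 1)) (cm_norm_ge0 gauss Hh).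
rewrite (_ : CMn h * _ * L * w 1 = (1 + 5 / 3) * (L * w 1 * CMn h)); last by ring.
rewrite (_ : 13 * L * w 1 * CMn h = 13 * (L * w 1 * CMn h)); last by ring.
by lra.
Qed.

Lemma ou_deriv2_le x h k : CMH h -> CMH k ->
  `|D t g x [:: h; k]| <= 13 * L * w 2 * (CMn h * CMn k).
Proof.
move=> Hh Hk; have := ou_derivs_holder gauss (hs := [:: k]) x t0 a0 L0 cg (conj Hh (conj Hk I)) hg.
move=> /le_trans; apply; rewrite /= expr0 expr1 -/(w 2) !mulr1.
have := mulr_ge0 (mulr_ge0 L0 (w0 2)) (mulr_ge0 (cm_norm_ge0 gauss Hh) (cm_norm_ge0 gauss Hk)).
rewrite (_ : CMn h * _ * L * w 2 = (5 / 3 * (1 + 5 / 3 * (5 / 4))) * (L * w 2 * (CMn h * CMn k))); last by ring.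
rewrite (_ : 13 * L * w 2 * _ = 13 * (L * w 2 * (CMn h * CMn k))); last by ring.
by lra.
Qed.

Lemma ou_deriv3_le x j h k : CMH j -> CMH h -> CMH k ->
  `|D t g x [:: j; h; k]| <= 13 * L * w 3 * CMn j * (CMn h * CMn k).
Proof.
move=> Hj Hh Hk.
have := ou_derivs_holder gauss (hs := [:: h; k]) x t0 a0 L0 cg (conj Hj (conj Hh (conj Hk I))) hg.
move=> /le_trans; apply; rewrite /= expr0 expr1 expr2 -/(w 3) !mulr1.
have := mulr_ge0 (mulr_ge0 L0 (w0 3)) (mulr_ge0 (cm_norm_ge0 gauss Hj) (mulr_ge0 (cm_norm_ge0 gauss Hh) (cm_norm_ge0 gauss Hk))).
rewrite (_ : CMn j * _ * L * w 3 = (5 / 3 * (5 / 4) * (5 / 3) * (1 + 5 / 3 * (5 / 4 * (5 / 4)))) *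
   (L * w 3 * (CMn j * (CMn h * CMn k)))); last by ring.
rewrite (_ : 13 * L * w 3 * _ * _ = 13 * (L * w 3 * (CMn j * (CMn h * CMn k)))); last by ring.
by lra.
Qed.

Let scaled (s : R) h : 0 <= s <= 1 -> CMH h -> CMH (s *: h) /\ CMn (s *: h) <= CMn h.
Proof.
move=> /andP[s0 s1] Hh; have [H1 ->] := CMZ gauss s Hh; split => //.
by rewrite ger0_norm// ler_piMl// cm_norm_ge0.
Qed.

Definition ou_mod (r : R) : R := Num.min (2 * w 2) (w 3 * r).

Lemma ou_deriv2_increment x j h k : CMH j -> CMH h -> CMH k ->
  `|D t g (x + j) [:: h; k] - D t g x [:: h; k]| <= 13 * L * ou_mod (CMn j) * (CMn h * CMn k).
Proof.
move=> Hj Hh Hk.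
have n0 : 0 <= CMn h * CMn k by rewrite mulr_ge0 ?cm_norm_ge0.
rewrite /ou_mod; case: (leP (2 * w 2) (w 3 * CMn j)) => _.
- apply: le_trans (ler_normB _ _) _.
  apply: le_trans (lerD (ou_deriv2_le _ Hh Hk) (ou_deriv2_le _ Hh Hk)) _.
  rewrite le_eqVlt; apply/orP; left; apply/eqP; ring.
- have := @ou_derivs_mean_value _ _ _ gauss t g x j [:: h; k] 0 (13 * L * (w 3 * CMn j) * (CMn h * CMn k)) t0 cg Hj (conj Hh (conj Hk I)).
  rewrite subr0; apply => s s01; rewrite subr0.
  by apply: le_trans (ou_deriv3_le _ Hj Hh Hk) _; rewrite !mulrA.
Qed.

Lemma ou_mod_le (r r' : R) : r <= r' -> ou_mod r <= ou_mod r'.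
Proof.
move=> rr; rewrite /ou_mod le_min !ge_min lexx/=; apply/orP; right.
by rewrite ler_wpM2l.
Qed.

(** With the mean value formula centred at the second derivative at [x], the remainder is controlled
    by increments of that derivative and inherits their interpolated bound. *)
Lemma ou_deriv1_remainder x k h : CMH k -> CMH h ->
  `|D t g (x + k) [:: h] - D t g x [:: h] - D t g x [:: k; h]| <=
    13 * L * ou_mod (CMn k) * (CMn k * CMn h).
Proof.
move=> Hk Hh; apply: ou_derivs_mean_value => // s s01.
have [Hsk Nsk] := scaled s01 Hk.
apply: le_trans (ou_deriv2_increment _ Hsk Hk Hh) _.
rewrite ler_wpM2r ?mulr_ge0 ?cm_norm_ge0// ler_wpM2l ?mulr_ge0//.
exact: ou_mod_le.
Qed.

Lemma ou_deriv0_remainder x h : CMH h ->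
  `|D t g (x + h) [::] - D t g x [::] - D t g x [:: h]| <= 13 * L * w 2 * (CMn h * CMn h).
Proof.
move=> Hh; apply: ou_derivs_mean_value => // s s01.
have [Hsh Nsh] := scaled s01 Hh.
rewrite -[X in `|X|]subr0.
apply: ou_derivs_mean_value => // s' s01'; rewrite subr0.
apply: le_trans (ou_deriv2_le _ Hsh Hh) _.
rewrite ler_wpM2l ?mulr_ge0 ?w0// ler_wpM2r ?cm_norm_ge0//.
Qed.

Lemma ou_deriv_head_linear x (c : R) h k hs : CMH h -> CMH k -> all_CM gam hs ->
  D t g x (c *: h + k :: hs) = c * D t g x (h :: hs) + D t g x (k :: hs).
Proof.
move=> Hh Hk Hhs; rewrite /ou_derivs.
rewrite (cm_derivs_head_linear gauss c Hh Hk Hhs (cyl_ou_frame t x cg)).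
by rewrite mulrDr mulrCA.
Qed.

Lemma ou_deriv_second_linear x (c : R) h k k' hs : CMH h -> CMH k -> CMH k' -> all_CM gam hs ->
  D t g x [:: h, c *: k + k' & hs] = c * D t g x [:: h, k & hs] + D t g x [:: h, k' & hs].
Proof.
move=> Hh Hk Hk' Hhs; rewrite /ou_derivs.
rewrite (cm_derivs_second_linear gauss c Hh Hk Hk' Hhs (cyl_ou_frame t x cg)).
by rewrite mulrDr mulrCA.
Qed.

Lemma ou_derivs_distance x y hs : all_CM gam hs ->
  `|D t g x hs - D t g y hs| <= ou_ratio t ^+ size hs * (derivs_bound gam hs *
     Num.sqrt (expect gam (fun z => (ou_frame t g x z - ou_frame t g y z) ^+ 2))).
Proof.
move=> Hhs; have r0 := ou_ratio_gt0 t0.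
have cx := cyl_ou_frame t x cg; have cy := cyl_ou_frame t y cg.
rewrite /ou_derivs -mulrBr normrM (ger0_norm (exprn_ge0 _ (ltW r0))) ler_wpM2l ?exprn_ge0 ?(ltW r0)//.
rewrite (cm_derivsB gauss Hhs cx cy).
by apply: cm_derivs_L2 => //; exact: cylB.
Qed.

End OrnsteinUhlenbeckBounds.

(** * Limits tested on sequences, the form that dominated convergence provides *)

Section SequentialContinuity.
Context {R : realType} {P : pseudoMetricType R}.

Lemma within_cvg_seq (A : set P) (phi : P -> R) (x : P) :
  (forall u : nat -> P, (forall n, A (u n)) -> u n @[n --> \oo] --> x ->
     phi (u n) @[n --> \oo] --> phi x) ->
  phi @ within A (nbhs x) --> phi x.
Proof.
move=> H; apply/cvgrPdist_lt => e e0; apply: contrapT => N.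
have [n|u uP] := @choice nat P (fun n y => [/\ A y, ball x (n.+1%:R^-1) y & ~ `|phi x - phi y| < e]).
  apply: contrapT => N2; apply: N.
  apply/nbhs_ballP; exists (n.+1%:R^-1) => /=; first by rewrite invr_gt0.
  move=> y xy Ay; apply: contrapT => N3; apply: N2; exists y; split => //.
have cu : u n @[n --> \oo] --> x.
  apply/cvg_ballP => d d0; near=> n.
  have [_ h _] := uP n; apply: le_ball h.
  near: n; exact: (cvgr_le _ cvg_harmonic).
have := H u (fun n => let: And3 h _ _ := uP n in h) cu.
move=> /cvgrPdist_lt /(_ e e0) [N0 _ /(_ N0 (leqnn _)) /=].
by have [_ _] := uP N0.
Unshelve. all: by end_near.
Qed.

Lemma within_seq_cvg (A : set P) (phi : P -> R) (x : P) (u : nat -> P) :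
  phi @ within A (nbhs x) --> phi x -> (forall n, A (u n)) -> u n @[n --> \oo] --> x ->
  phi (u n) @[n --> \oo] --> phi x.
Proof.
move=> H uA ux B HB; have HB' : nbhs x (fun y => A y -> B (phi y)) by exact: H.
by have [N N1 N2] := ux _ HB'; exists N => // n Nn; apply: N2 => //; exact: uA.
Qed.

Lemma cvg_seq_continuous (phi : P -> R) (x : P) :
  (forall u : nat -> P, u n @[n --> \oo] --> x -> phi (u n) @[n --> \oo] --> phi x) ->
  {for x, continuous phi}.
Proof.
move=> H; have := @within_cvg_seq setT phi x (fun u _ => H u).
move=> /cvgrPdist_lt c; apply/cvgrPdist_lt => e e0.
by apply: (@filterS _ (nbhs x) _ _ _ _ (c e e0)) => y /(_ Logic.I).
Qed.

End SequentialContinuity.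

(** * Continuity of the semigroup jointly in time and space *)

Section OrnsteinUhlenbeckContinuity.
Context {R : realType} {X : normedModType R} (gam : probability (borel_X X) R).
Hypothesis gauss : centered_gaussian gam.
Implicit Types (h k j x y : X) (hs : seq X).
Local Notation D := (ou_derivs gam).

Variables (T M : R) (g : R -> X -> R).
Hypotheses (cg : forall s, 0 <= s <= T -> cyl (g s))
  (bg : forall s x, 0 <= s <= T -> `|g s x| <= M)
  (jg : forall (u : nat -> R) (z : nat -> X) s x, (forall n, 0 <= u n <= T) -> 0 <= s <= T ->
     u n @[n --> \oo] --> s -> z n @[n --> \oo] --> x -> g (u n) (z n) @[n --> \oo] --> g s x).

Lemma continuous_ou_std : continuous (@ou_std R).
Proof.
move=> t; apply: (@continuous_comp _ _ _ (fun t : R => 1 - expR (- (2 * t))) Num.sqrt); last exact: sqrt_continuous.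
apply: cvgB; first exact: cvg_cst.
apply: (@continuous_comp _ _ _ (fun t : R => - (2 * t)) expR); last exact: continuous_expR.
by apply: cvgN; apply: cvgMl_tmp; exact: cvg_id.
Qed.

Lemma continuous_expRN : continuous (fun t : R => expR (- t)).
Proof.
move=> t; apply: (@continuous_comp _ _ _ (fun t : R => - t) expR); last exact: continuous_expR.
by apply: cvgN; exact: cvg_id.
Qed.

Lemma ou_frame_cvg (u tau : nat -> R) (z : nat -> X) s (t : R) x :
  (forall n, 0 <= u n <= T) -> 0 <= s <= T -> u n @[n --> \oo] --> s ->
  tau n @[n --> \oo] --> t -> z n @[n --> \oo] --> x ->
  forall y, ou_frame (tau n) (g (u n)) (z n) y @[n --> \oo] --> ou_frame t (g s) x y.
Proof.
move=> uT sT us taut zx y; apply: jg => //.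
have e1 : expR (- tau n) @[n --> \oo] --> expR (- t) by exact: (cvg_comp _ _ taut (@continuous_expRN t)).
have e2 : ou_std (tau n) @[n --> \oo] --> ou_std t by exact: (cvg_comp _ _ taut (@continuous_ou_std t)).
by apply: cvgD; [exact: cvgZ|exact: cvgZr_tmp].
Qed.

(** At [t = 0] the ratio is a division by 0; there the limit is claimed only for order zero, where
    the ratio occurs to the power 0. *)
Lemma ou_derivs_cvg hs (u tau : nat -> R) (z : nat -> X) s (t : R) x : all_CM gam hs ->
  (forall n, 0 <= u n <= T) -> 0 <= s <= T -> u n @[n --> \oo] --> s ->
  tau n @[n --> \oo] --> t -> z n @[n --> \oo] --> x -> (0 < t \/ hs = [::]) ->
  D (tau n) (g (u n)) (z n) hs @[n --> \oo] --> D t (g s) x hs.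
Proof.
move=> Hhs uT sT us taut zx t0; rewrite /ou_derivs; apply: cvgM; last first.
  apply: (cm_derivs_bounded_limit gauss (M := M)) => //.
  - by move=> n; apply: cyl_ou_frame; apply: cg.
  - by move=> n y; apply: bg.
  - by move=> y; apply: ou_frame_cvg.
have [t0'|->] := t0; last by rewrite expr0; exact: cvg_cst.
have c1 : ou_ratio (tau n) @[n --> \oo] --> ou_ratio t.
  apply: cvgM.
    exact: (cvg_comp _ _ taut (@continuous_expRN t)).
  apply: cvgV; first by have [s0 _] := ou_std_sqr_le t0'; rewrite gt_eqF.
  exact: (cvg_comp _ _ taut (@continuous_ou_std t)).
exact: (cvg_comp _ _ c1 (@exprn_continuous _ _ _)).
Qed.

Lemma ou_frame_distance_cvg (u tau : nat -> R) (z z' : nat -> X) s (t : R) x x' :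
  (forall n, 0 <= u n <= T) -> 0 <= s <= T -> u n @[n --> \oo] --> s ->
  tau n @[n --> \oo] --> t -> z n @[n --> \oo] --> x -> z' n @[n --> \oo] --> x' ->
  Num.sqrt (expect gam (fun y => (ou_frame (tau n) (g (u n)) (z n) y -
      ou_frame (tau n) (g (u n)) (z' n) y) ^+ 2)) @[n --> \oo] -->
  Num.sqrt (expect gam (fun y => (ou_frame t (g s) x y - ou_frame t (g s) x' y) ^+ 2)).
Proof.
move=> uT sT us taut zx zx'.
apply: continuous_cvg; first exact: sqrt_continuous.
apply: (@expect_cvg _ _ _ _ _ ((M + M) ^+ 2)).
- move=> n; apply: measurable_funX; apply: measurable_funB; apply: cyl_bmeasurable; apply: cyl_ou_frame; exact: cg.
- move=> n y; have M0 : 0 <= M := le_trans (normr_ge0 _) (bg 0 sT).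
  rewrite normrX lerXn2r ?nnegrE ?addr_ge0//.
  by apply: le_trans (ler_normB _ _) _; apply: lerD; apply: bg.
- move=> y; have d0 : ou_frame (tau n) (g (u n)) (z n) y - ou_frame (tau n) (g (u n)) (z' n) y
      @[n --> \oo] --> ou_frame t (g s) x y - ou_frame t (g s) x' y.
    by apply: cvgB; apply: ou_frame_cvg.
  exact: (cvg_comp _ _ d0 (@exprn_continuous _ _ _)).
Qed.

End OrnsteinUhlenbeckContinuity.

(** * Schauder estimates for the time integral *)

Section QuantitativeC2a.
Context {R : realType} {X : normedModType R} (gam : probability (borel_X X) R).
Local Notation CMn := (cm_norm gam).
Local Notation CMH := (CM gam).

(** Bounds for fixed directions, homogeneous in them, take the place of suprema over unit balls. The
    remainders of order |h|^2 and |h|^(1+a) are quantitative forms of the two differentiability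
    conditions, and the moduli [d] at the end do not depend on the directions, as continuity in
    operator norm demands. *)
Record C2a_est (a A : R) (f : X -> R) (Df : X -> X -> R) (D2f : X -> X -> X -> R) : Prop := {
  est_bound : forall x, `|f x| <= A;
  est_continuous : continuous f;
  est_D_linear : forall x (c : R) h k, CMH h -> CMH k ->
    Df x (c *: h + k) = c * Df x h + Df x k;
  est_D_bound : forall x h, CMH h -> `|Df x h| <= A * CMn h;
  est_D2_linearl : forall x (c : R) h h' k, CMH h -> CMH h' -> CMH k ->
    D2f x (c *: h + h') k = c * D2f x h k + D2f x h' k;
  est_D2_linearr : forall x (c : R) h k k', CMH h -> CMH k -> CMH k' ->
    D2f x h (c *: k + k') = c * D2f x h k + D2f x h k';
  est_D2_bound : forall x h k, CMH h -> CMH k -> `|D2f x h k| <= A * (CMn h * CMn k);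
  est_remainder0 : forall x h, CMH h -> `|f (x + h) - f x - Df x h| <= A * (CMn h * CMn h);
  est_remainder1 : forall x h k, CMH h -> CMH k ->
    `|Df (x + h) k - Df x k - D2f x h k| <= A * CMn h `^ a * (CMn h * CMn k);
  est_holder : forall x j h k, CMH j -> CMH h -> CMH k ->
    `|D2f (x + j) h k - D2f x h k| <= A * CMn j `^ a * (CMn h * CMn k);
  est_D_continuous : forall x (e : R), 0 < e -> exists d : R, 0 < d /\ forall y, `|y - x| < d ->
    forall h, CMH h -> `|Df y h - Df x h| <= e * CMn h;
  est_D2_continuous : forall x (e : R), 0 < e -> exists d : R, 0 < d /\ forall y, `|y - x| < d ->
    forall h k, CMH h -> CMH k -> `|D2f y h k - D2f x h k| <= e * (CMn h * CMn k) }.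

Hypothesis gauss : centered_gaussian gam.
Variables (a A : R) (f : X -> R) (Df : X -> X -> R) (D2f : X -> X -> X -> R).
Hypothesis est : C2a_est a A f Df D2f.

Lemma est_ge0 : 0 <= A. Proof. by apply: le_trans (est_bound est 0). Qed.

Lemma est_DZ x (c : R) h : CMH h -> Df x (c *: h) = c * Df x h.
Proof.
move=> Hh; have [H0 n0] := CM0 gauss.
have Dx0 : Df x 0 = 0.
  by apply/eqP; rewrite -normr_le0; have := est_D_bound est x H0; rewrite n0 mulr0.
by have := est_D_linear est x c Hh H0; rewrite addr0 Dx0 addr0.
Qed.

Lemma est_D2Zl x (c : R) h k : CMH h -> CMH k -> D2f x (c *: h) k = c * D2f x h k.
Proof.
move=> Hh Hk; have [H0 n0] := CM0 gauss.
have Dx0 : D2f x 0 k = 0.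
  by apply/eqP; rewrite -normr_le0; have := est_D2_bound est x H0 Hk; rewrite n0 mul0r mulr0.
by have := est_D2_linearl est x c Hh H0 Hk; rewrite addr0 Dx0 addr0.
Qed.

Lemma est_D2Zr x (c : R) h k : CMH h -> CMH k -> D2f x h (c *: k) = c * D2f x h k.
Proof.
move=> Hh Hk; have [H0 n0] := CM0 gauss.
have Dx0 : D2f x h 0 = 0.
  by apply/eqP; rewrite -normr_le0; have := est_D2_bound est x Hh H0; rewrite n0 !mulr0.
by have := est_D2_linearr est x c Hh Hk H0; rewrite addr0 Dx0 addr0.
Qed.

End QuantitativeC2a.

Section DominatedIntegral.
Context {R : realType}.
Notation mu := (@lebesgue_measure R).

Lemma dominated_Rintegral_le (I : set R) (phi psi : R -> R) (C K : R) :
  measurable I -> measurable_fun I phi -> measurable_fun I psi ->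
  0 <= C -> (forall s, I s -> 0 <= psi s) ->
  (\int[mu]_(s in I) (psi s)%:E <= K%:E)%E ->
  (forall s, I s -> `|phi s| <= C * psi s) ->
  mu.-integrable I (EFin \o phi) /\ `|\int[mu]_(s in I) phi s| <= C * K.
Proof.
move=> mI mphi mpsi C0 psi0 psiK phile.
have ipsi : mu.-integrable I (EFin \o psi).
  apply/integrableP; split; first exact/measurable_EFinP.
  under eq_integral => s /set_mem Is do rewrite /= (ger0_norm (psi0 s Is)).
  by apply: le_lt_trans psiK _; rewrite ltry.
have iC : mu.-integrable I (EFin \o (fun s => C * psi s)) by exact: (integrableZl _ _ ipsi).
have iphi : mu.-integrable I (EFin \o phi).
  apply: le_integrable iC => //; first exact/measurable_EFinP.
  move=> s Is; rewrite /= lee_fin [leRHS]ger0_norm; first exact: phile.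
  by rewrite mulr_ge0// psi0.
split => //.
apply: le_trans (le_normr_Rintegral _ iphi) _ => //.
apply: (@le_trans _ _ (\int[mu]_(s in I) (C * psi s))).
  by apply: le_Rintegral => //; exact: (integrable_norm iphi).
rewrite RintegralZl// ler_wpM2l// /Rintegral -lee_fin fineK//.
exact: integrable_fin_num.
Qed.

End DominatedIntegral.

(** * The time integral and its derivatives *)

Section MildDerivatives.
Context {R : realType} {X : normedModType R} (gam : probability (borel_X X) R).
Hypothesis gauss : centered_gaussian gam.
Implicit Types (h k j x y : X) (hs : seq X).
Local Notation D := (ou_derivs gam).
Local Notation CMn := (cm_norm gam).
Local Notation CMH := (CM gam).
Notation mu := (@lebesgue_measure R).

Variables (T M a L : R) (g : R -> X -> R).
Hypotheses (a01 : 0 < a < 1) (L0 : 0 <= L)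
  (cg : forall s : R, 0 <= s <= T -> cyl (g s))
  (bg : forall (s : R) x, 0 <= s <= T -> `|g s x| <= M)
  (hg : forall s : R, 0 <= s <= T -> holder_along gam a L (g s))
  (jg : forall (u : nat -> R) (z : nat -> X) (s : R) x, (forall n, 0 <= u n <= T) -> 0 <= s <= T ->
     u n @[n --> \oo] --> s -> z n @[n --> \oo] --> x -> g (u n) (z n) @[n --> \oo] --> g s x).

(* The interval is open at [t] because [ou_ratio 0] is a division by [0]. *)
Definition mild_derivs t x hs : R := \int[mu]_(s in `[0, t[) D (t - s) (g s) x hs.
Local Notation V := mild_derivs.

Let a0 : 0 < a. Proof. by case/andP: a01. Qed.

Let in_time t s : t <= T -> `[0, t[%classic s -> 0 <= s <= T /\ 0 < t - s.
Proof.
move=> tT /=; rewrite in_itv/= => /andP[s0 st]; rewrite s0 subr_gt0 st; split => //=.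
by rewrite (le_trans (ltW st)).
Qed.

Let measurable_sequential (I : set R) (phi : R -> R) : measurable I ->
  (forall s (u : nat -> R), I s -> (forall n, I (u n)) -> u n @[n --> \oo] --> s ->
    phi (u n) @[n --> \oo] --> phi s) -> measurable_fun I phi.
Proof.
move=> mI H; apply: subspace_continuous_measurable_fun => //.
apply/subspace_continuousP => s Is; apply: within_cvg_seq => u uI us.
exact: H.
Qed.

Lemma measurable_ou_derivs t x hs : t <= T -> all_CM gam hs ->
  measurable_fun `[0, t[%classic (fun s => D (t - s) (g s) x hs).
Proof.
move=> tT Hhs; apply: measurable_sequential; first exact: measurable_itv.
move=> s u Is Iu us.
have [sT ts] := in_time tT Is.
apply: (ou_derivs_cvg gauss cg bg jg (u := u) (z := fun=> x)) => //.
- by move=> n; have [] := in_time tT (Iu n).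
- by apply: cvgB => //; exact: cvg_cst.
- exact: cvg_cst.
- by left.
Qed.

Let ou_weightE t s (n : nat) : ou_weight a n (t - s) = power_weight ((a - n%:R) / 2 + 1) t s.
Proof. by rewrite /ou_weight /power_weight addrK. Qed.

(** Bounds for the time integrals of the weights of order 1 and 2 up to the horizon [T], and the
    factor of the interpolated weight from [integral_min_weight_le], which depends on [a] alone. *)
Let K1 : R := (2 * T) `^ ((a + 1) / 2) / (a + 1).
Let K2 : R := (2 * T) `^ (a / 2) / a.
Let K3 : R := 2 / a + (1 - a)^-1.

Let weight_int (b t : R) : 0 < b -> 0 <= t -> t <= T ->
  (\int[mu]_(s in `[0%R, t[) (power_weight b t s)%:E <= ((2 * T) `^ b / (2 * b))%:E)%E.
Proof.
move=> b0 t0 tT; apply: le_trans (integral_power_weight_le b0 t0) _.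
rewrite subr0 lee_fin ler_wpM2r ?invr_ge0 ?mulr_ge0 ?(ltW b0)//.
apply: ge0_ler_powR; rewrite ?nnegrE ?(ltW b0) ?mulr_ge0//.
  exact: le_trans tT.
by rewrite ler_wpM2l.
Qed.

Let ou_derivs0_le (tau s : R) x : 0 <= s <= T -> `|D tau (g s) x [::]| <= M.
Proof.
move=> sT; rewrite /ou_derivs expr0 mul1r.
have := cm_derivs_le gauss (hs := [::]) Logic.I (cyl_ou_frame tau x (cg sT)).
by move=> /(_ M (fun y => bg _ sT)); rewrite mul1r.
Qed.

Lemma mild_derivs_joint_cvg (u : nat -> R) (z : nat -> X) (t : R) x :
  (forall n, 0 <= u n <= T) -> 0 <= t <= T -> u n @[n --> \oo] --> t -> z n @[n --> \oo] --> x ->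
  V (u n) (z n) [::] @[n --> \oo] --> V t x [::].
Proof.
move=> uT tT ut zx.
have M0 : 0 <= M := le_trans (normr_ge0 _) (@bg t 0 tT).
(* Extension by 0 moves the varying end point from the domain into the integrand. *)
pose F n := (fun s => D (u n - s) (g s) (z n) [::]) \_ `[0, u n[%classic.
pose F0 := (fun s => D (t - s) (g s) x [::]) \_ `[0, t[%classic.
have mF n : measurable_fun setT (F n).
  apply/(measurable_restrictT _ (measurable_itv _)); apply: measurable_ou_derivs => //.
  by case/andP: (uT n).
have mF0 : measurable_fun setT F0.
  apply/(measurable_restrictT _ (measurable_itv _)); apply: measurable_ou_derivs => //.
  by case/andP: tT.
pose B := (fun=> M : R) \_ `[0, T]%classic.
have iB : mu.-integrable setT (EFin \o B).
  rewrite /B -restrict_EFin; apply/integrable_restrict => //=.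
  have iM : mu.-integrable `[0, T] (EFin \o (fun=> M)).
    exact: (@integrable_bounded_itv _ (fun=> M) 0 T `|M| (measurable_cst _) (fun s _ => lexx _)).
  by rewrite setTI; exact: iM.
have [|||_ c] := @Rintegral_dominated_convergence _ (measurableTypeR R) R mu setT F F0 B measurableT mF mF0.
(* At [s = t] the intervals [[0, u n[] may contain [s] or not without settling; this single point is
   the exceptional null set. *)
- exists [set t]; split; [exact: measurable_set1|exact: lebesgue_measure_set1|].
  move=> s /= Hs; apply: contrapT => st; apply: Hs => _.
  rewrite /F /F0; have [ts|s_t|/esym //] := ltrgtP t s.
  + rewrite [X in _ --> X]patchE memNset ?/= ?in_itv/= ?(le_gtF (ltW ts)) ?andbF//.
    apply: cvg_near_cst.
    have : \forall n \near \oo, u n <= s by exact: (cvgr_le _ ut).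
    apply: filterS => n us; rewrite patchE memNset//= in_itv/= ltNge us andbF//.
  + have [s0|s0] := ltP s 0.
      rewrite [X in _ --> X]patchE memNset ?/= ?in_itv/= ?(lt_geF s0)//.
      apply: cvg_near_cst; apply: nearW => n.
      by rewrite patchE memNset//= in_itv/= (lt_geF s0).
    rewrite [X in _ --> X]patchE mem_set ?/= ?in_itv/= ?s0//.
    have sT : 0 <= s <= T.
      by rewrite s0/=; case/andP: tT => _; apply: le_trans; exact: ltW.
    have cs : s @[_ --> \oo] --> s by exact: cvg_cst.
    have cus : u n - s @[n --> \oo] --> t - s by apply: cvgB => //; exact: cvg_cst.
    have cD : D (u n - s) (g s) (z n) [::] @[n --> \oo] --> D (t - s) (g s) x [::].
      exact: (ou_derivs_cvg gauss cg bg jg (hs := [::]) Logic.I (fun=> sT) sT cs cus zx (or_intror erefl)).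
    apply: cvg_trans cD; apply: near_eq_cvg.
    have : \forall n \near \oo, s < u n by exact: (cvgr_gt _ ut).
    apply: filterS => n su; rewrite patchE mem_set//= in_itv/= s0 su//.
- exact: iB.
- move=> n s _; rewrite /F /B !patchE; case: ifPn => [|_].
    rewrite inE /= in_itv/= => /andP[s0 su].
    have sT : 0 <= s <= T.
      by rewrite s0/=; case/andP: (uT n) => _; apply: le_trans; exact: ltW.
    by rewrite mem_set/= ?in_itv//=; exact: ou_derivs0_le.
  by rewrite normr0; case: ifP.
rewrite /V Rintegral_mkcond; under eq_cvg do rewrite Rintegral_mkcond.
exact: c.
Qed.

Section FixedTime.
Variable t : R.
Hypothesis t0T : 0 <= t <= T.
Let t0 : 0 <= t. Proof. by case/andP: t0T. Qed.
Let tT : t <= T. Proof. by case/andP: t0T. Qed.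
Let T0 : 0 <= T := le_trans t0 tT.
Let M0 : 0 <= M := le_trans (normr_ge0 _) (@bg t 0 t0T).
Let I : set R := `[0, t[%classic.
Let mI : measurable (I : set (measurableTypeR R)). Proof. exact: measurable_itv. Qed.

Let estimate1 (phi : R -> R) (C : R) : measurable_fun I phi -> 0 <= C ->
  (forall s, I s -> `|phi s| <= C * ou_weight a 1 (t - s)) ->
  mu.-integrable I (EFin \o phi) /\ `|\int[mu]_(s in I) phi s| <= C * K1.
Proof.
move=> mphi C0 H.
apply: (@dominated_Rintegral_le _ I phi (power_weight ((a + 1) / 2) t)) => //.
- exact: measurable_power_weight.
- by move=> s _; exact: power_weight_ge0.
- have b0 : 0 < (a + 1) / 2 by rewrite divr_gt0// addr_gt0.
  apply: le_trans (weight_int b0 t0 tT) _; rewrite lee_fin /K1.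
  by rewrite (_ : 2 * ((a + 1) / 2) = a + 1)//; field.
- move=> s Is; have := H s Is; rewrite ou_weightE.
  by rewrite (_ : (a - 1) / 2 + 1 = (a + 1) / 2)//; field.
Qed.

Let estimate2 (phi : R -> R) (C : R) : measurable_fun I phi -> 0 <= C ->
  (forall s, I s -> `|phi s| <= C * ou_weight a 2 (t - s)) ->
  mu.-integrable I (EFin \o phi) /\ `|\int[mu]_(s in I) phi s| <= C * K2.
Proof.
move=> mphi C0 H.
apply: (@dominated_Rintegral_le _ I phi (power_weight (a / 2) t)) => //.
- exact: measurable_power_weight.
- by move=> s _; exact: power_weight_ge0.
- have b0 : 0 < a / 2 by rewrite divr_gt0.
  apply: le_trans (weight_int b0 t0 tT) _; rewrite lee_fin /K2.
  by rewrite (_ : 2 * (a / 2) = a)//; field.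
- move=> s Is; have := H s Is; rewrite ou_weightE.
  by rewrite (_ : (a - 2%:R) / 2 + 1 = a / 2)//; field.
Qed.

Let estimate3 (phi : R -> R) (C r : R) : measurable_fun I phi -> 0 <= C -> 0 <= r ->
  (forall s, I s -> `|phi s| <= C * ou_mod a (t - s) r) ->
  mu.-integrable I (EFin \o phi) /\ `|\int[mu]_(s in I) phi s| <= C * (K3 * r `^ a).
Proof.
move=> mphi C0; rewrite le_eqVlt => /predU1P[<- H|r0 H].
  rewrite powR0 ?(gt_eqF a0)// !mulr0.
  have := @estimate2 phi 0 mphi (lexx 0); rewrite mul0r; apply => s Is.
  have := H s Is; rewrite /ou_mod mulr0 mul0r.
  by have /min_idPr -> : 0 <= 2 * ou_weight a 2 (t - s); rewrite ?mulr0// mulr_ge0// powR_ge0.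
apply: (@dominated_Rintegral_le _ I phi (fun s => Num.min (2 * power_weight (a / 2) t s)
      (power_weight ((a - 1) / 2) t s * r))) => //.
- apply: measurable_minr.
  + by apply: measurable_funM => //; exact: measurable_power_weight.
  + by apply: measurable_funM => //; exact: measurable_power_weight.
- by move=> s _; rewrite le_min !mulr_ge0 ?power_weight_ge0// ltW.
- exact: integral_min_weight_le.
- move=> s Is; have := H s Is; rewrite /ou_mod !ou_weightE.
  rewrite (_ : (a - 2%:R) / 2 + 1 = a / 2); last by field.
  by rewrite (_ : (a - 3%:R) / 2 + 1 = (a - 1) / 2)//; field.
Qed.

Let mD x hs : all_CM gam hs -> measurable_fun I (fun s => D (t - s) (g s) x hs).
Proof. exact: measurable_ou_derivs. Qed.

Let int0 x : mu.-integrable I (EFin \o (fun s => D (t - s) (g s) x [::])) /\ `|V t x [::]| <= M * T.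
Proof.
apply: (@dominated_Rintegral_le _ I _ (fun=> 1)) => //.
- exact: mD.
- rewrite integral_cst//= mul1e lebesgue_measure_itv/=.
  by case: ifP => _; rewrite ?oppr0 ?adde0 lee_fin.
- by move=> s Is; have [sT _] := in_time tT Is; rewrite mulr1; exact: ou_derivs0_le.
Qed.

Let int1 x h : CMH h -> mu.-integrable I (EFin \o (fun s => D (t - s) (g s) x [:: h])) /\
  `|V t x [:: h]| <= 13 * L * K1 * CMn h.
Proof.
move=> Hh; rewrite (_ : 13 * L * K1 * CMn h = 13 * L * CMn h * K1); last by ring.
apply: estimate1.
- by apply: mD.
- by rewrite !mulr_ge0 ?cm_norm_ge0.
- move=> s Is; have [sT ts] := in_time tT Is.
  have := ou_deriv1_le gauss a0 L0 (cg sT) (hg sT) ts x Hh.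
  by rewrite (_ : 13 * L * CMn h * _ = 13 * L * ou_weight a 1 (t - s) * CMn h)//; ring.
Qed.

Let int2 x h k : CMH h -> CMH k -> mu.-integrable I (EFin \o (fun s => D (t - s) (g s) x [:: h; k])) /\
  `|V t x [:: h; k]| <= 13 * L * K2 * (CMn h * CMn k).
Proof.
move=> Hh Hk; rewrite (_ : 13 * L * K2 * _ = 13 * L * (CMn h * CMn k) * K2); last by ring.
apply: estimate2.
- by apply: mD.
- by rewrite !mulr_ge0 ?cm_norm_ge0.
- move=> s Is; have [sT ts] := in_time tT Is.
  have := ou_deriv2_le gauss a0 L0 (cg sT) (hg sT) ts x Hh Hk.
  by rewrite (_ : 13 * L * (CMn h * CMn k) * _ = 13 * L * ou_weight a 2 (t - s) * (CMn h * CMn k))//; ring.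
Qed.

Let V_remainder0 x h : CMH h ->
  `|V t (x + h) [::] - V t x [::] - V t x [:: h]| <= 13 * L * K2 * (CMn h * CMn h).
Proof.
move=> Hh; have [i1 _] := int0 (x + h); have [i2 _] := int0 x; have [i3 _] := int1 x Hh.
have i12 := integrableB mI i1 i2.
rewrite /V -(RintegralB mI i1 i2) -(RintegralB mI i12 i3).
rewrite (_ : 13 * L * K2 * _ = 13 * L * (CMn h * CMn h) * K2); last by ring.
apply: (proj2 (estimate2 _ _ _)).
- by apply: measurable_funB; [apply: measurable_funB|]; apply: mD.
- by rewrite !mulr_ge0 ?cm_norm_ge0.
- move=> s Is; have [sT ts] := in_time tT Is.
  have := ou_deriv0_remainder gauss a0 L0 (cg sT) (hg sT) ts x Hh.
  by rewrite (_ : 13 * L * (CMn h * CMn h) * _ = 13 * L * ou_weight a 2 (t - s) * (CMn h * CMn h))//; ring.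
Qed.

Let V_remainder1 x h k : CMH h -> CMH k ->
  `|V t (x + h) [:: k] - V t x [:: k] - V t x [:: h; k]| <= 13 * L * K3 * CMn h `^ a * (CMn h * CMn k).
Proof.
move=> Hh Hk; have [i1 _] := int1 (x + h) Hk; have [i2 _] := int1 x Hk; have [i3 _] := int2 x Hh Hk.
have i12 := integrableB mI i1 i2.
rewrite /V -(RintegralB mI i1 i2) -(RintegralB mI i12 i3).
rewrite (_ : 13 * L * K3 * _ * _ = 13 * L * (CMn h * CMn k) * (K3 * CMn h `^ a)); last by ring.
apply: (proj2 (estimate3 _ _ _ _)).
- by apply: measurable_funB; [apply: measurable_funB|]; apply: mD.
- by rewrite !mulr_ge0 ?cm_norm_ge0.
- exact: cm_norm_ge0.
- move=> s Is; have [sT ts] := in_time tT Is.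
  have := ou_deriv1_remainder gauss a0 L0 (cg sT) (hg sT) ts x Hh Hk.
  by rewrite (_ : 13 * L * (CMn h * CMn k) * _ = 13 * L * ou_mod a (t - s) (CMn h) * (CMn h * CMn k))//; ring.
Qed.

Let V_holder x j h k : CMH j -> CMH h -> CMH k ->
  `|V t (x + j) [:: h; k] - V t x [:: h; k]| <= 13 * L * K3 * CMn j `^ a * (CMn h * CMn k).
Proof.
move=> Hj Hh Hk; have [i1 _] := int2 (x + j) Hh Hk; have [i2 _] := int2 x Hh Hk.
rewrite /V -(RintegralB mI i1 i2).
rewrite (_ : 13 * L * K3 * _ * _ = 13 * L * (CMn h * CMn k) * (K3 * CMn j `^ a)); last by ring.
apply: (proj2 (estimate3 _ _ _ _)).
- by apply: measurable_funB; apply: mD.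
- by rewrite !mulr_ge0 ?cm_norm_ge0.
- exact: cm_norm_ge0.
- move=> s Is; have [sT ts] := in_time tT Is.
  have := ou_deriv2_increment gauss a0 L0 (cg sT) (hg sT) ts x Hj Hh Hk.
  by rewrite (_ : 13 * L * (CMn h * CMn k) * _ = 13 * L * ou_mod a (t - s) (CMn j) * (CMn h * CMn k))//; ring.
Qed.

Let V_linear x (c : R) hs1 hs2 hs3 :
  mu.-integrable I (EFin \o (fun s => D (t - s) (g s) x hs1)) ->
  mu.-integrable I (EFin \o (fun s => D (t - s) (g s) x hs2)) ->
  (forall s, 0 <= s <= T ->
    D (t - s) (g s) x hs3 = c * D (t - s) (g s) x hs1 + D (t - s) (g s) x hs2) ->
  V t x hs3 = c * V t x hs1 + V t x hs2.
Proof.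
move=> i1 i2 H.
have i3 : mu.-integrable I (EFin \o (fun s => c * D (t - s) (g s) x hs1)) by exact: (integrableZl _ _ i1).
rewrite /V -(RintegralZl _ mI i1) -(RintegralD mI i3 i2); apply: eq_Rintegral => s; rewrite inE => Is.
by have [sT _] := in_time tT Is; exact: H.
Qed.

Let dist s x y : R :=
  Num.sqrt (expect gam (fun z => (ou_frame (t - s) (g s) y z - ou_frame (t - s) (g s) x z) ^+ 2)).

(** The weight [W] is integrable in time but does not get small; the second argument of the minimum
    tends to 0 as [y] tends to [x], but the power of the ratio in front of it is singular at
    [s = t]. The minimum is dominated by the first and squeezed by the second, so its integral tends
    to 0. The radius [d] is found before [phi] and [C], which gives uniformity in the directions. *)
Let dominated_modulus (n : nat) (W : R -> R) (K : R) x (e : R) :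
  measurable_fun I W -> (forall s, I s -> 0 <= W s) -> (\int[mu]_(s in I) (W s)%:E <= K%:E)%E ->
  0 < e -> exists d, 0 < d /\ forall y, `|y - x| < d ->
    forall (phi : R -> R) (C : R), measurable_fun I phi -> 0 <= C ->
    (forall s, I s -> `|phi s| <= C * Num.min (W s) (ou_ratio (t - s) ^+ n * (4 * dist s x y))) ->
    `|\int[mu]_(s in I) phi s| <= C * e.
Proof.
move=> mW W0 WK e0.
pose psi y s := Num.min (W s) (ou_ratio (t - s) ^+ n * (4 * dist s x y)).
have ratio_cvg (u : nat -> R) s : I s -> (forall n, I (u n)) -> u n @[n --> \oo] --> s ->
    ou_ratio (t - u n) @[n --> \oo] --> ou_ratio (t - s).
  move=> Is Iu us; have [_ ts] := in_time tT Is.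
  have tus : t - u n @[n --> \oo] --> t - s by apply: cvgB => //; exact: cvg_cst.
  apply: cvgM; first exact: (cvg_comp _ _ tus (@continuous_expRN R (t - s))).
  apply: cvgV; first by have [s0 _] := ou_std_sqr_le ts; rewrite gt_eqF.
  exact: (cvg_comp _ _ tus (@continuous_ou_std R (t - s))).
have mr y : measurable_fun I (fun s => ou_ratio (t - s) ^+ n * (4 * dist s x y)).
  apply: measurable_sequential => // s u Is Iu us.
  have [sT ts] := in_time tT Is.
  have uT m : 0 <= u m <= T by have [] := in_time tT (Iu m).
  have tus : t - u m @[m --> \oo] --> t - s by apply: cvgB => //; exact: cvg_cst.
  apply: cvgM; first exact: (cvg_comp _ _ (ratio_cvg u s Is Iu us) (@exprn_continuous _ _ _)).
  apply: cvgMl_tmp.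
  have cy : y @[_ --> \oo] --> y by exact: cvg_cst.
  have cx : x @[_ --> \oo] --> x by exact: cvg_cst.
  exact: (ou_frame_distance_cvg cg bg jg uT sT us tus cy cx).
have mpsi y : measurable_fun I (psi y) by exact: measurable_minr.
have r0 s : I s -> 0 <= ou_ratio (t - s) ^+ n.
  by move=> Is; have [_ ts] := in_time tT Is; rewrite exprn_ge0// ltW// ou_ratio_gt0.
have psi0 y s : I s -> 0 <= psi y s.
  by move=> Is; rewrite le_min W0//= mulr_ge0 ?r0// mulr_ge0// sqrtr_ge0.
have psiW y s : I s -> `|psi y s| <= 1 * W s.
  by move=> Is; rewrite ger0_norm ?psi0// mul1r ge_min lexx.
have ipsi y : mu.-integrable I (EFin \o psi y).
  by have [] := @dominated_Rintegral_le _ I (psi y) W 1 K mI (mpsi y) mW ler01 W0 WK (psiW y).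
have iW : mu.-integrable I (EFin \o W).
  have [] // := @dominated_Rintegral_le _ I W W 1 K mI mW mW ler01 W0 WK.
  by move=> s Is; rewrite ger0_norm ?W0// mul1r.
have distxx s : dist s x x = 0.
  rewrite /dist (_ : (fun z => _) = (fun=> 0)); last by apply/funext => z; rewrite subrr expr0n.
  by rewrite expect_cst sqrtr0.
have psixx s : I s -> psi x s = 0.
  by move=> Is; rewrite /psi distxx !mulr0 (min_idPr (W0 s Is)).
have c0 : (fun y => \int[mu]_(s in I) psi y s) @ within setT (nbhs x) --> \int[mu]_(s in I) psi x s.
  apply: within_cvg_seq => z _ zx.
  have [|||_ c] := @Rintegral_dominated_convergence _ (measurableTypeR R) R mu I (fun m => psi (z m)) (psi x) W mI (fun m => mpsi (z m)) (mpsi x).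
  - apply: aeW => s Is; have [sT ts] := in_time tT Is.
    have cd : dist s x (z m) @[m --> \oo] --> dist s x x.
      have cs : s @[_ --> \oo] --> s by exact: cvg_cst.
      have cts : t - s @[_ --> \oo] --> t - s by exact: cvg_cst.
      have cx : x @[_ --> \oo] --> x by exact: cvg_cst.
      exact: (ou_frame_distance_cvg cg bg jg (fun=> sT) sT cs cts zx cx).
    have cr : ou_ratio (t - s) ^+ n * (4 * dist s x (z m)) @[m --> \oo] --> ou_ratio (t - s) ^+ n * (4 * dist s x x).
      by apply: cvgMl_tmp; apply: cvgMl_tmp; exact: cd.
    rewrite distxx !mulr0 in cr; rewrite psixx//.
    apply: (@squeeze_cvgr _ _ _ _ (fun=> 0) (fun m => ou_ratio (t - s) ^+ n * (4 * dist s x (z m)))) => //.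
    + by apply: nearW => m; rewrite psi0//= ge_min lexx orbT.
    + exact: cvg_cst.
  - exact: iW.
  - by move=> m s Is; rewrite -[W s]mul1r; exact: psiW.
  exact: c.
have psix : \int[mu]_(s in I) psi x s = 0.
  by rewrite /Rintegral integral0_eq// => s Is; rewrite psixx.
rewrite psix in c0.
have /cvgrPdist_le /(_ e e0) /nbhs_ballP [d /= d0 dP] := c0.
exists d; split => // y yx phi C mphi C0 phile.
have yb : ball x d y by rewrite -ball_normE/= distrC.
have := dP y yb Logic.I; rewrite /= sub0r normrN => H.
have psie : (\int[mu]_(s in I) (psi y s)%:E <= e%:E)%E.
  have f := integrable_fin_num mI (ipsi y).
  rewrite -(fineK f) lee_fin; apply: le_trans H; exact: ler_norm.
by have [] := @dominated_Rintegral_le _ I phi (psi y) C e mI mphi (mpsi y) C0 (psi0 y) psie phile.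
Qed.

Let le_mul_min (z C u v : R) : z <= C * u -> z <= C * v -> z <= C * Num.min u v.
Proof. by case: (leP u v). Qed.

(** Both orders of differentiation at once: [P] selects the lists of directions and [w] is the
    product of their norms. The factor 4 exceeds the constants 5/3 and 125/36 of [derivs_bound] at
    orders one and two, and 26 is twice 13, for a difference of two derivatives. *)
Let V_continuous (n : nat) (b : R) (P : seq X -> Prop) (w : seq X -> R) x (e : R) : 0 < b ->
  (forall hs, P hs -> all_CM gam hs /\ size hs = n) ->
  (forall hs, P hs -> 0 <= w hs /\ derivs_bound gam hs <= 4 * w hs) ->
  (forall y hs, P hs -> mu.-integrable I (EFin \o (fun s => D (t - s) (g s) y hs))) ->
  (forall s y hs, I s -> P hs ->
     `|D (t - s) (g s) y hs| <= 13 * L * power_weight b t s * w hs) ->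
  0 < e -> exists d : R, 0 < d /\ forall y, `|y - x| < d ->
  forall hs, P hs -> `|V t y hs - V t x hs| <= e * w hs.
Proof.
move=> b0 Phs Pw iD bD e0.
pose W s := 26 * L * power_weight b t s.
have L26 : 0 <= 26 * L by rewrite mulr_ge0.
have mW : measurable_fun I W by apply: measurable_funM => //; exact: measurable_power_weight.
have W0 s : I s -> 0 <= W s by move=> _; rewrite mulr_ge0// power_weight_ge0.
have WK : (\int[mu]_(s in I) (W s)%:E <= (26 * L * ((2 * T) `^ b / (2 * b)))%:E)%E.
  under eq_integral do rewrite EFinM.
  rewrite ge0_integralZl//; last 2 first.
  - by apply/measurable_EFinP; exact: measurable_power_weight.
  - by move=> s _; rewrite lee_fin power_weight_ge0.
  by rewrite [leRHS]EFinM lee_wpmul2l//; exact: weight_int.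
have [d [d0 dP]] := @dominated_modulus n W _ x e mW W0 WK e0.
exists d; split => // y yx hs Hhs; have [CMhs sz] := Phs hs Hhs; have [w0 wb] := Pw hs Hhs.
rewrite /V -(RintegralB mI (iD y hs Hhs) (iD x hs Hhs)) mulrC; apply: (dP y yx) => //.
  by apply: measurable_funB; apply: mD.
move=> s Is; have [sT ts] := in_time tT Is; apply: le_mul_min.
  apply: le_trans (ler_normB _ _) _.
  apply: le_trans (lerD (bD s y hs Is Hhs) (bD s x hs Is Hhs)) _.
  by rewrite /W le_eqVlt; apply/orP; left; apply/eqP; ring.
apply: le_trans (ou_derivs_distance gauss (cg sT) ts y x CMhs) _.
rewrite sz -/(dist s x y).
have r0 := ou_ratio_gt0 ts; have q0 : 0 <= dist s x y by exact: sqrtr_ge0.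
rewrite [leRHS](_ : _ = ou_ratio (t - s) ^+ n * (4 * w hs * dist s x y)); last by ring.
by rewrite ler_wpM2l ?exprn_ge0 ?(ltW r0)// ler_wpM2r.
Qed.

Lemma mild_derivs_est : C2a_est gam a (M * T + 13 * L * (K1 + K2 + K3))
  (fun x => V t x [::]) (fun x h => V t x [:: h]) (fun x h k => V t x [:: h; k]).
Proof.
have K10 : 0 <= K1 by rewrite divr_ge0 ?powR_ge0// addr_ge0// ltW.
have K20 : 0 <= K2 by rewrite divr_ge0 ?powR_ge0// ltW.
have K30 : 0 <= K3.
  by case/andP: a01 => _ a1; rewrite addr_ge0// ?divr_ge0 ?invr_ge0 ?subr_ge0 ?(ltW a0) ?(ltW a1).
have le1 : 13 * L * K1 <= M * T + 13 * L * (K1 + K2 + K3).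
  by rewrite -[leLHS]add0r lerD ?mulr_ge0// ler_wpM2l ?mulr_ge0//; lra.
have le2 : 13 * L * K2 <= M * T + 13 * L * (K1 + K2 + K3).
  by rewrite -[leLHS]add0r lerD ?mulr_ge0// ler_wpM2l ?mulr_ge0//; lra.
have le3 : 13 * L * K3 <= M * T + 13 * L * (K1 + K2 + K3).
  by rewrite -[leLHS]add0r lerD ?mulr_ge0// ler_wpM2l ?mulr_ge0//; lra.
have N0 h : CMH h -> 0 <= CMn h by exact: cm_norm_ge0.
split.
- move=> x; have [_ H] := int0 x; apply: le_trans H _.
  rewrite lerDl; apply: mulr_ge0; [exact: mulr_ge0|by apply: addr_ge0 => //; exact: addr_ge0].
- move=> x; apply: cvg_seq_continuous => z zx.
  by apply: (mild_derivs_joint_cvg (u := fun=> t)) => //; exact: cvg_cst.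
- move=> x c h k Hh Hk; apply: V_linear => [||s sT]; [by case: (int1 x Hh)|by case: (int1 x Hk)|].
  exact: (ou_deriv_head_linear gauss (t - s) (cg sT) x c Hh Hk (hs := [::]) Logic.I).
- by move=> x h Hh; have [_ H] := int1 x Hh; apply: le_trans H _; rewrite ler_wpM2r ?N0.
- move=> x c h h' k Hh Hh' Hk.
  apply: V_linear => [||s sT]; [by case: (int2 x Hh Hk)|by case: (int2 x Hh' Hk)|].
  exact: (ou_deriv_head_linear gauss (t - s) (cg sT) x c Hh Hh' (hs := [:: k]) (conj Hk Logic.I)).
- move=> x c h k k' Hh Hk Hk'.
  apply: V_linear => [||s sT]; [by case: (int2 x Hh Hk)|by case: (int2 x Hh Hk')|].
  exact: (ou_deriv_second_linear gauss (t - s) (cg sT) x c Hh Hk Hk' (hs := [::]) Logic.I).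
- by move=> x h k Hh Hk; have [_ H] := int2 x Hh Hk; apply: le_trans H _; rewrite ler_wpM2r ?mulr_ge0 ?N0.
- by move=> x h Hh; apply: le_trans (V_remainder0 x Hh) _; rewrite ler_wpM2r ?mulr_ge0 ?N0.
- move=> x h k Hh Hk; apply: le_trans (V_remainder1 x Hh Hk) _.
  by rewrite ler_wpM2r ?mulr_ge0 ?N0// ler_wpM2r ?powR_ge0.
- move=> x j h k Hj Hh Hk; apply: le_trans (V_holder x Hj Hh Hk) _.
  by rewrite ler_wpM2r ?mulr_ge0 ?N0// ler_wpM2r ?powR_ge0.
- move=> x e e0.
  have b0 : 0 < (a + 1) / 2 by rewrite divr_gt0// addr_gt0.
  have [||||d [d0 dP]] := @V_continuous 1 _ (fun hs => exists2 h, CMH h & hs = [:: h])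
    (fun hs => if hs is h :: _ then CMn h else 0) x e b0 _ _ _ _ e0.
  + by move=> _ [h Hh ->].
  + move=> _ [h Hh ->]; have h0 := N0 h Hh; split => //=.
    by rewrite expr0 !mulr1 ler_wpM2r//; lra.
  + by move=> y _ [h Hh ->]; have [] := int1 y Hh.
  + move=> s y _ Is [h Hh ->]; have [sT ts] := in_time tT Is.
    have := ou_deriv1_le gauss a0 L0 (cg sT) (hg sT) ts y Hh; rewrite ou_weightE.
    by rewrite (_ : (a - 1) / 2 + 1 = (a + 1) / 2)//; field.
  exists d; split => // y yx h Hh; apply: (dP y yx [:: h]).
  by exists h.
- move=> x e e0; have b0 : 0 < a / 2 by rewrite divr_gt0.
  have [||||d [d0 dP]] := @V_continuous 2 _
    (fun hs => exists2 p : X * X, CMH p.1 /\ CMH p.2 & hs = [:: p.1; p.2])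
    (fun hs => if hs is [:: h, k & _] then CMn h * CMn k else 0) x e b0 _ _ _ _ e0.
  + by move=> _ [[h k] [Hh Hk] ->].
  + move=> _ [[h k] [Hh Hk] ->]; have h0 := N0 h Hh; have k0 := N0 k Hk; split; first exact: mulr_ge0.
    rewrite /= expr0 expr1 !mulr1 (_ : 5 / 3 * (5 / 4) * CMn h * (5 / 3 * CMn k) =
      (5 / 3 * (5 / 4) * (5 / 3)) * (CMn h * CMn k)); last by ring.
    by rewrite ler_wpM2r ?mulr_ge0//; lra.
  + by move=> y _ [[h k] [Hh Hk] ->]; have [] := int2 y Hh Hk.
  + move=> s y _ Is [[h k] [Hh Hk] ->]; have [sT ts] := in_time tT Is.
    have := ou_deriv2_le gauss a0 L0 (cg sT) (hg sT) ts y Hh Hk; rewrite ou_weightE.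
    by rewrite (_ : (a - 2%:R) / 2 + 1 = a / 2)//; field.
  exists d; split => // y yx h k Hh Hk; apply: (dP y yx [:: h; k]).
  by exists (h, k).
Qed.

End FixedTime.
End MildDerivatives.

(** * Regularity of the semigroup on C^(2+a) *)

Section OperatorNorms.
Context {R : realType} {X : normedModType R} (gam : probability (borel_X X) R).
Hypothesis gauss : centered_gaussian gam.
Local Notation CMn := (cm_norm gam).
Local Notation CMH := (CM gam).

Let unit_scaling h : CMH h -> h != 0 ->
  [/\ 0 < CMn h, CMH ((CMn h)^-1 *: h) & CMn ((CMn h)^-1 *: h) <= 1].
Proof.
move=> Hh h0; have n0 := cm_norm_gt0 gauss Hh h0.
have [H1 H2] := CMZ gauss (CMn h)^-1 Hh; split => //.
by rewrite H2 ger0_norm ?invr_ge0 ?(ltW n0)// mulVf ?gt_eqF.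
Qed.

Lemma dual_norm_leP (phi : X -> R) (A : R) : 0 <= A ->
  (forall (c : R) k, CMH k -> phi (c *: k) = c * phi k) ->
  (dual_norm gam phi <= A%:E)%E <-> (forall k, CMH k -> `|phi k| <= A * CMn k).
Proof.
move=> A0 phiZ; split => [H k Hk|H]; last first.
  apply: ge_ereal_sup => _ [k [Hk k1] <-]; rewrite lee_fin.
  by apply: le_trans (H k Hk) _; rewrite ler_piMr.
have [->|k0] := eqVneq k 0.
  have [H0 n0] := CM0 gauss.
  by have := phiZ 0 0 H0; rewrite scale0r mul0r => ->; rewrite n0 mulr0 normr0.
have [n0 H1 H2] := unit_scaling Hk k0.
have : (`|phi ((CMn k)^-1 *: k)|%:E <= A%:E)%E.
  by apply: le_trans H; apply: ereal_sup_ubound; exists ((CMn k)^-1 *: k).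
rewrite lee_fin phiZ// normrM ger0_norm ?invr_ge0 ?(ltW n0)//.
by rewrite ler_pdivrMl// mulrC.
Qed.

Lemma bil_norm_leP (B : X -> X -> R) (A : R) : 0 <= A ->
  (forall (c : R) h k, CMH h -> CMH k -> B (c *: h) k = c * B h k) ->
  (forall (c : R) h k, CMH h -> CMH k -> B h (c *: k) = c * B h k) ->
  (bil_norm gam B <= A%:E)%E <->
  (forall h k, CMH h -> CMH k -> `|B h k| <= A * (CMn h * CMn k)).
Proof.
move=> A0 BZl BZr; split => [H h k Hh Hk|H]; last first.
  apply: ge_ereal_sup => _ [[h k] /= [Hh Hk h1 k1] <-]; rewrite lee_fin.
  apply: le_trans (H h k Hh Hk) _; rewrite ler_piMr// mulr_ile1 ?cm_norm_ge0//.
have [H0 n0] := CM0 gauss.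
have [->|h0] := eqVneq h 0.
  by have := BZl 0 0 k H0 Hk; rewrite scale0r mul0r => ->; rewrite n0 mul0r mulr0 normr0.
have [->|k0] := eqVneq k 0.
  by have := BZr 0 h 0 Hh H0; rewrite scale0r mul0r => ->; rewrite n0 !mulr0 normr0.
have [nh h1 h2] := unit_scaling Hh h0.
have [nk k1 k2] := unit_scaling Hk k0.
have : (`|B ((CMn h)^-1 *: h) ((CMn k)^-1 *: k)|%:E <= A%:E)%E.
  by apply: le_trans H; apply: ereal_sup_ubound; exists ((CMn h)^-1 *: h, (CMn k)^-1 *: k).
rewrite lee_fin BZl// BZr// !normrM !normfV (gtr0_norm nh) (gtr0_norm nk).
by rewrite mulrA -invfM ler_pdivrMl ?mulr_gt0// mulrC.
Qed.

Lemma sup_norm_leP (f : X -> R) (A : R) :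
  (sup_norm f <= A%:E)%E <-> (forall x, `|f x| <= A).
Proof.
split => [H x|H]; last by apply: ge_ereal_sup => _ [x _ <-]; rewrite lee_fin.
by rewrite -lee_fin; apply: le_trans H; apply: ereal_sup_ubound; exists x.
Qed.

Lemma ereal_sup_range_leP (T : Type) (F : T -> \bar R) (A : \bar R) :
  (ereal_sup (range F) <= A)%E <-> (forall x, (F x <= A)%E).
Proof.
split => [H x|H]; last by apply: ge_ereal_sup => _ [x _ <-].
by apply: le_trans H; apply: ereal_sup_ubound; exists x.
Qed.

End OperatorNorms.

Section MeanValueUnit.
Context {R : realType}.

Lemma mean_value_unit (F G : R -> R) :
  (forall s (e : R), 0 < e -> exists d : R, 0 < d /\
     forall r, 0 < `|r| < d -> `|F (s + r) - F s - r * G s| <= e * `|r|) ->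
  exists c, 0 < c < 1 /\ F 1 - F 0 = G c.
Proof.
move=> H.
have dF s : is_derive s (1 : R) F (G s) by apply: is_derive_approx => e; exact: H.
have [c /[!in_itv]/= c01 E] := MVT ltr01 (fun s _ => dF s)
  (continuous_subspaceT (fun s => is_derive_continuous (dF s))).
by exists c; split => //; rewrite E subr0 mulr1.
Qed.

End MeanValueUnit.

(** * Uniform estimates from the definition of the class *)

Section EstimatesOfC2aH.
Context {R : realType} {X : normedModType R} (gam : probability (borel_X X) R).
Hypothesis gauss : centered_gaussian gam.
Local Notation CMn := (cm_norm gam).
Local Notation CMH := (CM gam).

(** The definition provides remainders that are only small compared with |h|. The mean value theorem
    along s |-> x + s h turns them into differences of derivatives at nearby points, of order |h|^2
    and |h|^(1+a) with the same constant [A]. *)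
Lemma C2aH_est (a A : R) f Df D2f : 0 < a -> 0 <= A -> C2aH gam a f Df D2f ->
  (sup_norm f <= A%:E)%E ->
  (ereal_sup (range (fun x => dual_norm gam (Df x))) <= A%:E)%E ->
  (ereal_sup (range (fun x => bil_norm gam (D2f x))) <= A%:E)%E ->
  (holder_bil gam a D2f <= A%:E)%E -> C2a_est gam a A f Df D2f.
Proof.
move=> a0 A0 [[[cf _] [linD bilD2] [diff1 diff2] _ [cD cD2]] _].
move=> /sup_norm_leP bf /ereal_sup_range_leP bD /ereal_sup_range_leP bD2 hD2.
have DZ x (c : R) k : CMH k -> Df x (c *: k) = c * Df x k by have [_ H _] := linD x; exact: H.
have DD x h k : CMH h -> CMH k -> Df x (h + k) = Df x h + Df x k.
  by have [H _ _] := linD x; exact: H.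
have D2Zl x (c : R) h k : CMH h -> CMH k -> D2f x (c *: h) k = c * D2f x h k.
  by move=> Hh Hk; have [/(_ k Hk)[_ H _] _ _] := bilD2 x; exact: H.
have D2Dl x h h' k : CMH h -> CMH h' -> CMH k -> D2f x (h + h') k = D2f x h k + D2f x h' k.
  by move=> Hh Hh' Hk; have [/(_ k Hk)[H _ _] _ _] := bilD2 x; exact: H.
have D2Zr x (c : R) h k : CMH h -> CMH k -> D2f x h (c *: k) = c * D2f x h k.
  by move=> Hh Hk; have [_ /(_ h Hh)[_ H _] _] := bilD2 x; exact: H.
have D2Dr x h k k' : CMH h -> CMH k -> CMH k' -> D2f x h (k + k') = D2f x h k + D2f x h k'.
  by move=> Hh Hk Hk'; have [_ /(_ h Hh)[H _ _] _] := bilD2 x; exact: H.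
have D0 x : Df x 0 = 0.
  by have [H0 _] := CM0 gauss; have := DZ x 0 0 H0; rewrite scale0r mul0r.
have D20 x k : CMH k -> D2f x 0 k = 0.
  by move=> Hk; have [H0 _] := CM0 gauss; have := D2Zl x 0 0 k H0 Hk; rewrite scale0r mul0r.
have {}bD x h : CMH h -> `|Df x h| <= A * CMn h.
  by move=> Hh; apply: (proj1 (dual_norm_leP gauss A0 (DZ x)) (bD x)).
have {}bD2 x h k : CMH h -> CMH k -> `|D2f x h k| <= A * (CMn h * CMn k).
  by move=> Hh Hk; apply: (proj1 (bil_norm_leP gauss A0 (D2Zl x) (D2Zr x)) (bD2 x)).
have {}hD2 x j h k : CMH j -> CMH h -> CMH k ->
    `|D2f (x + j) h k - D2f x h k| <= A * CMn j `^ a * (CMn h * CMn k).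
  move=> Hj Hh Hk; have [->|j0] := eqVneq j 0.
    by rewrite addr0 subrr normr0 !mulr_ge0 ?powR_ge0 ?cm_norm_ge0//; have [] := CM0 gauss.
  have n0 : 0 < CMn j `^ a by rewrite powR_gt0// (cm_norm_gt0 gauss).
  have H : (bil_norm gam (fun h k => D2f (x + j) h k - D2f x h k)%R * ((CMn j `^ a)^-1)%:E <= A%:E)%E.
    by apply: le_trans hD2; apply: ereal_sup_ubound; exists (x, j).
  rewrite lee_pdivrMr// -EFinM in H.
  apply: (proj1 (bil_norm_leP gauss _ _ _) H) => //.
  - by rewrite mulr_ge0 ?powR_ge0.
  - by move=> c h' k' Hh' Hk'; rewrite !D2Zl// mulrBr.
  - by move=> c h' k' Hh' Hk'; rewrite !D2Zr// mulrBr.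
have mv1 x h : CMH h -> exists c, 0 < c < 1 /\ f (x + h) - f x = Df (x + c *: h) h.
  move=> Hh; have [->|h0] := eqVneq h 0.
    by exists 2^-1; rewrite addr0 subrr D0; split => //; apply/andP; split; lra.
  have n0 := cm_norm_gt0 gauss Hh h0.
  have [s e e0|c [c01]] := @mean_value_unit R (fun s => f (x + s *: h)) (fun s => Df (x + s *: h) h).
    have [d [d0 dP]] := diff1 (x + s *: h) (e / CMn h) (divr_gt0 e0 n0).
    exists (d / CMn h); split => [|r /andP[r0 rd]]; first exact: divr_gt0.
    have [Hr nr] := CMZ gauss r Hh.
    have := dP (r *: h) Hr; rewrite nr mulr_gt0// -ltr_pdivlMr// rd => /(_ isT).
    rewrite DZ// -(addrA x) -scalerDl => /le_trans; apply.
    by rewrite mulrCA divfK ?gt_eqF// mulrC.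
  by rewrite scale1r scale0r addr0 => E; exists c.
have mv2 x h k : CMH h -> CMH k ->
    exists c, 0 < c < 1 /\ Df (x + h) k - Df x k = D2f (x + c *: h) h k.
  move=> Hh Hk; have [->|h0] := eqVneq h 0.
    by exists 2^-1; rewrite addr0 subrr D20//; split => //; apply/andP; split; lra.
  have n0 := cm_norm_gt0 gauss Hh h0; have nk := cm_norm_ge0 gauss Hk.
  have [s e e0|c [c01]] := @mean_value_unit R (fun s => Df (x + s *: h) k) (fun s => D2f (x + s *: h) h k).
    (* The operator-norm estimate is evaluated at the fixed [k], whose norm may vanish, hence the 1
       in the denominator. *)
    have nk1 : 0 < CMn k + 1 by rewrite ltr_wpDl.
    have e1 : 0 < e / (CMn h * (CMn k + 1)) by rewrite divr_gt0// mulr_gt0.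
    have [d [d0 dP]] := diff2 (x + s *: h) _ e1.
    exists (d / CMn h); split => [|r /andP[r0 rd]]; first exact: divr_gt0.
    have [Hr nr] := CMZ gauss r Hh.
    have := dP (r *: h) Hr; rewrite nr mulr_gt0// -ltr_pdivlMr// rd => /(_ isT) H.
    have [||H1 _] := dual_norm_leP gauss (A := e / (CMn h * (CMn k + 1)) * (`|r| * CMn h))
      (phi := fun k => Df (x + s *: h + r *: h) k - Df (x + s *: h) k - D2f (x + s *: h) (r *: h) k).
    - by apply: mulr_ge0; [exact: ltW|apply: mulr_ge0 => //; exact: ltW].
    - by move=> c k' Hk'; rewrite !DZ// D2Zr// !mulrBr.
    have := H1 H k Hk; rewrite D2Zl// -(addrA x) -scalerDl => /le_trans; apply.
    rewrite [leLHS](_ : _ = e * `|r| * (CMn k / (CMn k + 1))); last by field; rewrite !gt_eqF.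
    by rewrite ler_piMr ?mulr_ge0 ?(ltW e0)// ler_pdivrMr// mul1r lerDl.
  by rewrite scale1r scale0r addr0 => E; exists c.
split => //.
- by move=> x c h k Hh Hk; have [Hch _] := CMZ gauss c Hh; rewrite DD// DZ.
- by move=> x c h h' k Hh Hh' Hk; have [Hch _] := CMZ gauss c Hh; rewrite D2Dl// D2Zl.
- by move=> x c h k k' Hh Hk Hk'; have [Hck _] := CMZ gauss c Hk; rewrite D2Dr// D2Zr.
- move=> x h Hh; have [c [/andP[c0 c1] ->]] := mv1 x h Hh.
  have [Hch nch] := CMZ gauss c Hh.
  have [d [d01 ->]] := mv2 x _ h Hch Hh.
  apply: le_trans (bD2 _ _ _ Hch Hh) _; rewrite nch (gtr0_norm c0).
  rewrite ler_wpM2l// ler_wpM2r ?cm_norm_ge0// ler_piMl ?cm_norm_ge0//.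
  exact: ltW.
- move=> x h k Hh Hk; have [c [/andP[c0 c1] ->]] := mv2 x h k Hh Hk.
  have [Hch nch] := CMZ gauss c Hh.
  apply: le_trans (hD2 _ _ _ _ Hch Hh Hk) _; rewrite nch (gtr0_norm c0).
  rewrite ler_wpM2r ?mulr_ge0 ?cm_norm_ge0// ler_wpM2l//.
  apply: ge0_ler_powR; rewrite ?nnegrE ?mulr_ge0 ?cm_norm_ge0 ?(ltW a0) ?(ltW c0)//.
  by rewrite ler_piMl ?cm_norm_ge0// ltW.
- move=> x e e0; have [d [d0 dP]] := cD x e e0; exists d; split => // y yx h Hh.
  apply: (proj1 (dual_norm_leP gauss (ltW e0) _) (dP y yx)) => //.
  by move=> c k Hk; rewrite !DZ// mulrBr.
- move=> x e e0; have [d [d0 dP]] := cD2 x e e0; exists d; split => // y yx h k Hh Hk.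
  apply: (proj1 (bil_norm_leP gauss (ltW e0) _ _) (dP y yx)) => //.
    by move=> c h' k' Hh' Hk'; rewrite !D2Zl// mulrBr.
  by move=> c h' k' Hh' Hk'; rewrite !D2Zr// mulrBr.
Qed.

End EstimatesOfC2aH.

(** * The semigroup on functions with Hoelder second derivative *)

Section OrnsteinUhlenbeckOfC2a.
Context {R : realType} {X : normedModType R} (gam : probability (borel_X X) R).
Hypothesis gauss : centered_gaussian gam.
Local Notation CMn := (cm_norm gam).
Local Notation CMH := (CM gam).
Local Notation E := (expect gam).

Let bmeasurable_affine (G : X -> R) (u v : R) x :
  (forall x (e : R), 0 < e -> exists d : R, 0 < d /\ forall y, `|y - x| < d -> `|G y - G x| <= e) ->
  bmeasurable (fun z => G (u *: x + v *: z)).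
Proof.
move=> cG; apply: continuous_bmeasurable => z.
have cG' : continuous G.
  move=> y; apply/cvgrPdist_le => e e0; have [d [d0 dP]] := cG y e e0.
  apply/nbhs_ballP; exists d => //= y'; rewrite -ball_normE/= distrC => yy'.
  by rewrite distrC; exact: dP.
apply: (@continuous_comp _ _ _ (fun z => u *: x + v *: z) G); last exact: cG'.
by apply: cvgD; [exact: cvg_cst|exact: scaler_continuous].
Qed.

(** The radius of equicontinuity of [Phi] depends on the integration variable, so uniformity in [j]
    is proved by contradiction. Offending points [y n] tending to [x] and offending indices [j n]
    give normalised differences that are bounded and tend to 0 pointwise; their expectations would
    then tend to 0 as well. *)
Lemma expect_equicontinuous (J : Type) (P : J -> Prop) (w : J -> R) (Phi : X -> J -> R) (A u v : R) :
  0 <= A -> (forall j, P j -> 0 <= w j) -> (forall x j, P j -> `|Phi x j| <= A * w j) ->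
  (forall x (e : R), 0 < e -> exists d : R, 0 < d /\ forall y, `|y - x| < d ->
     forall j, P j -> `|Phi y j - Phi x j| <= e * w j) ->
  (forall x j, P j -> bmeasurable (fun z => Phi (u *: x + v *: z) j)) /\
  (forall x (e : R), 0 < e -> exists d : R, 0 < d /\ forall y, `|y - x| < d ->
     forall j, P j ->
     `|E (fun z => Phi (u *: y + v *: z) j) - E (fun z => Phi (u *: x + v *: z) j)| <= e * w j).
Proof.
move=> A0 w0 bPhi cPhi.
have mPhi x j : P j -> bmeasurable (fun z => Phi (u *: x + v *: z) j).
  move=> Pj; apply: (bmeasurable_affine (G := Phi ^~ j)) => y e e0.
  have w1 : 0 < w j + 1 by rewrite ltr_wpDl ?w0.
  have [d [d0 dP]] := cPhi y _ (divr_gt0 e0 w1); exists d; split => // y' yy'.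
  apply: le_trans (dP y' yy' j Pj) _; rewrite mulrAC ler_pdivrMr// ler_wpM2l ?(ltW e0)//.
  by rewrite lerDl.
split => // x e e0; apply: contrapT => H.
have [n|y yP] := @choice nat X (fun n y => `|y - x| < n.+1%:R^-1 /\ exists j, P j /\
    e * w j < `|E (fun z => Phi (u *: y + v *: z) j) - E (fun z => Phi (u *: x + v *: z) j)|).
  apply: contrapT => Hn; apply: H; exists n.+1%:R^-1; split => // y yx j Pj.
  rewrite leNgt; apply/negP => lt; apply: Hn; exists y; split => //.
  by exists j.
have [n|j jP] := @choice nat J (fun n j => P j /\
    e * w j < `|E (fun z => Phi (u *: y n + v *: z) j) - E (fun z => Phi (u *: x + v *: z) j)|).
  by have [_] := yP n.
(* A weight may vanish: then [invr0] makes [F n] zero, and the contradiction comes instead from the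
   difference itself being 0. *)
pose F n z := (w (j n))^-1 * (Phi (u *: y n + v *: z) (j n) - Phi (u *: x + v *: z) (j n)).
have wF n z (B : R) : 0 <= B -> `|Phi (u *: y n + v *: z) (j n) - Phi (u *: x + v *: z) (j n)| <= B * w (j n) ->
    `|F n z| <= B.
  move=> B0; have [Pj _] := jP n; rewrite /F normrM normfV (ger0_norm (w0 _ Pj)) => le.
  have := w0 _ Pj; rewrite le_eqVlt => /predU1P[<-|wp]; first by rewrite invr0 mul0r.
  by rewrite ler_pdivrMl// mulrC.
have bD n z : `|Phi (u *: y n + v *: z) (j n) - Phi (u *: x + v *: z) (j n)| <= 2 * A * w (j n).
  have [Pj _] := jP n; apply: le_trans (ler_normB _ _) _.
  by rewrite -mulrA mulr2n mulrDl mul1r lerD ?bPhi.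
have mD n : bmeasurable (fun z => Phi (u *: y n + v *: z) (j n) - Phi (u *: x + v *: z) (j n)).
  by have [Pj _] := jP n; apply: measurable_funB; exact: mPhi.
have mF n : bmeasurable (F n) by apply: measurable_funM => //; exact: mD.
have cF z : F n z @[n --> \oo] --> (0 : R).
  apply/cvgrPdist_le => e' e'0.
  have [d [d0 dP]] := cPhi (u *: x + v *: z) e' e'0.
  have cy : (fun n => `|u| * n.+1%:R^-1) @ \oo --> `|u| * 0.
    by apply: cvgMl_tmp; exact: cvg_harmonic.
  rewrite mulr0 in cy.
  have : \forall n \near \oo, `|u| * n.+1%:R^-1 < d by exact: (cvgr_lt _ cy).
  apply: filterS => n nd; rewrite sub0r normrN; apply: wF; first exact: ltW.
  have [Pj _] := jP n; apply: dP => //.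
  rewrite [X in `|X|](_ : _ = u *: (y n - x)); last by rewrite opprD addrACA subrr addr0 scalerBr.
  rewrite normrZ; apply: le_lt_trans nd; rewrite ler_wpM2l//.
  by have [/ltW] := yP n.
have := expect_cvg (gam := gam) mF (fun n z => wF n z _ (mulr_ge0 (ler0n _ 2) A0) (bD n z)) cF.
rewrite expect_cst => /cvgrPdist_lt /(_ e e0) [N _ /(_ N (leqnn _)) /=].
have [Pj lt] := jP N; rewrite sub0r normrN /F.
rewrite (@expectZ _ _ gam _ (fun z => Phi (u *: y N + v *: z) (j N) - Phi (u *: x + v *: z) (j N))); last first.
  exact: (bounded_eintegrable gam (mD N) (bD N)).
have iPhi x' : eintegrable gam (fun z => Phi (u *: x' + v *: z) (j N)).
  by apply: (@bounded_eintegrable _ _ gam _ (A * w (j N)) (mPhi x' _ Pj)) => z; exact: bPhi.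
rewrite (expectB (iPhi (y N)) (iPhi x)) normrM normfV (ger0_norm (w0 _ Pj)).
have := w0 _ Pj; rewrite le_eqVlt => /predU1P[w00|wp]; last first.
  by rewrite ltr_pdivrMl// mulrC => /(lt_trans lt); rewrite ltxx.
have := bD N; rewrite -w00 mulr0 => D0; move: lt; rewrite -w00 mulr0 -(expectB (iPhi (y N)) (iPhi x)).
by move=> /lt_le_trans /(_ (norm_expect_le gam (mD N) D0)); rewrite ltxx.
Qed.

Section Estimates.
Variables (a A t : R) (f : X -> R) (Df : X -> X -> R) (D2f : X -> X -> X -> R).
Hypotheses (a0 : 0 < a) (t0 : 0 <= t) (est : C2a_est gam a A f Df D2f).
Let c := expR (- t).
Let v := ou_std t.

Definition OU_D x h := c * E (fun z => Df (c *: x + v *: z) h).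
Definition OU_D2 x h k := c ^+ 2 * E (fun z => D2f (c *: x + v *: z) h k).

Let c0 : 0 < c. Proof. exact: expR_gt0. Qed.
Let c1 : c <= 1. Proof. by rewrite -expR0 ler_expR oppr_le0. Qed.
Let A0 : 0 <= A := est_ge0 est.
Let N0 h : CMH h -> 0 <= CMn h. Proof. exact: cm_norm_ge0. Qed.

Let DZ := est_DZ gauss est.
Let D2Z := est_D2Zl gauss est.

Let shift (x h z : X) : c *: (x + h) + v *: z = c *: x + v *: z + c *: h.
Proof. by rewrite scalerDr addrAC. Qed.

Let scale_le h : CMH h -> [/\ CMH (c *: h), CMn (c *: h) = c * CMn h & c * CMn h <= CMn h].
Proof.
move=> Hh; have [H1 H2] := CMZ gauss c Hh; rewrite (gtr0_norm c0) in H2; split => //.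
by rewrite ler_piMl ?N0.
Qed.

Let contraction (z B : R) : 0 <= B -> `|z| <= B -> `|c * z| <= B.
Proof.
by move=> B0 zB; rewrite normrM (gtr0_norm c0); apply: le_trans zB; rewrite ler_piMl.
Qed.

Let powR_scale_le h : CMH h -> (c * CMn h) `^ a <= CMn h `^ a.
Proof.
move=> Hh; have [_ _ H] := scale_le Hh.
by apply: ge0_ler_powR; rewrite ?nnegrE ?mulr_ge0 ?N0 ?(ltW a0) ?(ltW c0).
Qed.

Let mD x h : CMH h -> bmeasurable (fun z => Df (c *: x + v *: z) h).
Proof.
by have [H _] := expect_equicontinuous c v A0 N0 (est_D_bound est) (est_D_continuous est); exact: H.
Qed.

Let P2 (p : X * X) := CMH p.1 /\ CMH p.2.
Let w2 (p : X * X) := CMn p.1 * CMn p.2.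
Let D2_equicontinuous := @expect_equicontinuous (X * X) P2 w2 (fun x p => D2f x p.1 p.2) A c v A0
  (fun p (Hp : P2 p) => mulr_ge0 (N0 Hp.1) (N0 Hp.2))
  (fun x p (Hp : P2 p) => est_D2_bound est x Hp.1 Hp.2)
  (fun x e e0 => let: ex_intro d (conj d0 dP) := est_D2_continuous est x e0 in
     ex_intro _ d (conj d0 (fun y yx p (Hp : P2 p) => dP y yx p.1 p.2 Hp.1 Hp.2))).

Let mD2 x h k : CMH h -> CMH k -> bmeasurable (fun z => D2f (c *: x + v *: z) h k).
Proof. by move=> Hh Hk; have [H _] := D2_equicontinuous; exact: (H x (h, k) (conj Hh Hk)). Qed.

Let mf x : bmeasurable (fun z => f (c *: x + v *: z)).
Proof.
apply: bmeasurable_affine => y e e0.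
have /cvgrPdist_le /(_ e e0) /nbhs_ballP[d /= d0 dP] := @est_continuous _ _ _ _ _ _ _ _ est y.
exists d; split => // y' yy'; rewrite distrC; apply: dP.
by rewrite -ball_normE/= distrC.
Qed.

Let iD x h : CMH h -> eintegrable gam (fun z => Df (c *: x + v *: z) h).
Proof. by move=> Hh; apply: (bounded_eintegrable gam (mD x Hh)) => z; exact: (est_D_bound est _ Hh). Qed.

Let iD2 x h k : CMH h -> CMH k -> eintegrable gam (fun z => D2f (c *: x + v *: z) h k).
Proof.
by move=> Hh Hk; apply: (bounded_eintegrable gam (mD2 x Hh Hk)) => z; exact: (est_D2_bound est _ Hh Hk).
Qed.

Let iF x : eintegrable gam (fun z => f (c *: x + v *: z)).
Proof. by apply: (bounded_eintegrable gam (mf x)) => z; exact: (est_bound est). Qed.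

(** A step [h] in [x] is a step of e^(-t) h inside the expectation, so each estimate for [f] applies
    pointwise, and e^(-t) <= 1 keeps the constant [A]. *)
Lemma OU_est : continuous (OU gam t f) -> C2a_est gam a A (OU gam t f) OU_D OU_D2.
Proof.
move=> cOU; split => //.
- move=> x; apply: (norm_expect_le gam (mf x)) => z; exact: (est_bound est).
- move=> x b h k Hh Hk; rewrite /OU_D mulrCA -mulrDr -(expectZ b (iD x Hh)).
  rewrite -(expectD (eintegrableZ b (iD x Hh)) (iD x Hk)).
  congr (_ * E _); apply/funext => z; exact: (est_D_linear est).
- move=> x h Hh; apply: contraction; first by rewrite mulr_ge0 ?N0.
  by apply: (norm_expect_le gam (mD x Hh)) => z; exact: (est_D_bound est).
- move=> x b h h' k Hh Hh' Hk; rewrite /OU_D2 mulrCA -mulrDr -(expectZ b (iD2 x Hh Hk)).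
  rewrite -(expectD (eintegrableZ b (iD2 x Hh Hk)) (iD2 x Hh' Hk)).
  congr (_ * E _); apply/funext => z; exact: (est_D2_linearl est).
- move=> x b h k k' Hh Hk Hk'; rewrite /OU_D2 mulrCA -mulrDr -(expectZ b (iD2 x Hh Hk)).
  rewrite -(expectD (eintegrableZ b (iD2 x Hh Hk)) (iD2 x Hh Hk')).
  congr (_ * E _); apply/funext => z; exact: (est_D2_linearr est).
- move=> x h k Hh Hk; have B0 : 0 <= A * (CMn h * CMn k) by rewrite !mulr_ge0 ?N0.
  rewrite /OU_D2 expr2 -mulrA; apply: contraction => //; apply: contraction => //.
  by apply: (norm_expect_le gam (mD2 x Hh Hk)) => z; exact: (est_D2_bound est).
- move=> x h Hh; have [Hch nch le] := scale_le Hh.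
  rewrite /OU_D -(expectZ c (iD x Hh)) -(expectB (iF (x + h)) (iF x)).
  rewrite -(expectB (eintegrableB (iF (x + h)) (iF x)) (eintegrableZ c (iD x Hh))).
  apply: (norm_expect_le gam).
    apply: measurable_funB; first exact: (measurable_funB (mf (x + h)) (mf x)).
    by apply: measurable_funM => //; exact: mD.
  move=> z; rewrite shift -DZ//; apply: le_trans (est_remainder0 est _ Hch) _.
  by rewrite nch ler_wpM2l// ler_pM// mulr_ge0 ?N0// ltW.
- move=> x h k Hh Hk; have [Hch nch le] := scale_le Hh.
  have B0 : 0 <= A * CMn h `^ a * (CMn h * CMn k) by rewrite !mulr_ge0 ?N0 ?powR_ge0.
  rewrite /OU_D /OU_D2 expr2 -mulrA -!mulrBr; apply: contraction => //.
  rewrite -(expectZ c (iD2 x Hh Hk)) -(expectB (iD (x + h) Hk) (iD x Hk)).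
  rewrite -(expectB (eintegrableB (iD (x + h) Hk) (iD x Hk)) (eintegrableZ c (iD2 x Hh Hk))).
  apply: (norm_expect_le gam).
    apply: measurable_funB; first exact: (measurable_funB (mD (x + h) Hk) (mD x Hk)).
    by apply: measurable_funM => //; exact: mD2.
  move=> z; rewrite shift -D2Z//; apply: le_trans (est_remainder1 est _ Hch Hk) _.
  rewrite nch; apply: ler_pM.
  + by rewrite mulr_ge0 ?powR_ge0.
  + by rewrite !mulr_ge0 ?N0// ltW.
  + by rewrite ler_wpM2l// powR_scale_le.
  + by rewrite ler_wpM2r ?N0.
- move=> x j h k Hj Hh Hk; have [Hcj ncj le] := scale_le Hj.
  have B0 : 0 <= A * CMn j `^ a * (CMn h * CMn k) by rewrite !mulr_ge0 ?N0 ?powR_ge0.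
  rewrite /OU_D2 -mulrBr expr2 -(mulrA c c).
  apply: (contraction B0); apply: (contraction B0).
  rewrite -(expectB (iD2 (x + j) Hh Hk) (iD2 x Hh Hk)); apply: (norm_expect_le gam).
    exact: (measurable_funB (mD2 (x + j) Hh Hk) (mD2 x Hh Hk)).
  move=> z; rewrite shift; apply: le_trans (est_holder est _ Hcj Hh Hk) _.
  by rewrite ncj ler_wpM2r ?mulr_ge0 ?N0// ler_wpM2l// powR_scale_le.
- move=> x e e0.
  have [_ /(_ x e e0)[d [d0 dP]]] := expect_equicontinuous c v A0 N0 (est_D_bound est) (est_D_continuous est).
  exists d; split => // y yx h Hh; rewrite /OU_D -mulrBr; apply: contraction; last exact: dP.
  by rewrite mulr_ge0 ?N0// ltW.
- move=> x e e0; have [_ /(_ x e e0)[d [d0 dP]]] := D2_equicontinuous.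
  exists d; split => // y yx h k Hh Hk; rewrite /OU_D2 -mulrBr expr2 -mulrA.
  have B0 : 0 <= e * (CMn h * CMn k) by rewrite !mulr_ge0 ?N0// ltW.
  apply: contraction => //; apply: contraction => //; exact: (dP y yx (h, k) (conj Hh Hk)).
Qed.

End Estimates.

Lemma OU_joint_cvg (f : X -> R) (M : R) (u : nat -> R) (z : nat -> X) (t : R) x :
  continuous f -> (forall x, `|f x| <= M) -> u n @[n --> \oo] --> t -> z n @[n --> \oo] --> x ->
  OU gam (u n) f (z n) @[n --> \oo] --> OU gam t f x.
Proof.
move=> cf bf ut zx.
have arg (y : X) : expR (- u n) *: z n + ou_std (u n) *: y @[n --> \oo] --> expR (- t) *: x + ou_std t *: y.
  have e1 : expR (- u n) @[n --> \oo] --> expR (- t) by exact: (cvg_comp _ _ ut (@continuous_expRN R t)).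
  have e2 : ou_std (u n) @[n --> \oo] --> ou_std t by exact: (cvg_comp _ _ ut (@continuous_ou_std R t)).
  by apply: cvgD; [exact: cvgZ|exact: cvgZr_tmp].
apply: (@expect_cvg _ _ gam (fun n y => f (expR (- u n) *: z n + ou_std (u n) *: y))
  (fun y => f (expR (- t) *: x + ou_std t *: y)) M) => [n|n y|y].
- apply: continuous_bmeasurable => y.
  apply: (@continuous_comp _ _ _ (fun y => expR (- u n) *: z n + ou_std (u n) *: y) f); last exact: cf.
  by apply: cvgD; [exact: cvg_cst|exact: scaler_continuous].
- exact: bf.
- exact: (cvg_comp _ _ (arg y) (cf _)).
Qed.

End OrnsteinUhlenbeckOfC2a.

(** * The mild solution *)

Section C2aEstimates.
Context {R : realType} {X : normedModType R} (gam : probability (borel_X X) R).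
Hypothesis gauss : centered_gaussian gam.
Local Notation CMn := (cm_norm gam).
Local Notation CMH := (CM gam).

Let N0 h : CMH h -> 0 <= CMn h. Proof. exact: cm_norm_ge0. Qed.

Lemma C2a_estD (a A B : R) f Df D2f g Dg D2g :
  C2a_est gam a A f Df D2f -> C2a_est gam a B g Dg D2g ->
  C2a_est gam a (A + B) (fun x => f x + g x) (fun x h => Df x h + Dg x h)
    (fun x h k => D2f x h k + D2g x h k).
Proof.
move=> ef eg; split.
- by move=> x; apply: le_trans (ler_normD _ _) _; rewrite lerD ?(est_bound ef) ?(est_bound eg).
- by move=> x; apply: cvgD; [exact: (est_continuous ef)|exact: (est_continuous eg)].
- move=> x c h k Hh Hk; rewrite (est_D_linear ef x c Hh Hk) (est_D_linear eg x c Hh Hk).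
  by rewrite mulrDr addrACA.
- move=> x h Hh; apply: le_trans (ler_normD _ _) _.
  by rewrite mulrDl lerD// ?(est_D_bound ef)// (est_D_bound eg).
- move=> x c h h' k Hh Hh' Hk.
  rewrite (est_D2_linearl ef x c Hh Hh' Hk) (est_D2_linearl eg x c Hh Hh' Hk).
  by rewrite mulrDr addrACA.
- move=> x c h k k' Hh Hk Hk'.
  rewrite (est_D2_linearr ef x c Hh Hk Hk') (est_D2_linearr eg x c Hh Hk Hk').
  by rewrite mulrDr addrACA.
- move=> x h k Hh Hk; apply: le_trans (ler_normD _ _) _.
  by rewrite mulrDl lerD// ?(est_D2_bound ef)// (est_D2_bound eg).
- move=> x h Hh; rewrite [X in `|X|](_ : _ = (f (x + h) - f x - Df x h) + (g (x + h) - g x - Dg x h)); last by ring.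
  apply: le_trans (ler_normD _ _) _.
  by rewrite mulrDl lerD// ?(est_remainder0 ef)// (est_remainder0 eg).
- move=> x h k Hh Hk; rewrite [X in `|X|](_ : _ = (Df (x + h) k - Df x k - D2f x h k) +
    (Dg (x + h) k - Dg x k - D2g x h k)); last by ring.
  apply: le_trans (ler_normD _ _) _.
  by rewrite !mulrDl lerD// ?(est_remainder1 ef)// (est_remainder1 eg).
- move=> x j h k Hj Hh Hk; rewrite [X in `|X|](_ : _ = (D2f (x + j) h k - D2f x h k) +
    (D2g (x + j) h k - D2g x h k)); last by ring.
  apply: le_trans (ler_normD _ _) _.
  by rewrite !mulrDl lerD// ?(est_holder ef)// (est_holder eg).
- move=> x e e0; have e2 : 0 < e / 2 by rewrite divr_gt0.
  have [d [d0 dP]] := est_D_continuous ef x e2; have [d' [d'0 dP']] := est_D_continuous eg x e2.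
  exists (Num.min d d'); split; first by rewrite lt_min d0.
  move=> y; rewrite lt_min => /andP[yd yd'] h Hh.
  rewrite [X in `|X|](_ : _ = (Df y h - Df x h) + (Dg y h - Dg x h)); last by ring.
  apply: le_trans (ler_normD _ _) _.
  by rewrite (splitr e) mulrDl lerD ?dP ?dP'.
- move=> x e e0; have e2 : 0 < e / 2 by rewrite divr_gt0.
  have [d [d0 dP]] := est_D2_continuous ef x e2; have [d' [d'0 dP']] := est_D2_continuous eg x e2.
  exists (Num.min d d'); split; first by rewrite lt_min d0.
  move=> y; rewrite lt_min => /andP[yd yd'] h k Hh Hk.
  rewrite [X in `|X|](_ : _ = (D2f y h k - D2f x h k) + (D2g y h k - D2g x h k)); last by ring.
  apply: le_trans (ler_normD _ _) _.
  by rewrite (splitr e) mulrDl lerD ?dP ?dP'.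
Qed.

Section Norms.
Variables (a A : R) (f : X -> R) (Df : X -> X -> R) (D2f : X -> X -> X -> R).
Hypotheses (a0 : 0 < a) (est : C2a_est gam a A f Df D2f).

Let A0 : 0 <= A := est_ge0 est.

Let DZ := est_DZ gauss est.
Let D2Zl := est_D2Zl gauss est.
Let D2Zr := est_D2Zr gauss est.

Let sup_norm_le : (sup_norm f <= A%:E)%E.
Proof. by apply/sup_norm_leP => x; exact: (est_bound est). Qed.

Let dual_le x : (dual_norm gam (Df x) <= A%:E)%E.
Proof. by apply/(dual_norm_leP gauss A0 (DZ x)) => k; exact: (est_D_bound est). Qed.

Let bil_le x : (bil_norm gam (D2f x) <= A%:E)%E.
Proof. by apply/(bil_norm_leP gauss A0 (D2Zl x) (D2Zr x)) => h k; exact: (est_D2_bound est). Qed.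

Let holder_bil_le : (holder_bil gam a D2f <= A%:E)%E.
Proof.
apply: ge_ereal_sup => _ [[x j] /= [Hj j0] <-].
have n0 : 0 < CMn j `^ a by rewrite powR_gt0// (cm_norm_gt0 gauss).
rewrite lee_pdivrMr// -EFinM.
apply/(bil_norm_leP gauss).
- by rewrite mulr_ge0 ?powR_ge0.
- by move=> c h' k' Hh' Hk'; rewrite !D2Zl// mulrBr.
- by move=> c h' k' Hh' Hk'; rewrite !D2Zr// mulrBr.
- by move=> h k Hh Hk; exact: (est_holder est).
Qed.

Lemma C2a_est_C2aH : C2aH gam a f Df D2f.
Proof.
have H1 h k x : CMH h -> CMH k -> Df x (h + k) = Df x h + Df x k.
  by move=> Hh Hk; have := est_D_linear est x 1 Hh Hk; rewrite scale1r mul1r.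
split; last by apply: le_lt_trans holder_bil_le _; rewrite ltry.
split.
- by split; [exact: (est_continuous est)|exists A; exact: (est_bound est)].
- split=> x.
    split => [h k Hh Hk|b h Hh|]; [exact: H1|exact: DZ|].
    by apply: le_lt_trans (dual_le x) _; rewrite ltry.
  split => [k Hk|h Hh|].
  + split => [h h' Hh Hh'|b h Hh|].
    * by have := est_D2_linearl est x 1 Hh Hh' Hk; rewrite scale1r mul1r.
    * exact: D2Zl.
    * apply: (@le_lt_trans _ _ (A * CMn k)%:E); last by rewrite ltry.
      apply/(dual_norm_leP gauss); first by rewrite mulr_ge0 ?N0.
        by move=> c h Hh; exact: D2Zl.
      by move=> h Hh; rewrite -mulrA [CMn k * _]mulrC; exact: (est_D2_bound est).
  + split => [k k' Hk Hk'|b k Hk|].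
    * by have := est_D2_linearr est x 1 Hh Hk Hk'; rewrite scale1r mul1r.
    * exact: D2Zr.
    * apply: (@le_lt_trans _ _ (A * CMn h)%:E); last by rewrite ltry.
      apply/(dual_norm_leP gauss); first by rewrite mulr_ge0 ?N0.
        by move=> c k Hk; exact: D2Zr.
      by move=> k Hk; rewrite -mulrA; exact: (est_D2_bound est).
  + by apply: le_lt_trans (bil_le x) _; rewrite ltry.
- have A1 : 0 < A + 1 by rewrite ltr_wpDl.
  split=> x e e0.
    exists (e / (A + 1)); split; first exact: divr_gt0.
    move=> h Hh /andP[h0]; rewrite ltr_pdivlMr// => hd.
    apply: le_trans (est_remainder0 est x Hh) _; rewrite mulrA ler_wpM2r ?N0//.
    by apply: le_trans (ltW hd); rewrite mulrC ler_wpM2l ?N0// lerDl.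
  have d0 : 0 < e / (A + 1) by rewrite divr_gt0.
  (* Below this radius |h|^a is at most e / (A + 1), which the remainder of order |h|^(1+a) with
     constant [A] requires. *)
  exists ((e / (A + 1)) `^ a^-1); split; first by rewrite powR_gt0.
  move=> h Hh /andP[h0 hd].
  apply/(dual_norm_leP gauss).
  + by rewrite mulr_ge0 ?N0// ltW.
  + by move=> c k Hk; rewrite !DZ// D2Zr// !mulrBr.
  + move=> k Hk; apply: le_trans (est_remainder1 est x Hh Hk) _.
    rewrite -(mulrA e) ler_wpM2r ?mulr_ge0 ?N0//.
    have : CMn h `^ a <= e / (A + 1).
      rewrite -[leRHS]powRr1 ?(ltW d0)// -[X in _ <= _ `^ X](mulVf (lt0r_neq0 a0)) powRrM.
      by apply: ge0_ler_powR; rewrite ?nnegrE ?powR_ge0 ?N0 ?(ltW a0) ?(ltW hd).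
    rewrite ler_pdivlMr// mulrC; apply: le_trans.
    by rewrite ler_wpM2r ?powR_ge0// lerDl.
- split; apply: (@le_lt_trans _ _ A%:E); rewrite ?ltry//; exact/ereal_sup_range_leP.
- split=> x e e0.
    have [d [d0 dP]] := est_D_continuous est x e0; exists d; split => // y yx.
    apply/(dual_norm_leP gauss (ltW e0)); last by move=> k Hk; exact: dP.
    by move=> c k Hk; rewrite !DZ// mulrBr.
  have [d [d0 dP]] := est_D2_continuous est x e0; exists d; split => // y yx.
  apply/(bil_norm_leP gauss (ltW e0)); last by move=> h k Hh Hk; exact: dP.
    by move=> c h' k' Hh' Hk'; rewrite !D2Zl// mulrBr.
  by move=> c h' k' Hh' Hk'; rewrite !D2Zr// mulrBr.
Qed.

Lemma C2a_est_norm_le : (C2aH_norm gam a f Df D2f <= (4 * A)%:E)%E.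
Proof.
rewrite (_ : 4 * A = A + A + A + A); last by ring.
rewrite !EFinD; apply: leeD => //; apply: leeD; first apply: leeD => //.
  by apply/ereal_sup_range_leP.
by apply/ereal_sup_range_leP.
Qed.

End Norms.
End C2aEstimates.

Section MildSolution.
Context {R : realType} {X : normedModType R} (gam : probability (borel_X X) R).
Hypotheses (sepX : separable_space X) (gauss : centered_gaussian gam).
Local Notation CMn := (cm_norm gam).
Local Notation CMH := (CM gam).

Variables (T a : R).
Hypotheses (T0 : 0 < T) (a01 : 0 < a < 1).

Let a0 : 0 < a. Proof. by case/andP: a01. Qed.

(** The sum of the three time integrals bounding the first derivative, the second derivative and its
    Hoelder increments. *)
Definition schauder_constant : R :=
  (2 * T) `^ ((a + 1) / 2) / (a + 1) + (2 * T) `^ (a / 2) / a + (2 / a + (1 - a)^-1).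

Lemma schauder_constant_ge0 : 0 <= schauder_constant.
Proof.
case/andP: a01 => _ a1.
by rewrite !addr_ge0// ?divr_ge0 ?powR_ge0 ?invr_ge0 ?subr_ge0 ?addr_ge0 ?(ltW a0) ?(ltW a1).
Qed.

Variables (A B : R) (f : X -> R) (Df : X -> X -> R) (D2f : X -> X -> X -> R) (g : R -> X -> R).
Hypotheses (fest : C2a_est gam a A f Df D2f) (B0 : 0 <= B)
  (gTX : Cb_TX T g) (gb : forall t x, 0 <= t <= T -> `|g t x| <= B)
  (gc : forall t, 0 <= t <= T -> continuous (g t))
  (gh : forall t, 0 <= t <= T -> (holder_H gam a (g t) <= B%:E)%E).

Let gcyl t : 0 <= t <= T -> cyl (g t).
Proof. by move=> tT; apply: (cyl_continuous sepX (M := B)); [exact: gc|move=> x; exact: gb]. Qed.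

Let gholder t : 0 <= t <= T -> holder_along gam a B (g t).
Proof.
move=> tT x k Hk; have [->|k0] := eqVneq k 0.
  by rewrite addr0 subrr normr0 mulr_ge0 ?powR_ge0.
have n0 : 0 < CMn k `^ a by rewrite powR_gt0// (cm_norm_gt0 gauss).
rewrite -ler_pdivrMr// -lee_fin; apply: le_trans (gh tT); apply: ereal_sup_ubound.
by exists (x, k).
Qed.

Let gjoint (u : nat -> R) (z : nat -> X) (s : R) x : (forall n, 0 <= u n <= T) -> 0 <= s <= T ->
  u n @[n --> \oo] --> s -> z n @[n --> \oo] --> x -> g (u n) (z n) @[n --> \oo] --> g s x.
Proof.
move=> uT sT us zx; have [/subspace_continuousP cg _] := gTX.
apply: (@within_seq_cvg _ (R * X)%type ([set` `[0, T]] `*` [set: X]) (fun p => g p.1 p.2) (s, x)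
  (fun n => (u n, z n))).
- by apply: cg; split => //=; rewrite in_itv.
- by move=> n; split => //=; rewrite in_itv/=; exact: uT.
- exact: (cvg_pair us zx).
Qed.

Let V := mild_derivs gam g.

(** The closed interval of [mild_sol] and the half-open one of [mild_derivs] differ by the null set
    containing the end point. *)
Let mild_solE t x : 0 <= t <= T -> mild_sol gam f g t x = OU gam t f x + V t x [::].
Proof.
move=> /andP[t0 tT]; rewrite /mild_sol /V /mild_derivs; congr (_ + _).
have -> : (fun s => OU gam (t - s) (g s) x) = (fun s => ou_derivs gam (t - s) (g s) x [::]).
  by apply/funext => s; rewrite ou_derivs0.
rewrite /Rintegral -integral_itv_bndo_bndc//.
apply/measurable_EFinP; exact: (measurable_ou_derivs gauss gcyl gb gjoint x tT (hs := [::]) Logic.I).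
Qed.

Definition mild_D t x h := OU_D gam t Df x h + V t x [:: h].
Definition mild_D2 t x h k := OU_D2 gam t D2f x h k + V t x [:: h; k].

Let OU_joint := @OU_joint_cvg _ _ gam f A.

Let mild_est t : 0 <= t <= T ->
  C2a_est gam a (A + (B * T + 13 * B * schauder_constant)) (mild_sol gam f g t)
    (mild_D t) (mild_D2 t).
Proof.
move=> tT.
rewrite (_ : mild_sol gam f g t = fun x => OU gam t f x + V t x [::]); last first.
  by apply/funext => x; exact: mild_solE.
apply: C2a_estD; last exact: (mild_derivs_est gauss a01 B0 gcyl gb gholder gjoint tT).
apply: OU_est => //; first by case/andP: tT.
move=> x; apply: cvg_seq_continuous => z zx.
apply: (OU_joint (u := fun=> t)) => //.
- exact: (est_continuous fest).
- exact: (est_bound fest).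
- exact: cvg_cst.
Qed.

Lemma mild_sol_C02aH : C02aH gam T a (mild_sol gam f g) mild_D mild_D2 /\
  (C02aH_norm gam T a (mild_sol gam f g) mild_D mild_D2 <=
    (4 * (A + (B * T + 13 * B * schauder_constant)))%:E)%E.
Proof.
have le : (C02aH_norm gam T a (mild_sol gam f g) mild_D mild_D2 <=
    (4 * (A + (B * T + 13 * B * schauder_constant)))%:E)%E.
  apply: ge_ereal_sup => _ [t tT <-]; move: tT; rewrite /= in_itv/= => tT.
  exact: (C2a_est_norm_le gauss (mild_est tT)).
split => //; split.
- split.
    apply/subspace_continuousP => -[t x] [/=]; rewrite in_itv/= => tT _.
    apply: (@within_cvg_seq _ (R * X)%type _ _ (t, x)) => p pA ptx.
    have uT n : 0 <= (p n).1 <= T by have [/=] := pA n; rewrite in_itv.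
    have c1 : (p n).1 @[n --> \oo] --> t by exact: (cvg_comp _ _ ptx cvg_fst).
    have c2 : (p n).2 @[n --> \oo] --> x by exact: (cvg_comp _ _ ptx cvg_snd).
    change (mild_sol gam f g (p n).1 (p n).2 @[n --> \oo] --> mild_sol gam f g t x).
    rewrite mild_solE// (_ : (fun n => _) = fun n => OU gam (p n).1 f (p n).2 + V (p n).1 (p n).2 [::]); last first.
      by apply/funext => n; rewrite mild_solE.
    apply: cvgD; first exact: (OU_joint (est_continuous fest) (est_bound fest) c1 c2).
    exact: (mild_derivs_joint_cvg gauss gcyl gb gjoint uT tT c1 c2).
  exists (A + (B * T + 13 * B * schauder_constant)) => t x /=; rewrite in_itv/= => tT.
  exact: (est_bound (mild_est tT)).
- move=> t /=; rewrite in_itv/= => tT; exact: (C2a_est_C2aH gauss a0 (mild_est tT)).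
- by apply: le_lt_trans le _; rewrite ltry.
Qed.

End MildSolution.

(** * Sign and finiteness of the norms *)

Section NormComponents.
Context {R : realType} {X : normedModType R} (gam : probability (borel_X X) R).
Hypothesis gauss : centered_gaussian gam.
Local Notation CMH := (CM gam).

Lemma ereal_sup_ge0 (S : set (\bar R)) y : S y -> (0 <= y -> 0 <= ereal_sup S)%E.
Proof. by move=> Sy /le_trans; apply; exact: ereal_sup_ubound. Qed.

Lemma sup_norm_ge0 (f : X -> R) : (0 <= sup_norm f)%E.
Proof. by apply: (@ereal_sup_ge0 _ `|f 0|%:E); [exists 0|rewrite lee_fin]. Qed.

Lemma dual_norm_ge0 (phi : X -> R) : (0 <= dual_norm gam phi)%E.
Proof.
have [H0 n0] := CM0 gauss.
by apply: (@ereal_sup_ge0 _ `|phi 0|%:E); [exists 0; rewrite //= n0|rewrite lee_fin].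
Qed.

Lemma bil_norm_ge0 (B : X -> X -> R) : (0 <= bil_norm gam B)%E.
Proof.
have [H0 n0] := CM0 gauss.
by apply: (@ereal_sup_ge0 _ `|B 0 0|%:E); [exists (0, 0); rewrite //= n0|rewrite lee_fin].
Qed.

Lemma holder_bil_ge0 (a : R) (B : X -> X -> X -> R) h : CMH h -> h != 0 ->
  (0 <= holder_bil gam a B)%E.
Proof.
move=> Hh h0; apply: ereal_sup_ge0; first by exists (0, h).
by rewrite mule_ge0 ?bil_norm_ge0// lee_fin invr_ge0 powR_ge0.
Qed.

Lemma holder_H_ge0 (a : R) (F : X -> R) h : CMH h -> h != 0 -> (0 <= holder_H gam a F)%E.
Proof.
move=> Hh h0; apply: ereal_sup_ge0; first by exists (0, h).
by rewrite lee_fin divr_ge0 ?powR_ge0.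
Qed.

Lemma holder_bil_trivial (a : R) (B : X -> X -> X -> R) : (forall h, CMH h -> h = 0) ->
  holder_bil gam a B = -oo%E.
Proof.
move=> CM_trivial; rewrite /holder_bil (_ : [set p | _] = set0) ?image_set0 ?ereal_sup0//.
by apply/seteqP; split => // -[x h] [/= /CM_trivial ->]; rewrite eqxx.
Qed.

Lemma holder_H_trivial (a : R) (F : X -> R) : (forall h, CMH h -> h = 0) ->
  holder_H gam a F = -oo%E.
Proof.
move=> CM_trivial; rewrite /holder_H (_ : [set p | _] = set0) ?image_set0 ?ereal_sup0//.
by apply/seteqP; split => // -[x h] [/= /CM_trivial ->]; rewrite eqxx.
Qed.

Lemma ge0_fin_numP (x : \bar R) : (0 <= x)%E -> (x < +oo)%E -> exists r : R, 0 <= r /\ x = r%:E.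
Proof. by case: x => //= r r0 _; exists r. Qed.

Lemma real_upper_bound (x : \bar R) : (x < +oo)%E -> exists r : R, 0 <= r /\ (x <= r%:E)%E.
Proof.
case: x => //= [r _|_]; last by exists 0; rewrite leNye.
by exists `|r|; rewrite lee_fin ler_norm.
Qed.

End NormComponents.

Theorem mainTheorem3 (R : realType) (X : completeNormedModType R)
  (gam : probability (borel_X X) R) :
  separable_space X -> centered_gaussian gam ->
  forall (T a : R), 0 < T -> 0 < a < 1 ->
  exists C : R, 0 < C /\
    forall (f : X -> R) (Df : X -> X -> R) (D2f : X -> X -> X -> R)
           (g : R -> X -> R),
      C2aH gam a f Df D2f -> C0aH gam T a g ->
      exists (Dv : R -> X -> X -> R) (D2v : R -> X -> X -> X -> R),
        C02aH gam T a (mild_sol gam f g) Dv D2v /\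
        (C02aH_norm gam T a (mild_sol gam f g) Dv D2v
          <= C%:E * (C2aH_norm gam a f Df D2f + C0aH_norm gam T a g))%E.
Proof.
move=> sepX gauss T a T0 a01.
have a0 : 0 < a by case/andP: a01.
pose K := schauder_constant T a.
have K0 : 0 <= K by exact: schauder_constant_ge0.
(* The norm has four components, each at most A + (B T + 13 B K) when [A] and [B] bound the data;
   the constant dominates the coefficients of both. *)
have C0 : 0 < 4 * (1 + T + 13 * K) by nra.
exists (4 * (1 + T + 13 * K)); split => // f Df D2f g Hf Hg.
exists (mild_D gam Df g), (mild_D2 gam D2f g).
have [gTX Hgt Ng] := Hg.
have Hgt' t : 0 <= t <= T -> CaH gam a (g t) by move=> tT; apply: Hgt; rewrite /= in_itv.
(* Stated with real upper bounds instead of norms, so that it also covers the case where the norms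
   of the data are not real numbers. *)
have core (A B : R) : 0 <= A -> 0 <= B -> (sup_norm f <= A%:E)%E ->
    (ereal_sup (range (fun x => dual_norm gam (Df x))) <= A%:E)%E ->
    (ereal_sup (range (fun x => bil_norm gam (D2f x))) <= A%:E)%E ->
    (holder_bil gam a D2f <= A%:E)%E ->
    (forall t, 0 <= t <= T -> (sup_norm (g t) <= B%:E)%E) ->
    (forall t, 0 <= t <= T -> (holder_H gam a (g t) <= B%:E)%E) ->
    C02aH gam T a (mild_sol gam f g) (mild_D gam Df g) (mild_D2 gam D2f g) /\
    (C02aH_norm gam T a (mild_sol gam f g) (mild_D gam Df g) (mild_D2 gam D2f g)
      <= (4 * (1 + T + 13 * K) * (A + B))%:E)%E.
  move=> A0 B0 n1 n2 n3 n4 gB gH.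
  have fest := C2aH_est gauss a0 A0 Hf n1 n2 n3 n4.
  have [|||H1 H2] := mild_sol_C02aH sepX gauss a01 fest B0 gTX.
  - by move=> t x tT; move/sup_norm_leP: (gB t tT); apply.
  - by move=> t tT; have [[]] := Hgt' t tT.
  - exact: gH.
  split => //; apply: le_trans H2 _; rewrite lee_fin -/K.
  have := mulr_ge0 A0 (ltW T0); have := mulr_ge0 A0 K0.
  by move: (A * K) => AK; move: (A * T) => AT; nra.
have [[[cf [Mf bf]] _ _ [n2 n3] _] n4] := Hf.
have n1 : (sup_norm f < +oo)%E.
  by apply: (@le_lt_trans _ _ Mf%:E); [exact/sup_norm_leP|rewrite ltry].
(* If the Cameron-Martin space is trivial, the Hoelder seminorms are suprema of empty sets,
   so that both sides of the estimate are [-oo]. *)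
have [[h0 [Hh0 h00]]|CM_trivial] := pselect (exists h, CM gam h /\ h != 0); last first.
  have {}CM_trivial h : CM gam h -> h = 0.
    by move=> Hh; apply: contrapT => /eqP h0; apply: CM_trivial; exists h.
  have [r1 [r10 le1]] := real_upper_bound n1; have [r2 [r20 le2]] := real_upper_bound n2.
  have [r3 [r30 le3]] := real_upper_bound n3; have [_ [M gM]] := gTX.
  have r0 : 0 <= r1 + r2 + r3 by rewrite !addr_ge0.
  have [||||||H _] := core (r1 + r2 + r3) `|M| r0 (normr_ge0 _).
  - by apply: le_trans le1 _; rewrite lee_fin; lra.
  - by apply: le_trans le2 _; rewrite lee_fin; lra.
  - by apply: le_trans le3 _; rewrite lee_fin; lra.
  - by rewrite holder_bil_trivial ?leNye.
  - move=> t tT; apply/sup_norm_leP => x; apply: le_trans (ler_norm M).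
    by apply: gM; rewrite /= in_itv.
  - by move=> t tT; rewrite holder_H_trivial ?leNye.
  split => //; apply: ge_ereal_sup => _ [t _ <-].
  by rewrite /C2aH_norm holder_bil_trivial// addeNy leNye.
have [r1 [r10 E1]] := ge0_fin_numP (sup_norm_ge0 f) n1.
have [|r2 [r20 E2]] := ge0_fin_numP _ n2.
  by apply: (@ereal_sup_ge0 _ _ (dual_norm gam (Df 0))); [exists 0|exact: dual_norm_ge0].
have [|r3 [r30 E3]] := ge0_fin_numP _ n3.
  by apply: (@ereal_sup_ge0 _ _ (bil_norm gam (D2f 0))); [exists 0|exact: bil_norm_ge0].
have [r4 [r40 E4]] := ge0_fin_numP (holder_bil_ge0 gauss a D2f Hh0 h00) n4.
have Ef : C2aH_norm gam a f Df D2f = (r1 + r2 + r3 + r4)%:E.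
  by rewrite /C2aH_norm /C2H_norm E1 E2 E3 E4.
have gS t : 0 <= t <= T -> (0 <= sup_norm (g t))%E by move=> _; exact: sup_norm_ge0.
have gH t : (0 <= holder_H gam a (g t))%E by exact: (holder_H_ge0 _ _ Hh0 h00).
have Ngt t : 0 <= t <= T -> (CaH_norm gam a (g t) <= C0aH_norm gam T a g)%E.
  by move=> tT; apply: ereal_sup_ubound; exists t => //=; rewrite in_itv.
have [|B [B0 EB]] := ge0_fin_numP _ Ng.
  have t0 : 0 <= (0 : R) <= T by rewrite lexx ltW.
  by apply: le_trans (Ngt 0 t0); rewrite adde_ge0 ?gS.
have r0 : 0 <= r1 + r2 + r3 + r4 by rewrite !addr_ge0.
rewrite Ef EB -EFinD -EFinM; apply: core => //.
- by rewrite E1 lee_fin; lra.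
- by rewrite E2 lee_fin; lra.
- by rewrite E3 lee_fin; lra.
- by rewrite E4 lee_fin; lra.
- by move=> t tT; rewrite -EB; apply: le_trans (Ngt t tT); rewrite leeDl.
- by move=> t tT; rewrite -EB; apply: le_trans (Ngt t tT); rewrite leeDr ?gS.
Qed.
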